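(* Let $q\ge1$, let $\Delta\ge3$ be an integer, let $p<p_u(q,\Delta)$, and suppose that $\mathcal G$ is sampled uniformly at random from the (simple) $\Delta$-regular graphs on vertex set $\{1,\dots,n\}$. Let $(X^1_t)_{t\ge0}$ be the FK-dynamics on $\mathcal G$ started from the all-open configuration. Then there is a sufficiently large constant $C>0$ such that for every $v\in V(\mathcal G)$, every $k\ge1$ and every $T\ge Cn\log n$, with probability $1-\exp(-\Omega(k))-O(n^{-5})$ the random graph $\mathcal G$ is such that $$P\big(|\mathcal C_v(X_T^1)|\ge k\big)\le \exp(-\Omega(k))+O(n^{-5}),$$ where $P$ denotes probability over the FK-dynamics on the fixed graph $\mathcal G$.
   Context: $\mathcal C_v(\omega)$ is the connected component of $v$ in the graph $(V(\mathcal G),\{e:\omega(e)=1\})$. The implied constants depend only on $p,q,\Delta$; $\Omega(k)$ is standard asymptotic notation in $k$, i.e. a quantity at least $ck$ for all $k\ge k_0$, with $c>0$ and $k_0$ uniform in $n,v,T$. $n$ is such that $\Delta n$ is even. Random-cluster model: for a finite graph $G=(V,E)$, $p\in(0,1)$, $q>0$, it is the probability measure on $\omega\in\{0,1\}^E$ (subsets of $E$) given by $\pi_{G,p,q}(\omega)\propto p^{|\omega|}(1-p)^{|E|-|\omega|}q^{c(\omega)}$, where $c(\omega)$ is the number of connected components of $(V,\omega)$. FK-dynamics: from $\omega_t\subseteq E$, choose an edge $e_t\in E$ uniformly at random; set $\omega_{t+1}=\omega_t\cup\{e_t\}$ with probability $\hat p:=\frac{p}{q(1-p)+p}$ if $e_t$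 is a cut-edge in $(V,\omega_t)$ (changing its state changes the number of connected components) and with probability $p$ otherwise; otherwise set $\omega_{t+1}=\omega_t\setminus\{e_t\}$. Threshold $p_u(q,\Delta)$: let $\mathcal T_h$ be the complete tree of depth $h$ with root $\rho$ having $\Delta$ children and every other non-leaf vertex having $\Delta-1$ children, with set of leaves $\partial\mathcal T_h$. Let $\pi^1_{\mathcal T_h,p,q}$ be the random-cluster measure with wired boundary condition, i.e. all vertices of $\partial\mathcal T_h$ are identified as a single vertex when counting components. $p_u(q,\Delta)$ is the critical value such that for $p<p_u(q,\Delta)$ the $\pi^1_{\mathcal T_h,p,q}$-probability that $\rho$ is connected to $\partial\mathcal T_h$ by a path of open edges tends to $0$ as $h\to\infty$, while for $p>p_u(q,\Delta)$ it stays bounded away from $0$. *)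

(* Defs.v *)
From mathcomp Require Import all_boot all_order all_algebra.
From mathcomp Require Import boolp classical_sets reals topology normedtype.
From mathcomp Require Import sequences exp.

Set Implicit Arguments.
Unset Strict Implicit.
Unset Printing Implicit Defensive.

Import Order.TTheory GRing.Theory Num.Theory.
Import numFieldNormedType.Exports.
Local Open Scope ring_scope.

(* A simple graph on V is given by its set of edges, each edge being a        *)
(* 2-element subset of V; a configuration is a subset of the edge set.        *)
Section Graph.
Variable V : finType.
Implicit Types (E w : {set {set V}}) (B : {set V}) (v : V) (Delta : nat).

Definition simple E : bool := [forall e in E, #|e| == 2].

Definition degree E v : nat := #|[set e in E | v \in e]|.

Definition regular Delta E : bool :=
  simple E && [forall v, degree E v == Delta].

Definition adj w : rel V := [rel x y | [set x; y] \in w].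

Definition open_cluster w v : {set V} := [set x | connect (adj w) v x].

(* Identifying all the vertices of B amounts, for counting components, to     *)
(* making them pairwise adjacent; B = set0 is the free boundary condition.    *)
Definition wired_adj B w : rel V :=
  [rel x y | adj w x y || (x \in B) && (y \in B)].

Definition ncomp_wired B w : nat := n_comp (wired_adj B w) V.

Definition ncomp w : nat := n_comp (adj w) V.

Definition cut_edge w (e : {set V}) : bool := ncomp (e |: w) != ncomp (w :\ e).

End Graph.

Section RandomCluster.
Variables (R : realType) (V : finType) (p q : R).
Implicit Types (E w : {set {set V}}) (B : {set V}).

Definition rc_weight E B w : R :=
  p ^+ #|w| * (1 - p) ^+ (#|E| - #|w|) * q ^+ ncomp_wired B w.

Definition rc_prob E B (A : pred {set {set V}}) : R :=
  (\sum_(w in powerset E | A w) rc_weight E B w) /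
  (\sum_(w in powerset E) rc_weight E B w).

End RandomCluster.

Section FKDynamics.
Variables (R : realType) (V : finType) (p q : R).
Implicit Types (E w : {set {set V}}).

Definition phat : R := p / (q * (1 - p) + p).

Definition open_prob w (e : {set V}) : R := if cut_edge w e then phat else p.

Definition fk_kernel E w w' : R :=
  \sum_(e in E) #|E|%:R^-1 *
    (open_prob w e * (w' == e |: w)%:R +
     (1 - open_prob w e) * (w' == w :\ e)%:R).

Fixpoint fk_law E w0 (t : nat) w : R :=
  if t is s.+1 then \sum_w' fk_law E w0 s w' * fk_kernel E w' w
  else (w == w0)%:R.

Definition fk_prob E w0 (t : nat) (A : pred {set {set V}}) : R :=
  \sum_(w | A w) fk_law E w0 t w.

End FKDynamics.

(* The vertices of the tree of depth h are the words of length at most h      *)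
(* recording the children chosen from the root downwards: the first letter    *)
(* ranges over Delta values, the following ones over Delta - 1 values.        *)
Section Tree.
Variables (Delta h : nat).

Definition tree_vertex : finType :=
  {x : h.-bseq 'I_Delta | all (fun a : 'I_Delta => (a < Delta.-1)%N) (behead x)}.

Definition tree_word (x : tree_vertex) : seq 'I_Delta := val (val x).

Definition tree_root : tree_vertex := Sub [bseq] isT.

Definition tree_leaves : {set tree_vertex} :=
  [set x | size (tree_word x) == h].

Definition tree_child : rel tree_vertex :=
  [rel x y | [exists a, tree_word y == rcons (tree_word x) a]].

Definition tree_edges : {set {set tree_vertex}} :=
  [set [set xy.1; xy.2] | xy : tree_vertex * tree_vertex & tree_child xy.1 xy.2].

Definition root_to_leaves (w : {set {set tree_vertex}}) : bool :=
  [exists x in tree_leaves, connect (adj w) tree_root x].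

End Tree.

Section Threshold.
Variable R : realType.

Definition root_leaf_prob (q : R) (Delta : nat) (p : R) (h : nat) : R :=
  rc_prob p q (tree_edges Delta h) (tree_leaves Delta h)
    (@root_to_leaves Delta h).

(* At most one r satisfies this: for r < r' any p strictly between them       *)
(* would have root_leaf_prob both tending to and bounded away from 0.         *)
Definition is_critical (q : R) (Delta : nat) (r : R) : Prop :=
  [/\ 0 <= r <= 1,
      forall p : R, 0 < p < 1 -> p < r ->
        (root_leaf_prob q Delta p h @[h --> \oo] --> (0 : R))%classic
    & forall p : R, 0 < p < 1 -> r < p ->
        exists2 eps : R, 0 < eps & forall h, eps <= root_leaf_prob q Delta p h].

(* The default value 0 lies below every admissible p, so p < p_u q Delta with *)
(* 0 < p can only hold when p_u q Delta is the critical value.                *)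
Definition p_u (q : R) (Delta : nat) : R := xget 0 (is_critical q Delta).

End Threshold.

Section RandomRegularGraph.
Variables (R : realType) (n Delta : nat).

Definition regular_graphs : {set {set {set 'I_n}}} :=
  [set E | regular Delta E].

Definition rrg_prob (A : pred {set {set 'I_n}}) : R :=
  #|[set E in regular_graphs | A E]|%:R / #|regular_graphs|%:R.

End RandomRegularGraph.

(* One-sided, unlike the library's bigOmega, which compares norms and would   *)
(* thus allow f k = - k.                                                      *)
Definition Omega_id (R : realType) (f : nat -> R) : Prop :=
  exists2 c : R, 0 < c & exists k0 : nat, forall k, (k0 <= k)%N -> c * k%:R <= f k.

(* Main.v *)
(* The dynamics are driven by the edges e_t and, for each t, a uniform variable,
   which gives a monotone grand coupling.  For an embedded copy of the (Delta-1)-ary tree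
   of depth h, the chain that applies only the updates of its edges, with its leaves and
   its root wired together, dominates the restriction of the FK-dynamics to that copy.  Once
   the edges have been chosen often enough (C n log n steps suffice), its law is
   at most (1 + eps) times the stationary one, and chains on disjoint copies are
   independent given the sequence (e_t).

   Below p_u the wired tree measure loses its root-to-leaves connection, first at
   some p' > p, which forces (Delta-1) phat(p') <= 1 and hence
   (Delta-1) phat(p) < 1, then at p itself, so that the expected number of leaves
   joined to the root tends to 0.  Revealing the cluster of v one tree copy at a
   time is therefore dominated by a subcritical branching process, except at the
   steps which meet a cycle.  The latter are bounded in number on graphs that are
   locally almost trees; all but a proportion O(n^-5) of the regular graphs are
   so around v at scale log n, by a union bound over walks and a switching
   argument.  The exploration is cut after O(log n) steps, whence the term
   O(n^-5). *)

Require Import Defs.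
From mathcomp Require Import all_boot all_order all_algebra.
From mathcomp Require Import boolp classical_sets reals topology normedtype.
From mathcomp Require Import sequences exp.
From mathcomp Require Import fintype finset ring lra zify.

Set Implicit Arguments.
Unset Strict Implicit.
Unset Printing Implicit Defensive.

Import Order.TTheory GRing.Theory Num.Theory.
Import numFieldNormedType.Exports.
Local Open Scope ring_scope.

(** No conditional probability is formed. Each step splits the event by the final state of the next
    region chain; prescribed final states on edge-disjoint copies have probability at most a product
    of values of [lam]. A bound per state is what a product needs, hence a relative mixing error,
    which a fixed finite chain allows because every state has positive mass.

    The induction carries an exponential moment: [theta] to the number of cluster vertices with
    unrevealed edges, times a factor [rho < 1] per region still to come. As the number [N] of joined
    leaves has small mean, some [theta > 1] gives [E theta^N <= rho * theta]. A region that meets a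
    cycle may multiply this by a constant power of [theta]; a reserve of such powers, proportional
    to the allowed number of excess edges, pays for it.

    A union bound over vertex sets of logarithmic size would have too many terms. Sets are listed by
    walks tracing a spanning tree: a regular graph has at most [Delta^l] walks of length [l] from
    [v], a power of n for logarithmic [l], and every excess edge brings a factor of order 1/n. *)

(** * Component counts under the insertion of one edge *)

Section AddEdge.
Variable V : finType.
Implicit Types (r : rel V) (x y : V).

Lemma connect_invariant r (S : V -> Prop) x y :
  (forall a b, S a -> r a b -> S b) -> S x -> connect r x y -> S y.
Proof.
move=> cl Sx /connectP[s]; elim: s x Sx => [|z s IHs] x Sx /=; first by move=> _ ->.
by case/andP=> rxz ps ey; exact: (IHs z (cl _ _ Sx rxz)).
Qed.

Definition add_edge r x y : rel V :=
  [rel a b | r a b || (a == x) && (b == y) || (a == y) && (b == x)].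

Lemma add_edge_sym r x y : symmetric r -> symmetric (add_edge r x y).
Proof. move=> sr a b; rewrite /add_edge /= (sr a b).
by case: (r b a) (a == x) (a == y) (b == x) (b == y) => [] [] [] [] []. Qed.

(** Only the components of [x] and [y] can change. Their union [A] is closed for both relations, so
    both counts split along [A]: outside, the components coincide; inside, two of them become one if
    [x] and [y] were not joined. *)
Lemma n_comp_add_edge r x y : symmetric r ->
  n_comp r V = (n_comp (add_edge r x y) V + ~~ connect r x y)%N.
Proof.
move=> sr; set r' := add_edge r x y.
have cs : connect_sym r := sym_connect_sym sr.
have cs' : connect_sym r' := sym_connect_sym (add_edge_sym x y sr).
have sub a b : connect r a b -> connect r' a b.
  by apply: connect_sub => u v ruv; apply: connect1; rewrite /r' /add_edge /= ruv.
have xy' : connect r' x y by apply: connect1; rewrite /r' /add_edge /= !eqxx orbT.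
case: (boolP (connect r x y)) => [xy|nxy].
  rewrite addn0; apply: eq_n_comp => a b; apply/idP/idP; first exact: sub.
  apply: connect_sub => u v /= /orP[/orP[ruv|/andP[/eqP-> /eqP->]]|/andP[/eqP-> /eqP->]] //.
    exact: connect1.
  by rewrite cs.
pose A := [pred z | connect r x z || connect r y z].
have clA a b : r a b -> (a \in A) = (b \in A).
  move=> rab; rewrite !inE; congr (_ || _); apply: same_connect_r => //; exact: connect1.
have clA' a b : r' a b -> (a \in A) = (b \in A).
  move=> /= /orP[/orP[/clA//|/andP[/eqP-> /eqP->]]|/andP[/eqP-> /eqP->]];
  by rewrite !inE !connect0 ?orbT.
have same z : z \notin A -> connect r z =1 connect r' z.
  move=> zA b; apply/idP/idP; first exact: sub.
  move=> zb; have: (b \notin A) && connect r z b; last by case/andP.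
  apply: (connect_invariant (S := fun b => (b \notin A) && connect r z b)) zb; last by rewrite zA connect0.
  move=> u v /andP[uA zu] uv.
  have vA : v \notin A by rewrite -(clA' _ _ uv).
  rewrite vA /=; apply: connect_trans zu _; apply: connect1.
  case/orP: uv => [/orP[//|/andP[/eqP eu _]]|/andP[/eqP eu _]];
  by move: uA; rewrite eu !inE connect0 ?orbT.
(* A root is picked from its connectivity class alone, so equal classes have equal roots. *)
have eqC : n_comp r [predC A] = n_comp r' [predC A].
  rewrite /n_comp_mem; apply: eq_card => z; rewrite !inE.
  case zA: (_ || _); first by rewrite !andbF.
  rewrite !andbT /= /roots /root; congr (odflt _ _ == _); apply: eq_pick.
  by apply: same; rewrite !inE zA.
rewrite (n_compC A r) (n_compC A r') eqC addnAC; congr addn.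
have -> : n_comp r' A = 1%N.
  rewrite -(n_comp_connect cs' x); apply: eq_n_comp_r => z; rewrite !inE.
  apply/idP/idP.
    by case/orP=> /sub // yz; apply: connect_trans yz.
  move=> xz; have: z \in A; last by rewrite inE.
  apply: (connect_invariant (S := fun b => b \in A)) xz; last by rewrite /= inE connect0.
  by move=> u v /= uA /clA' <-.
transitivity (n_comp r (connect r x) + n_comp r (connect r y))%N; last by rewrite !n_comp_connect.
rewrite /n_comp_mem -cardUI [X in (_ + X)%N]eq_card0 ?addn0.
  by apply: eq_card => z; rewrite !inE /= andb_orr.
move=> z; rewrite !inE /=; apply/negP => /andP[/andP[_ xz] /andP[_ yz]].
by move/negP: nxy; apply; apply: connect_trans xz _; rewrite cs.
Qed.

End AddEdge.

Section CutEdge.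
Variable V : finType.
Implicit Types (w : {set {set V}}) (B : {set V}) (x y : V).

Lemma adj_sym w : symmetric (adj w).
Proof. by move=> a b; rewrite /adj /= (finset.setUC [set a]). Qed.

Lemma wired_adj_sym B w : symmetric (wired_adj B w).
Proof. by move=> a b; rewrite /wired_adj /= (adj_sym w a) andbC. Qed.

Lemma set2_eqP (a b x y : V) :
  ([set a; b] == [set x; y]) = (a == x) && (b == y) || (a == y) && (b == x).
Proof.
apply/eqP/idP => [/setP e|].
  move: (e a) (e b) (e x) (e y); rewrite !inE !eqxx !orbT /= !(eq_sym x) !(eq_sym y).
  by case: (a == x) (a == y) (b == x) (b == y) => [] [] [] [].
by case/orP=> /andP[/eqP-> /eqP->]; last exact: finset.setUC.
Qed.

Lemma ncomp_wired_add B w x y :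
  ncomp_wired B (w :\ [set x; y]) =
  (ncomp_wired B ([set x; y] |: w) + ~~ connect (wired_adj B (w :\ [set x; y])) x y)%N.
Proof.
rewrite /ncomp_wired (n_comp_add_edge x y (wired_adj_sym B _)); congr addn.
apply: eq_n_comp; apply: eq_connect => a b; rewrite /add_edge /wired_adj /adj /= !inE set2_eqP.
move: (a == x) (b == y) (a == y) (b == x) ([set a; b] \in w) ((a \in B) && (b \in B)).
by do 6!case.
Qed.

Lemma wired_adj0 w : wired_adj finset.set0 w =2 adj w.
Proof. by move=> a b; rewrite /wired_adj /= !inE orbF. Qed.

Lemma cut_edgeE w x y :
  cut_edge w [set x; y] = ~~ connect (adj (w :\ [set x; y])) x y.
Proof.
rewrite /cut_edge.
have ncE (u : {set {set V}}) : ncomp u = ncomp_wired finset.set0 u.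
  rewrite /ncomp /ncomp_wired.
  by apply: eq_n_comp => a b; apply: eq_connect => c d; rewrite wired_adj0.
rewrite !ncE ncomp_wired_add (eq_connect (e' := adj (w :\ [set x; y]))); last exact: wired_adj0.
by rewrite -[X in X != _]addn0 eqn_add2l; case: connect.
Qed.

End CutEdge.

(** * Configurations on a tree with wired leaves *)

Section TreeConf.

(* [ds] lists the numbers of children at depths 0, 1, ...; an edge is a position
   in the tree, identified with its lower end, and a configuration records, for
   each child of the root, the state of its edge and the configuration below. *)
Fixpoint conf (ds : seq nat) : finType :=
  if ds is D :: ds' then {ffun 'I_D -> bool * conf ds'} : finType else unit.

Fixpoint pos (ds : seq nat) : finType :=
  if ds is D :: ds' then ('I_D * option (pos ds'))%type : finType else void.

Fixpoint getc (ds : seq nat) : conf ds -> pos ds -> bool :=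
  match ds with
  | [::] => fun _ _ => false
  | D :: ds' => fun (s : {ffun 'I_D -> bool * conf ds'}) z =>
      if z.2 is Some q then getc (s z.1).2 q else (s z.1).1
  end.

Fixpoint setc (ds : seq nat) : conf ds -> pos ds -> bool -> conf ds :=
  match ds with
  | [::] => fun s _ _ => s
  | D :: ds' => fun (s : {ffun 'I_D -> bool * conf ds'}) z o =>
      [ffun i => if i == z.1 then
          (if z.2 is Some q then ((s i).1, setc (s i).2 q o) else (o, (s i).2))
        else s i]
  end.

Fixpoint mkc (ds : seq nat) : (pos ds -> bool) -> conf ds :=
  match ds with
  | [::] => fun _ => tt
  | D :: ds' => fun f => [ffun i : 'I_D => (f (i, None), mkc (fun q => f (i, Some q)))]
  end.

Lemma conf_ext ds (s s' : conf ds) : getc s =1 getc s' -> s = s'.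
Proof.
elim: ds s s' => [|D ds IH] /= s s' e; first by case: s; case: s'.
apply/ffunP => i; have e0 := e (i, None); rewrite /= in e0.
have e1 : (s i).2 = (s' i).2 by apply: IH => q; exact: (e (i, Some q)).
by case: (s i) (s' i) e0 e1 => a b [a' b'] /= -> ->.
Qed.

Lemma getc_mkc ds (f : pos ds -> bool) : getc (mkc f) =1 f.
Proof. by elim: ds f => [|D ds IH] f //= [i [q|]]; rewrite /= ffunE //= IH. Qed.

Lemma getc_setc ds (s : conf ds) z o z' :
  getc (setc s z o) z' = if z' == z then o else getc s z'.
Proof.
elim: ds s z z' => [|D ds IH] //= s [i oz] [j oz'] /=; rewrite ffunE /= xpair_eqE.
case: (eqVneq j i) => [->|//] /=.
by case: oz oz' => [q|] [q'|] //=; rewrite IH.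
Qed.

Lemma setc_getc ds (s : conf ds) z : setc s z (getc s z) = s.
Proof. by apply: conf_ext => z'; rewrite getc_setc; case: eqP => // ->. Qed.

Lemma setc_setc ds (s : conf ds) z o o' : setc (setc s z o) z o' = setc s z o'.
Proof. by apply: conf_ext => z'; rewrite !getc_setc; case: eqP. Qed.

Fixpoint conn (ds : seq nat) : conf ds -> bool :=
  match ds with
  | [::] => fun _ => true
  | D :: ds' => fun s : {ffun 'I_D -> bool * conf ds'} =>
      [exists i, (s i).1 && conn (s i).2]
  end.

(* [noncut u s z] tells whether, in [s] with [z] removed, both ends of the edge
   [z] are joined to the wired vertex, the root being wired if [u] holds. *)
Fixpoint noncut (ds : seq nat) : bool -> conf ds -> pos ds -> bool :=
  match ds with
  | [::] => fun _ _ _ => false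
  | D :: ds' => fun u (s : {ffun 'I_D -> bool * conf ds'}) z =>
      let u' := u || [exists j, [&& j != z.1, (s j).1 & conn (s j).2]] in
      if z.2 is Some q then noncut ((s z.1).1 && u') (s z.1).2 q
      else u' && conn (s z.1).2
  end.

Lemma noncut_setc ds u (s : conf ds) z o : noncut u (setc s z o) z = noncut u s z.
Proof.
elim: ds u s z => [|D ds IH] //= u s [i oz] /=.
have -> : [exists j, [&& j != i, (setc (ds := D :: ds) s (i, oz) o j).1
            & conn (setc (ds := D :: ds) s (i, oz) o j).2]] =
          [exists j, [&& j != i, (s j).1 & conn (s j).2]].
  by apply: eq_existsb => j; rewrite /= ffunE /=; case: eqP.
by rewrite /= ffunE eqxx /=; case: oz => [q|] //=; rewrite IH.
Qed.

Fixpoint nleaf (ds : seq nat) : conf ds -> nat :=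
  match ds with
  | [::] => fun _ => 1%N
  | D :: ds' => fun s : {ffun 'I_D -> bool * conf ds'} =>
      (\sum_i (s i).1 * nleaf (s i).2)%N
  end.

End TreeConf.

Section TreeWeight.
Variables (R : realType) (p q : R).
Hypotheses (hq : 1 <= q) (hp : 0 < p < 1).

Let q0 : 0 < q. Proof. exact: lt_le_trans hq. Qed.
Let p0 : 0 < p. Proof. by case/andP: hp. Qed.
Let p1 : 0 < 1 - p. Proof. by case/andP: hp; rewrite subr_gt0. Qed.

(* The random-cluster weight where a component containing a leaf counts for
   nothing and the component of the root is not counted at all ([wtw] counts it,
   unless the root is wired); a closed edge thus pays [q] when the component
   below it misses the leaves. *)
Fixpoint wt (ds : seq nat) : conf ds -> R :=
  match ds with
  | [::] => fun _ => 1
  | D :: ds' => fun s : {ffun 'I_D -> bool * conf ds'} =>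
      \prod_i ((if (s i).1 then p else (1 - p) * (if conn (s i).2 then 1 else q))
               * wt (s i).2)
  end.

Definition wtw ds u (s : conf ds) : R := wt s * (if u || conn s then 1 else q).

Lemma wt_gt0 ds (s : conf ds) : 0 < wt s.
Proof.
elim: ds s => [|D ds IH] /= s; first exact: ltr01.
apply: prodr_gt0 => i _; rewrite mulr_gt0 //.
by case: ifP => // _; rewrite mulr_gt0 //; case: ifP.
Qed.

Lemma wtw_gt0 ds u (s : conf ds) : 0 < wtw u s.
Proof. by rewrite mulr_gt0 ?wt_gt0 //; case: ifP. Qed.

Lemma wtw_true ds (s : conf ds) : wtw true s = wt s.
Proof. by rewrite /wtw /= mulr1. Qed.

Lemma conn_cons D ds (s : conf (D :: ds)) (i : 'I_D) :
  conn s = (s i).1 && conn (s i).2 || [exists j, [&& j != i, (s j).1 & conn (s j).2]].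
Proof.
rewrite /=; apply/existsP/orP => [[j sj]|[si|/existsP[j /and3P[_ h1 h2]]]].
- case: (eqVneq j i) sj => [->|ji] sj; first by left.
  by right; apply/existsP; exists j; rewrite ji.
- by exists i.
- by exists j; rewrite h1.
Qed.

(** Here [u'] tells whether the root is wired, or joined to a leaf, without branch [i]. If edge [i]
    is open, the common component of its ends is charged to the subtree, wired when [u'] holds; if
    it is closed, the component of the root is charged to the edge and the lower one to the
    subtree. *)
Lemma wtw_cons D ds u (s : conf (D :: ds)) (i : 'I_D) :
  let u' := u || [exists j, [&& j != i, (s j).1 & conn (s j).2]] in
  wtw u s = (\prod_(j | j != i)
    ((if (s j).1 then p else (1 - p) * (if conn (s j).2 then 1 else q)) * wt (s j).2)) *
    ((if (s i).1 then p else (1 - p) * (if u' then 1 else q)) * wtw ((s i).1 && u') (s i).2).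
Proof.
move=> u'; rewrite /wtw (conn_cons s i) /= (bigD1 i) //= -/u'.
rewrite orbCA -/u' orbC.
case: (s i) => [si s2] /=.
case: si; case: u'; case: (conn s2) => /=; ring.
Qed.

(** Detailed balance for one edge: closing [z] creates a new component counted by [q] exactly when
    its ends are not both joined to the wired vertex. By [wtw_cons] the levels above [z] contribute
    equal factors to both sides. *)
Lemma wtw_ratio ds u (s : conf ds) z :
  wtw u (setc s z true) * ((1 - p) * (if noncut u s z then 1 else q)) =
  wtw u (setc s z false) * p.
Proof.
elim: ds u s z => [|D ds IH] //= u s [i oz].
rewrite !(wtw_cons _ _ i).
set u' := u || [exists j, [&& j != i, (s j).1 & conn (s j).2]].
have e o : u || [exists j, [&& j != i, (setc (ds := D :: ds) s (i, oz) o j).1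
            & conn (setc (ds := D :: ds) s (i, oz) o j).2]] = u'.
  rewrite /u'; congr orb; apply: eq_existsb => j; rewrite /= ffunE /=.
  by case: eqP.
rewrite /= in e; rewrite /= !e.
have eP o : \prod_(j | j != i)
    ((if (setc (ds := D :: ds) s (i, oz) o j).1 then p else
       (1 - p) * (if conn (setc (ds := D :: ds) s (i, oz) o j).2 then 1 else q))
       * wt (setc (ds := D :: ds) s (i, oz) o j).2) =
   \prod_(j | j != i)
    ((if (s j).1 then p else (1 - p) * (if conn (s j).2 then 1 else q)) * wt (s j).2).
  by apply: eq_bigr => j /negPf ji; rewrite /= ffunE /= ji.
rewrite /= in eP; rewrite !eP !ffunE !eqxx /=.
set P := \prod_(j | _) _; rewrite -!mulrA; congr (P * _).
case: oz {e eP P} => [z|] /=.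
  by congr (_ * _); move: (IH ((s i).1 && u') (s i).2 z); rewrite /wtw -!mulrA.
rewrite /wtw; case: u'; case: (conn (s i).2) => /=; ring.
Qed.

End TreeWeight.

(** * The grand coupling *)

Section Expectation.
Variables (R : realType) (p q : R).
Hypotheses (hq : 1 <= q) (hp : 0 < p < 1).

Let q0 : 0 < q. Proof. exact: lt_le_trans hq. Qed.
Let p0 : 0 < p. Proof. by case/andP: hp. Qed.
Let p1 : 0 < 1 - p. Proof. by case/andP: hp; rewrite subr_gt0. Qed.
Let k0 : 0 < q * (1 - p) + p. Proof. by rewrite addr_gt0 ?mulr_gt0. Qed.

Lemma phat_gt0 : 0 < phat p q. Proof. by rewrite divr_gt0. Qed.

(** This makes the dynamics monotone, and the weight of [None] below nonnegative. *)
Lemma phat_le : phat p q <= p.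
Proof.
rewrite ler_pdivrMr // ler_pMr //.
have : 0 <= (q - 1) * (1 - p) by apply: mulr_ge0; [rewrite subr_ge0|exact: ltW].
by move=> ?; lra.
Qed.

(* A heat-bath update reveals [Some o] when its uniform variable sets the edge
   to [o] whatever the configuration, and [None] when the edge has to be opened
   exactly if it is not a cut-edge. *)
Definition uw (u : option bool) : R :=
  match u with Some true => phat p q | Some false => 1 - p | None => p - phat p q end.

Lemma uw_ge0 u : 0 <= uw u.
Proof.
by case: u => [[]|] /=; [exact: ltW phat_gt0|exact: ltW|rewrite subr_ge0 phat_le].
Qed.

Lemma sum_option_bool (F : option bool -> R) :
  \sum_u F u = F None + F (Some true) + F (Some false).
Proof.
rewrite (bigD1 None) //= (bigD1 (Some true)) //= (bigD1 (Some false)) //=.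
by rewrite big1 ?addr0 ?addrA // => -[[]|].
Qed.

Lemma sum_uw : \sum_u uw u = 1.
Proof. by rewrite sum_option_bool /=; ring. Qed.

Variable X : Type.
Implicit Types (s : seq X) (F H : seq (X * option bool) -> R).

(* [Eu s F] averages over the update variables along the edge sequence [s],
   while [Av] below averages over the sequences of edges. *)
Fixpoint Eu s F : R :=
  if s is e :: s' then \sum_u uw u * Eu s' (fun o => F ((e, u) :: o)) else F [::].

Lemma Eu_le s F H : (forall o, [seq x.1 | x <- o] = s -> F o <= H o) -> Eu s F <= Eu s H.
Proof.
elim: s F H => [|e s IH] F H le /=; first exact: le.
apply: ler_sum => u _; apply: ler_wpM2l; first exact: uw_ge0.
by apply: IH => o eo; apply: le; rewrite /= eo.
Qed.

Lemma eq_Eu s F H : (forall o, [seq x.1 | x <- o] = s -> F o = H o) -> Eu s F = Eu s H.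
Proof. by move=> e; apply/eqP; rewrite eq_le !Eu_le // => o /e ->. Qed.

Lemma Eu_cst s a : Eu s (fun=> a) = a.
Proof.
elim: s => [|e s IH] //=; rewrite -[RHS]mul1r -sum_uw mulr_suml.
by apply: eq_bigr => u _; rewrite IH.
Qed.

Lemma Eu_sum (I : finType) s (F : I -> seq (X * option bool) -> R) :
  Eu s (fun o => \sum_i F i o) = \sum_i Eu s (F i).
Proof.
elim: s F => [|e s IH] F //=; rewrite exchange_big /=.
by apply: eq_bigr => u _; rewrite IH mulr_sumr.
Qed.

Lemma Eu_ge0 s F : (forall o, [seq x.1 | x <- o] = s -> 0 <= F o) -> 0 <= Eu s F.
Proof. by move=> h; rewrite -(Eu_cst s 0); apply: Eu_le. Qed.

(** For a fixed edge sequence the update variables are independent, so functionals of complementary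
    classes of edges factorise. Invariance under filtering expresses that a functional reads one
    class only. *)
Lemma Eu_indep s (a : pred X) F H :
  (forall o, F o = F [seq x <- o | a x.1]) ->
  (forall o, H o = H [seq x <- o | ~~ a x.1]) ->
  Eu s (fun o => F o * H o) = Eu s F * Eu s H.
Proof.
elim: s F H => [|e s IH] F H hF hH //=.
case ae: (a e).
  have eH u o : H ((e, u) :: o) = H o by rewrite hH /= ae /= -hH.
  under eq_bigr => u _ do under eq_Eu => o _ do rewrite eH.
  have -> : \sum_u uw u * Eu s (fun o => H ((e, u) :: o)) = Eu s H.
    under eq_bigr => u _ do under eq_Eu => o _ do rewrite eH.
    by rewrite -mulr_suml sum_uw mul1r.
  rewrite mulr_suml; apply: eq_bigr => u _; rewrite -mulrA; congr (_ * _).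
  by apply: IH => // o; rewrite hF /= ae [in RHS]hF /= ae filter_id.
have eF u o : F ((e, u) :: o) = F o by rewrite hF /= ae /= -hF.
under eq_bigr => u _ do under eq_Eu => o _ do rewrite eF.
have -> : \sum_u uw u * Eu s (fun o => F ((e, u) :: o)) = Eu s F.
  under eq_bigr => u _ do under eq_Eu => o _ do rewrite eF.
  by rewrite -mulr_suml sum_uw mul1r.
rewrite mulr_sumr; apply: eq_bigr => u _; rewrite mulrCA; congr (_ * _).
by apply: IH => // o; rewrite hH /= ae /= [in RHS]hH /= ae /= filter_id.
Qed.

End Expectation.

Section GrandCoupling.
Variables (R : realType) (V : finType) (p q : R).
Hypotheses (hq : 1 <= q) (hp : 0 < p < 1).
Implicit Types (E w : {set {set V}}).

Definition fk_upd w (x : {set V} * option bool) : {set {set V}} :=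
  if (if x.2 is Some o then o else ~~ cut_edge w x.1) then x.1 |: w else w :\ x.1.

Fixpoint Av E (T : nat) (g : seq {set V} -> R) : R :=
  if T is T'.+1 then \sum_(e in E) #|E|%:R^-1 * Av E T' (fun s => g (e :: s))
  else g [::].

Lemma Av_le E T g h :
  (forall s, size s = T -> all (fun e => e \in E) s -> g s <= h s) -> Av E T g <= Av E T h.
Proof.
elim: T g h => [|T IH] g h le /=; first exact: le.
apply: ler_sum => e eE; apply: ler_wpM2l; first by rewrite invr_ge0.
by apply: IH => s sz sE; apply: le; rewrite /= ?sz ?eE.
Qed.

Lemma Av_cst E T a : (0 < #|E|)%N -> Av E T (fun=> a) = a.
Proof.
move=> E0; elim: T => [|T IH] //=.
rewrite IH sumr_const -mulrnAl -[_ *+ _]mulr_natr mulVf ?mul1r //.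
by rewrite pnatr_eq0 -lt0n.
Qed.

Lemma Av_lin E T a g h :
  Av E T (fun s => a * g s + h s) = a * Av E T g + Av E T h.
Proof.
elim: T g h => [|T IH] g h //=.
rewrite mulr_sumr -big_split; apply: eq_bigr => e _ /=; rewrite IH; ring.
Qed.

Lemma Av_sum (I : finType) E T (a : I -> R) (g : I -> seq {set V} -> R) :
  Av E T (fun s => \sum_i a i * g i s) = \sum_i a i * Av E T (g i).
Proof.
elim: T g => [|T IH] g //=.
under eq_bigr => e _ do rewrite IH mulr_sumr.
rewrite exchange_big; apply: eq_bigr => i _ /=; rewrite mulr_sumr.
by apply: eq_bigr => e _; rewrite mulrCA.
Qed.

(** [fk_law] adds the last step while [Av] and [Eu] peel off the first one; the iterates of the
    one-step operator [K] connect the two orders. *)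
Lemma fk_law_Av E w0 T (f : {set {set V}} -> R) :
  \sum_w fk_law p q E w0 T w * f w =
  Av E T (fun s => Eu p q s (fun o => f (foldl fk_upd w0 o))).
Proof.
pose K (h : {set {set V}} -> R) w := \sum_w' fk_kernel p q E w w' * h w'.
have stepE h w : K h w =
    \sum_(e in E) #|E|%:R^-1 * \sum_u uw p q u * h (fk_upd w (e, u)).
  rewrite /K /fk_kernel.
  under eq_bigr => w' _ do rewrite mulr_suml.
  rewrite exchange_big; apply: eq_bigr => e _ /=.
  under eq_bigr => w' _ do rewrite -mulrA.
  rewrite -mulr_sumr; congr (_ * _).
  transitivity (\sum_w' (open_prob p q w e * ((w' == e |: w)%:R * h w') +
      (1 - open_prob p q w e) * ((w' == w :\ e)%:R * h w'))).
    by apply: eq_bigr => w' _; ring.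
  rewrite big_split /= -!mulr_sumr.
  have one w1 : \sum_w' (w' == w1)%:R * h w' = h w1.
    rewrite (bigD1 w1) //= eqxx mul1r big1 ?addr0 // => w' /negPf ->.
    by rewrite mul0r.
  rewrite !one sum_option_bool /fk_upd /= /open_prob.
  by case: ifP => _ /=; ring.
have iterE : \sum_w fk_law p q E w0 T w * f w = iter T K f w0.
  elim: T f => [|T IH] f /=.
    rewrite (bigD1 w0) //= eqxx mul1r big1 ?addr0 // => w /negPf ->.
    by rewrite mul0r.
  rewrite -iterS iterSr -IH.
  under eq_bigr => w _ do rewrite mulr_suml.
  rewrite exchange_big; apply: eq_bigr => w' _ /=; rewrite /K mulr_sumr.
  by apply: eq_bigr => w _; rewrite mulrA.
rewrite iterE; elim: T w0 {iterE} => [|T IH] w0 //=.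
rewrite stepE; apply: eq_bigr => e _; congr (_ * _).
under eq_bigr => u _ do rewrite IH.
by rewrite -Av_sum.
Qed.

Lemma fk_prob_Av E T w0 (A : pred {set {set V}}) :
  fk_prob p q E w0 T A =
  Av E T (fun s => Eu p q s (fun o => (A (foldl fk_upd w0 o))%:R)).
Proof.
rewrite -(fk_law_Av E w0 T (fun w => (A w)%:R)) /fk_prob big_mkcond /=.
by apply: eq_bigr => w _; case: (A w); rewrite ?mulr1 ?mulr0.
Qed.

End GrandCoupling.

(** * Mixing of the chain on a tree region *)

Section RegionChain.
Variables (R : realType) (p q : R).
Hypotheses (hq : 1 <= q) (hp : 0 < p < 1).

Let q0 : 0 < q. Proof. exact: lt_le_trans hq. Qed.
Let p0 : 0 < p. Proof. by case/andP: hp. Qed.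
Let p1 : 0 < 1 - p. Proof. by case/andP: hp; rewrite subr_gt0. Qed.
Let k0 : 0 < q * (1 - p) + p. Proof. by rewrite addr_gt0 ?mulr_gt0. Qed.

Variable ds : seq nat.
Implicit Types (c y : conf ds) (z : pos ds).

Definition updc c z (u : option bool) : conf ds :=
  setc c z (if u is Some o then o else noncut true c z).

(** Reversibility: an update at [z] only moves between a state and its [flip], and [wtw_ratio] says
    that the two flows are equal. *)
Lemma heat_bath_stationary z (h : conf ds -> R) :
  \sum_c wt p q c * (\sum_u uw p q u * h (updc c z u)) = \sum_c wt p q c * h c.
Proof.
pose op c := if noncut true c z then p else phat p q.
pose flip c := setc c z (~~ getc c z).
have flipK : involutive flip.
  move=> c; rewrite /flip setc_setc getc_setc eqxx negbK; exact: setc_getc.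
pose rate c := if getc c z then 1 - op c else op c.
have opF c o : op (setc c z o) = op c by rewrite /op noncut_setc.
have balance c : wt p q (setc c z true) * (1 - op c) = wt p q (setc c z false) * op c.
  have := wtw_ratio p q true c z; rewrite !wtw_true /op.
  case: ifP => _; first by rewrite mulr1.
  move=> e; apply: (mulIf (lt0r_neq0 k0)); rewrite -!mulrA.
  have -> : (1 - phat p q) * (q * (1 - p) + p) = (1 - p) * q.
    by rewrite /phat; field; rewrite lt0r_neq0.
  by rewrite e /phat; congr (_ * _); field; rewrite lt0r_neq0.
have rev c : wt p q c * rate c = wt p q (flip c) * rate (flip c).
  rewrite /flip /rate getc_setc eqxx opF.
  have ec := setc_getc c z; case: (getc c z) ec => /= ec; first by rewrite -balance ec.
  by rewrite balance ec.
have stepE c : \sum_u uw p q u * h (updc c z u) = h c + rate c * (h (flip c) - h c).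
  rewrite sum_option_bool /updc /flip /rate /op /=.
  have ec := setc_getc c z; case: (getc c z) ec => /= ec;
    case: (noncut true c z); rewrite ec; ring.
under eq_bigr => c _ do rewrite stepE mulrDr.
rewrite big_split /= -[RHS]addr0; congr (_ + _).
under eq_bigr => c _ do rewrite mulrA mulrBr.
rewrite big_split /= sumrN; apply/eqP; rewrite subr_eq0; apply/eqP.
rewrite (reindex_inj (inv_inj flipK)) /=; apply: eq_bigr => c _.
by rewrite flipK -rev.
Qed.

Variables (X : eqType) (m : X -> option (pos ds)).
Implicit Types s : seq X.

Definition updm c (x : X * option bool) : conf ds :=
  if m x.1 is Some z then updc c z x.2 else c.

(* Starting from [c], the probability of being at [y] after the updates along
   [s], those of edges outside the region (where [m] is [None]) being ignored. *)
Definition hit s c y : R := Eu p q s (fun o => (foldl updm c o == y)%:R).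

Lemma hit_cons e s c y : hit (e :: s) c y = \sum_u uw p q u * hit s (updm c (e, u)) y.
Proof. by []. Qed.

Lemma hit_ge0 s c y : 0 <= hit s c y.
Proof. by apply: Eu_ge0 => // o _; case: eqP => _ /=. Qed.

Lemma sum_hit s c : \sum_y hit s c y = 1.
Proof.
rewrite -Eu_sum // -[RHS](Eu_cst p q s 1); apply: eq_Eu => // o _.
by rewrite (bigD1 (foldl updm c o)) //= eqxx big1 ?addr0 // => y /negPf; rewrite eq_sym => ->.
Qed.

Lemma hit_cat s s' c y : hit (s ++ s') c y = \sum_c' hit s c c' * hit s' c' y.
Proof.
elim: s c => [|e s IH] c.
  rewrite (bigD1 c) //= /hit /= eqxx mul1r big1 ?addr0 // => c' /negPf.
  by rewrite eq_sym => ->; rewrite mul0r.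
rewrite cat_cons [LHS]hit_cons; under eq_bigr => u _ do rewrite IH mulr_sumr.
rewrite exchange_big; apply: eq_bigr => c' _ /=; rewrite hit_cons mulr_suml.
by apply: eq_bigr => u _; rewrite mulrA.
Qed.

Lemma hit_stationary s y : \sum_c wt p q c * hit s c y = wt p q y.
Proof.
elim: s => [|e s IH].
  rewrite /hit /= (bigD1 y) //= eqxx mulr1 big1 ?addr0 // => c' /negPf ->.
  by rewrite mulr0.
rewrite -[RHS]IH; under eq_bigr => c _ do rewrite hit_cons.
rewrite /updm /=; case: (m e) => [z|]; first exact: (heat_bath_stationary z (hit s ^~ y)).
by apply: eq_bigr => c _; rewrite -mulr_suml sum_uw // mul1r.
Qed.

Definition seen s : {set pos ds} := [set z | has (fun e => m e == Some z) s].

Definition umin : R := Num.min (phat p q) (1 - p).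

Lemma umin_gt0 : 0 < umin.
Proof. by rewrite lt_min p1 phat_gt0. Qed.

Lemma umin_le1 : umin <= 1.
Proof. by rewrite /umin ge_min; apply/orP; right; rewrite lerBlDr lerDl ltW. Qed.

(** Only the last update of each position matters. It is required to impose the value in [y]
    unconditionally, at cost [umin]; the earlier ones are arbitrary. *)
Lemma hit_lb s c y : (forall z, z \notin seen s -> getc c z = getc y z) ->
  umin ^+ #|seen s| <= hit s c y.
Proof.
elim: s c => [|e s IH] c agree.
  rewrite (_ : seen [::] = finset.set0); last by apply/setP => z; rewrite !inE.
  rewrite cards0 /hit /= (_ : c = y) ?eqxx //.
  by apply: conf_ext => z; apply: agree; rewrite !inE.
rewrite hit_cons /updm /=; case me: (m e) => [z0|]; last first.
  rewrite -mulr_suml sum_uw // mul1r.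
  have -> : seen (e :: s) = seen s by apply/setP => z; rewrite !inE /= me.
  by apply: IH => z zs; apply: agree; move: zs; rewrite !inE /= me.
have eS : seen (e :: s) = z0 |: seen s.
  by apply/setP => z; rewrite !inE /= me eq_sym (inj_eq Some_inj) eq_sym.
case z0s: (z0 \in seen s).
  have eS' : seen (e :: s) = seen s by rewrite eS; apply/finset.setUidPr; rewrite sub1set.
  rewrite eS' in agree *.
  rewrite -[leLHS]mul1r -(sum_uw p q) mulr_suml; apply: ler_sum => u _.
  apply: ler_wpM2l; first exact: uw_ge0.
  apply: IH => z zs; rewrite getc_setc; case: eqP => [ez|_]; last exact: agree.
  by rewrite ez z0s in zs.
rewrite eS cardsU1 z0s exprS.
apply: le_trans (_ : uw p q (Some (getc y z0)) * hit s (updc c z0 (Some (getc y z0))) y <= _).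
  apply: ler_pM.
  - exact: ltW umin_gt0.
  - by rewrite exprn_ge0 // ltW // umin_gt0.
  - by rewrite /umin; case: (getc y z0) => /=; rewrite ge_min lexx ?orbT.
  apply: IH => z zs; rewrite /updc getc_setc; case: eqP => [->//|/eqP zz0].
  by apply: agree; rewrite eS !inE negb_or zz0; move: zs; rewrite inE.
rewrite (bigD1 (Some (getc y z0))) //= lerDl; apply: sumr_ge0 => u _.
by rewrite mulr_ge0 ?uw_ge0 ?hit_ge0.
Qed.

Definition minor : R := umin ^+ #|pos ds|.

Lemma minor_gt0 : 0 < minor. Proof. by rewrite exprn_gt0 // umin_gt0. Qed.

Lemma minor_le1 : minor <= 1.
Proof. by rewrite exprn_ile1 ?umin_le1 // ltW // umin_gt0. Qed.

Definition covers s := [forall z, has (fun e => m e == Some z) s].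

Lemma hit_lb_covers s c y : covers s -> minor <= hit s c y.
Proof.
move/forallP=> cov; have -> : minor = umin ^+ #|seen s|.
  by congr (_ ^+ _); rewrite -cardsT; congr #|pred_of_set _|; apply/setP => z; rewrite !inE cov.
by apply: hit_lb => z; rewrite inE cov.
Qed.

(** From any start a covering block gives mass at least [minor] to a minimiser of [h], which pulls
    the average below the maximum by that share of the oscillation. *)
Lemma doeblin s (h : conf ds -> R) (del : R) : covers s ->
  (forall c c', h c - h c' <= del) ->
  forall c c', \sum_y hit s c y * h y - \sum_y hit s c' y * h y <= (1 - minor) * del.
Proof.
move=> cov osc c c'.
have [y1 _ max1] := @arg_maxP _ _ _ c xpredT h isT.
have [y0 _ min0] := @arg_minP _ _ _ c xpredT h isT.
have hi : \sum_y hit s c y * h y <= h y1 - minor * (h y1 - h y0).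
  rewrite lerBrDl -lerBrDr.
  have -> : h y1 - \sum_y hit s c y * h y = \sum_y hit s c y * (h y1 - h y).
    under [RHS]eq_bigr => y _ do rewrite mulrBr.
    by rewrite big_split /= sumrN -mulr_suml sum_hit mul1r.
  rewrite (bigD1 y0) //= -[leLHS]addr0; apply: lerD.
    by apply: ler_wpM2r; [rewrite subr_ge0; exact: max1|exact: hit_lb_covers].
  apply: sumr_ge0 => y _; rewrite mulr_ge0 ?hit_ge0 // subr_ge0; exact: max1.
have lo : h y0 <= \sum_y hit s c' y * h y.
  rewrite -[leLHS]mul1r -(sum_hit s c') mulr_suml; apply: ler_sum => y _.
  by apply: ler_wpM2l; [exact: hit_ge0|exact: min0].
apply: le_trans (lerB hi lo) _.
have -> : h y1 - minor * (h y1 - h y0) - h y0 = (1 - minor) * (h y1 - h y0) by ring.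
by apply: ler_wpM2l; [rewrite subr_ge0 minor_le1|exact: osc].
Qed.

Lemma hit_blocks ss s c c' y : all covers ss ->
  hit (flatten ss ++ s) c y - hit (flatten ss ++ s) c' y <= (1 - minor) ^+ size ss.
Proof.
elim: ss c c' => [|s1 ss IH] c c' /=.
  move=> _; apply: le_trans (_ : hit s c y <= _).
    by rewrite gerBl hit_ge0.
  rewrite expr0 -(sum_hit s c) (bigD1 y) //= lerDl; apply: sumr_ge0 => y' _; exact: hit_ge0.
case/andP=> cov /IH{}IH; rewrite -catA !hit_cat exprS.
exact: doeblin.
Qed.

(** Stationarity makes the target mass an average of [hit] over starting states, and [hit_blocks]
    compares each of them with [c]. *)
Lemma hit_near_stationary ss s c y : all covers ss ->
  hit (flatten ss ++ s) c y <=
  wt p q y / (\sum_(c' : conf ds) wt p q c') + (1 - minor) ^+ size ss.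
Proof.
move=> cov; rewrite -(hit_stationary (flatten ss ++ s) y).
have Z0 : 0 < \sum_(c' : conf ds) wt p q c'.
  rewrite (bigD1 c) //= ltr_wpDr ?wt_gt0 //.
  by apply: sumr_ge0 => c' _; apply: ltW; exact: wt_gt0.
rewrite -lerBlDl -(ler_pM2r Z0) mulrBl divfK ?lt0r_neq0 // !mulr_sumr -sumrB.
apply: ler_sum => c' _; rewrite mulrC -mulrBr [leRHS]mulrC.
by apply: ler_wpM2l; [exact: ltW (wt_gt0 hq hp _)|exact: hit_blocks].
Qed.

End RegionChain.

(** The additive error, once below [eps] times the least stationary mass, is a relative one. The
    number [b] of blocks depends on the shape [ds] only, hence is uniform in the graph and in the
    region. *)
Lemma near_stationary_ratio (R : realType) (p q : R) (hq : 1 <= q) (hp : 0 < p < 1)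
    (ds : seq nat) (eps : R) : 0 < eps ->
  exists b : nat, forall (X : eqType) (m : X -> option (pos ds)) ss s c y,
    size ss = b -> all (covers m) ss ->
    hit p q m (flatten ss ++ s) c y <=
    (1 + eps) * (wt p q y / (\sum_(c' : conf ds) wt p q c')).
Proof.
move=> eps0.
pose Z := \sum_(c' : conf ds) wt p q c'.
have Z0 : 0 < Z.
  rewrite /Z (bigD1 (mkc xpredT)) //= ltr_wpDr ?wt_gt0 //.
  by apply: sumr_ge0 => c' _; apply: ltW; exact: wt_gt0.
have [y0 _ min0] := @arg_minP _ _ _ (mkc xpredT : conf ds) xpredT (fun y => wt p q y / Z) isT.
have e0 : 0 < eps * (wt p q y0 / Z) by rewrite mulr_gt0 // divr_gt0 // wt_gt0.
have k1 : `|1 - minor p q ds| < 1.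
  rewrite ger0_norm ?subr_ge0 ?minor_le1 // ltrBlDr ltrDl; exact: minor_gt0.
have /cvgrPdist_lt cv := cvg_expr k1.
have [b _ hb] := cv _ e0.
exists b => X m ss s c y sz cov.
apply: le_trans (hit_near_stationary hq hp s c y cov) _.
rewrite mulrDl mul1r lerD2l sz.
have := hb b (leqnn b); rewrite /= sub0r normrN ger0_norm; last first.
  by rewrite exprn_ge0 // subr_ge0 minor_le1.
move/ltW/le_trans; apply; rewrite ler_pM2l //; exact: min0.
Qed.

(** * Subcriticality of the wired tree *)

Section TreeSums.
Variables (R : realType) (p q : R).
Implicit Types ds : seq nat.

Definition tot ds : R := \sum_(c : conf ds) wt p q c.
Definition tot0 ds : R := \sum_(c : conf ds) wt p q c * (~~ conn c)%:R.
Definition totN ds : R := \sum_(c : conf ds) wt p q c * (nleaf c)%:R.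
(** The total weight of one branch at the root; [brt0] is the part in which the branch joins the
    root to no leaf. *)
Definition brt ds : R := p * tot ds + (1 - p) * (tot ds + (q - 1) * tot0 ds).
Definition brt0 ds : R := p * tot0 ds + (1 - p) * (tot ds + (q - 1) * tot0 ds).

Let F ds (x : bool * conf ds) : R :=
  (if x.1 then p else (1 - p) * (if conn x.2 then 1 else q)) * wt p q x.2.

Lemma sum_bool_pair (T : finType) (G : bool * T -> R) :
  \sum_x G x = \sum_t G (true, t) + \sum_t G (false, t).
Proof.
transitivity (\sum_x G (x.1, x.2)); first by apply: eq_bigr => -[].
by rewrite -(pair_bigA _ (fun a b => G (a, b))) /= big_bool.
Qed.

Lemma tot_unwired ds : \sum_(c : conf ds) wt p q c * (if conn c then 1 else q) =
  tot ds + (q - 1) * tot0 ds.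
Proof.
rewrite /tot /tot0 mulr_sumr -big_split; apply: eq_bigr => c _ /=.
by case: (conn c) => /=; ring.
Qed.

Lemma sumF ds : \sum_x F (x : bool * conf ds) = brt ds.
Proof.
rewrite sum_bool_pair /F /= -mulr_sumr; congr (_ + _).
rewrite -tot_unwired mulr_sumr; apply: eq_bigr => c _; rewrite -!mulrA; congr (_ * _); exact: mulrC.
Qed.

Lemma tot_cons D ds : tot (D :: ds) = brt ds ^+ D.
Proof.
rewrite /tot /= -(bigA_distr_bigA (fun (i : 'I_D) x => F x)) /=.
by rewrite prodr_const card_ord sumF.
Qed.

Lemma tot0_cons D ds : tot0 (D :: ds) = brt0 ds ^+ D.
Proof.
pose G (x : bool * conf ds) := F x * (~~ (x.1 && conn x.2))%:R.
transitivity (\sum_(c : {ffun 'I_D -> bool * conf ds}) \prod_i G (c i)).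
  apply: eq_bigr => c _; rewrite [RHS]big_split /=; congr (_ * _).
  case: (boolP [exists _, _]) => [/existsP[i ci]|/existsPn h] /=.
    by rewrite (bigD1 i) //= ci mul0r.
  by rewrite big1 // => i _; rewrite h.
rewrite -(bigA_distr_bigA (fun (i : 'I_D) x => G x)) /= prodr_const card_ord.
congr (_ ^+ _); rewrite sum_bool_pair /G /F /= /brt0; congr (_ + _).
  by rewrite /tot0 mulr_sumr; apply: eq_bigr => c _; rewrite mulrA.
rewrite -tot_unwired mulr_sumr; apply: eq_bigr => c _; rewrite mulr1 -!mulrA; congr (_ * _); exact: mulrC.
Qed.

(** By linearity over the child above the leaf: its edge is open, and the other branches are summed
    freely. *)
Lemma totN_cons D ds : totN (D :: ds) = D%:R * (p * totN ds) * brt ds ^+ D.-1.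
Proof.
pose a (x : bool * conf ds) : R := (x.1 * nleaf x.2)%N%:R.
pose G (i j : 'I_D) x := F x * (if j == i then a x else 1).
transitivity (\sum_i \sum_(c : {ffun 'I_D -> bool * conf ds}) \prod_j G i j (c j)).
  rewrite exchange_big; apply: eq_bigr => c _ /=.
  rewrite natr_sum mulr_sumr; apply: eq_bigr => i _.
  rewrite [RHS]big_split /=; congr (_ * _).
  by rewrite (bigD1 i) //= eqxx big1 ?mulr1 // => j /negPf ->.
rewrite -mulrA mulr_natl -[X in _ *+ X](card_ord D) -sumr_const.
apply: eq_bigr => i _; rewrite -(bigA_distr_bigA (fun (j : 'I_D) x => G i j x)) /=.
rewrite (bigD1 i) //=; congr (_ * _).
  rewrite sum_bool_pair /G eqxx /F /a /= [X in _ + X]big1 ?addr0; last first.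
    by move=> c _; rewrite mul0n mulr0.
  by rewrite /totN mulr_sumr; apply: eq_bigr => c _; rewrite mul1n mulrA.
rewrite (eq_bigr (fun=> brt ds)); last first.
  move=> j /negPf ji; rewrite -sumF; apply: eq_bigr => x _.
  by rewrite /G ji mulr1.
by rewrite prodr_const; congr (_ ^+ _); rewrite cardC1 card_ord.
Qed.

End TreeSums.

Section Subcritical.
Variables (R : realType) (q : R) (d : nat).
Hypotheses (hq : 1 <= q) (hd : (0 < d)%N).

Section FixedP.
Variable p : R.
Hypothesis hp : 0 < p < 1.

Let q0 : 0 < q. Proof. exact: lt_le_trans hq. Qed.
Let p0 : 0 < p. Proof. by case/andP: hp. Qed.
Let p1 : 0 < 1 - p. Proof. by case/andP: hp; rewrite subr_gt0. Qed.
Let k0 : 0 < q * (1 - p) + p. Proof. by rewrite addr_gt0 ?mulr_gt0. Qed.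

Let T h := tot p q (nseq h d).
Let B h := tot0 p q (nseq h d).

Let T0 h : 0 < T h.
Proof.
rewrite /T /tot (bigD1 (mkc xpredT)) //= ltr_wpDr ?wt_gt0 //.
by apply: sumr_ge0 => c' _; apply: ltW; exact: wt_gt0.
Qed.

Let B0 h : 0 <= B h.
Proof. by apply: sumr_ge0 => c _; rewrite mulr_ge0 ?ler0n // ltW // wt_gt0. Qed.

Let BT h : B h < T h.
Proof.
rewrite /B /T /tot0 /tot -subr_gt0 -sumrB.
have h0 : 0 < wt p q (mkc xpredT : conf (nseq h d)) by exact: wt_gt0.
have c1 : conn (mkc xpredT : conf (nseq h d)).
  elim: h {h0} => [|h IH] //=; apply/existsP.
  by exists (Ordinal hd); rewrite ffunE.
rewrite (bigD1 (mkc xpredT)) //= c1 mulr0 subr0 ltr_wpDr //.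
apply: sumr_ge0 => c _; case: (conn c) => /=; rewrite ?mulr0 ?mulr1 ?subr0 ?subrr //.
by rewrite ltW // wt_gt0.
Qed.

(* [slack h] is the probability, under the normalised [wt], that the root of the
   tree of depth [h] is joined to a leaf, and [alpha h] below that an edge from the
   root of the tree of depth [h.+1] is open. *)
Definition slack h : R := (T h - B h) / T h.

Lemma slack_gt0 h : 0 < slack h.
Proof. by rewrite divr_gt0 // subr_gt0. Qed.

Lemma slack_le1 h : slack h <= 1.
Proof. by rewrite ler_pdivrMr // mul1r gerBl. Qed.

Let c0 : 0 <= (1 - p) * (q - 1).
Proof. by apply: mulr_ge0; [exact: ltW|rewrite subr_ge0]. Qed.

Definition alpha h : R := p / (q * (1 - p) + p - (1 - p) * (q - 1) * slack h).

Let den_ge h : 1 <= q * (1 - p) + p - (1 - p) * (q - 1) * slack h.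
Proof.
have h1 : (1 - p) * (q - 1) * slack h <= (1 - p) * (q - 1).
  by rewrite ler_piMr ?slack_le1.
lra.
Qed.

Let brtE h : brt p q (nseq h d) =
  (q * (1 - p) + p - (1 - p) * (q - 1) * slack h) * T h.
Proof.
rewrite /brt /slack -/(T h) -/(B h); field; exact: lt0r_neq0.
Qed.

Let brt_gt0 h : 0 < brt p q (nseq h d).
Proof. by rewrite brtE mulr_gt0 // (lt_le_trans ltr01). Qed.

Lemma alpha_ge h : phat p q <= alpha h.
Proof.
rewrite /phat /alpha ler_pM2l // lef_pV2 ?posrE //; last by rewrite (lt_le_trans ltr01).
by rewrite gerBl mulr_ge0 // ltW // slack_gt0.
Qed.

Lemma alpha_gt0 h : 0 < alpha h.
Proof. by rewrite divr_gt0 // (lt_le_trans ltr01). Qed.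

Lemma alpha_le1 h : alpha h <= 1.
Proof.
rewrite /alpha ler_pdivrMr ?(lt_le_trans ltr01) // mul1r.
by rewrite (le_trans _ (den_ge h)) // ltW // -subr_gt0.
Qed.

Lemma brt_ratio h : brt0 p q (nseq h d) = (1 - alpha h * slack h) * brt p q (nseq h d).
Proof.
transitivity (brt p q (nseq h d) - p * (T h - B h)).
  by rewrite /brt /brt0 -/(T h) -/(B h); ring.
rewrite mulrBl mul1r; congr (_ - _); rewrite brtE /alpha.
have : T h - B h = slack h * T h by rewrite /slack divfK // lt0r_neq0.
move=> ->; have := den_ge h; set K := q * _ + p - _ => K1.
by field; rewrite lt0r_neq0 // (lt_le_trans ltr01).
Qed.

Lemma slackS h : slack h.+1 = 1 - (1 - alpha h * slack h) ^+ d.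
Proof.
rewrite /slack /T /B /= tot_cons tot0_cons brt_ratio exprMn -/(slack h).
have n0 : brt p q (nseq h d) ^+ d != 0 by rewrite expf_neq0 // lt0r_neq0.
by rewrite -[X in X - _]mul1r -mulrBl mulfK.
Qed.

Definition meanN h : R := totN p q (nseq h d) / T h.

Lemma meanNS h : meanN h.+1 = d%:R * alpha h * meanN h.
Proof.
rewrite /meanN [T h.+1]/T /= totN_cons tot_cons.
have -> : brt p q (nseq h d) ^+ d = brt p q (nseq h d) * brt p q (nseq h d) ^+ d.-1.
  by rewrite -exprS prednK.
have : brt p q (nseq h d) ^+ d.-1 != 0 by rewrite expf_neq0 // lt0r_neq0.
move: (_ ^+ d.-1) => b b0; rewrite brtE /alpha.
have := den_ge h; set K := q * _ + p - _ => K1.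
by field; rewrite b0 !lt0r_neq0 // (lt_le_trans ltr01).
Qed.

Definition wired_conn_prob D h : R :=
  let ds := D :: nseq h d in
  (tot p q ds - tot0 p q ds) / (tot p q ds + (q - 1) * tot0 p q ds).

(** Carries the limit from the wired measure, where a root component missing the leaves costs [q],
    to [wt], where it costs nothing. This reweighting loses at most a factor [q], and a single
    branch at the root already connects with probability at least [phat * slack]. *)
Lemma slack_le_conn_prob D h : (0 < D)%N ->
  slack h <= q / phat p q * wired_conn_prob D h.
Proof.
move=> D0; rewrite /wired_conn_prob tot_cons tot0_cons brt_ratio exprMn.
set x := 1 - _; set b := brt _ _ _.
have b0 : 0 < b ^+ D by apply: exprn_gt0; exact: brt_gt0.
have as1 : alpha h * slack h <= 1.
  by rewrite mulr_ile1 ?alpha_le1 ?slack_le1 ?(ltW (alpha_gt0 h)) ?(ltW (slack_gt0 h)).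
have x0 : 0 <= x by rewrite subr_ge0.
have x1 : x <= 1 by rewrite /x gerBl mulr_ge0 ?(ltW (alpha_gt0 h)) ?(ltW (slack_gt0 h)).
have xD1 : x ^+ D <= x by rewrite -(prednK D0) exprS ler_piMr // exprn_ile1.
have xD0 : 0 <= x ^+ D by rewrite exprn_ge0.
have dn : 0 < 1 + (q - 1) * x ^+ D.
  by rewrite ltr_wpDr // mulr_ge0 // subr_ge0.
have -> : (b ^+ D - x ^+ D * b ^+ D) / (b ^+ D + (q - 1) * (x ^+ D * b ^+ D)) =
          (1 - x ^+ D) / (1 + (q - 1) * x ^+ D).
  have -> : b ^+ D - x ^+ D * b ^+ D = (1 - x ^+ D) * b ^+ D by ring.
  have -> : b ^+ D + (q - 1) * (x ^+ D * b ^+ D) = (1 + (q - 1) * x ^+ D) * b ^+ D by ring.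
  by rewrite -mulf_div divff ?mulr1 // lt0r_neq0.
have ph0 : 0 < phat p q by rewrite divr_gt0.
rewrite mulrAC ler_pdivlMr // mulrC.
apply: (@le_trans _ _ (1 - x ^+ D)).
  apply: (@le_trans _ _ (1 - x)); last by rewrite lerD2l lerN2.
  by rewrite /x opprB addrC subrK; apply: ler_wpM2r; [rewrite ltW ?slack_gt0|exact: alpha_ge].
rewrite mulrCA ler_peMr ?subr_ge0 ?(le_trans xD1) //.
rewrite ler_pdivlMr // mul1r.
have : (q - 1) * x ^+ D <= (q - 1) * 1.
  by rewrite ler_wpM2l ?subr_ge0 // (le_trans xD1).
by lra.
Qed.

Hypothesis lim0 : forall eps : R, 0 < eps ->
  exists h0, forall h, (h0 <= h)%N -> slack h < eps.

(** Otherwise 0 would repel the recursion [slackS]: once small, the positive [slack] could no longer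
    decrease, against [lim0]. *)
Lemma slope_le1 : d%:R * phat p q <= 1.
Proof.
rewrite leNgt; apply/negP => gt1.
set del := d%:R * phat p q in gt1 *.
have del0 : 0 < del by rewrite (lt_trans ltr01).
have d0 : 0 < d%:R :> R by rewrite ltr0n.
have bern (x : R) n : 0 <= x <= 1 -> (1 - x) ^+ n <= 1 - n%:R * x + (n%:R * x) ^+ 2.
  case/andP=> x0 x1; elim: n => [|n IH]; first by rewrite expr0 mul0r expr0n /= subr0 addr0.
  rewrite exprS; apply: le_trans (_ : (1 - x) * (1 - n%:R * x + (n%:R * x) ^+ 2) <= _).
    by apply: ler_wpM2l => //; rewrite subr_ge0.
  rewrite -natr1; have n0 : 0 <= n%:R :> R by rewrite ler0n.
  have h1 : 0 <= n%:R * (x * x) by rewrite !mulr_ge0.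
  have h2 : 0 <= (n%:R * n%:R) * (x * x * x) by rewrite !mulr_ge0.
  by rewrite !expr2; nra.
(* Below this level [y = d * alpha * slack] is at most [1 - 1 / del], whence
   [y * (1 - y) >= y / del >= slack]. *)
have e0 : 0 < (1 - del^-1) / d%:R by rewrite divr_gt0 // subr_gt0 invf_lt1.
have [h0 hh] := lim0 e0.
have incr h : (h0 <= h)%N -> slack h <= slack h.+1.
  move=> /hh lt; rewrite slackS.
  have s0 := slack_gt0 h.
  set y := d%:R * (alpha h * slack h).
  have as1 : 0 <= alpha h * slack h <= 1.
    have [a0 a1 b1] := And3 (ltW (alpha_gt0 h)) (alpha_le1 h) (slack_le1 h).
    by rewrite mulr_ge0 ?(ltW s0) // mulr_ile1 ?(ltW s0).
  apply: (@le_trans _ _ (y * (1 - y))); last first.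
    by have := bern _ d as1; rewrite -/y expr2; lra.
  have y1 : y <= 1 - del^-1.
    apply: ltW; move: lt; rewrite ltr_pdivlMr // mulrC => lt; apply: le_lt_trans lt.
    by rewrite /y ler_pM2l // ler_piMl ?alpha_le1 // ltW.
  have y2 : del * slack h <= y.
    by rewrite /y /del -mulrA ler_pM2l // ler_wpM2r ?alpha_ge // ltW.
  have : y * del^-1 <= y * (1 - y) by rewrite ler_wpM2l //; [rewrite (le_trans _ y2) // mulr_ge0 // ltW|lra].
  by apply: le_trans; rewrite ler_pdivlMr // mulrC.
have mono k : slack h0 <= slack (h0 + k).
  elim: k => [|k IH]; first by rewrite addn0.
  by rewrite addnS (le_trans IH) // incr // leq_addr.
have [h1 hh1] := lim0 (slack_gt0 h0).
by have := hh1 (h0 + h1)%N (leq_addl _ _); rewrite ltNge mono.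
Qed.

(** As [slack] vanishes, [alpha] approaches [phat], so the growth factor [d * alpha] of [meanNS]
    ends below [c], the midpoint between [d * phat] and 1. *)
Lemma meanN_small (eps : R) : d%:R * phat p q < 1 -> 0 < eps ->
  exists2 h, (0 < h)%N & meanN h < eps.
Proof.
move=> lt1 eps0.
have d0 : 0 < d%:R :> R by rewrite ltr0n.
have mN0 h : 0 < meanN h.
  elim: h => [|h IH]; last first.
    by rewrite meanNS; apply: mulr_gt0 => //; apply: mulr_gt0 => //; exact: alpha_gt0.
  by rewrite /meanN divr_gt0 // /totN (bigD1 tt) //= big1 ?addr0 ?mul1r ?ltr01 // => -[].
pose c := (1 + d%:R * phat p q) / 2.
have c1 : c < 1 by rewrite /c; lra.
have c2 : d%:R * phat p q < c by rewrite /c; lra.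
have ph0 : 0 < phat p q by rewrite divr_gt0.
have cp : 0 < c by apply: lt_trans c2; rewrite mulr_gt0.
have e0 : 0 < (q * (1 - p) + p - d%:R * p / c) / q.
  rewrite divr_gt0 // subr_gt0 ltr_pdivrMr //.
  by move: c2; rewrite /phat mulrA ltr_pdivrMr // [c * _]mulrC.
have [h0 hh] := lim0 e0.
have dec h : (h0 <= h)%N -> meanN h.+1 <= c * meanN h.
  move=> /hh lt; rewrite meanNS ler_pM2r // /alpha mulrA.
  have dn := den_ge h; rewrite ler_pdivrMr ?(lt_le_trans ltr01) //.
  move: lt; rewrite ltr_pdivlMr // => lt.
  have s0 := slack_gt0 h.
  have h1 : (1 - p) * (q - 1) * slack h <= slack h * q.
    rewrite mulrC; apply: ler_wpM2l; first exact: ltW.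
    have : 0 <= p * (q - 1) by rewrite mulr_ge0 ?subr_ge0 // ltW.
    by lra.
  have : d%:R * p / c <= q * (1 - p) + p - (1 - p) * (q - 1) * slack h by lra.
  by rewrite ler_pdivrMr // [_ * c]mulrC.
have geo k : meanN (h0 + k) <= c ^+ k * meanN h0.
  elim: k => [|k IH]; first by rewrite addn0 mul1r.
  rewrite addnS (le_trans (dec _ (leq_addr _ _))) // exprS -mulrA.
  by rewrite ler_pM2l.
have nc : `|c| < 1 by rewrite gtr0_norm.
have e1 : 0 < eps / meanN h0 by rewrite divr_gt0.
have := cvg_expr nc; move/cvgrPdist_lt/(_ _ e1) => [b _ hb].
exists (h0 + b.+1)%N; first by rewrite addnS.
apply: le_lt_trans (geo _) _; rewrite -ltr_pdivlMr //.
have := hb b.+1 (leqnSn b); rewrite /= sub0r normrN; apply: le_lt_trans.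
exact: ler_norm.
Qed.

End FixedP.

End Subcritical.

(** * Identification with the wired measure on the regular tree *)

Section TreePos.

Fixpoint parent (ds : seq nat) : pos ds -> option (pos ds) :=
  match ds with
  | [::] => fun _ => None
  | D :: ds' => fun z => if z.2 is Some x then Some (z.1, parent x) else None
  end.

Fixpoint leafp (ds : seq nat) : pos ds -> bool :=
  match ds with
  | [::] => fun _ => false
  | D :: ds' => fun z => if z.2 is Some x then leafp x else ds' == [::]
  end.

Fixpoint reach (ds : seq nat) : conf ds -> pos ds -> bool :=
  match ds with
  | [::] => fun _ _ => false
  | D :: ds' => fun (c : {ffun 'I_D -> bool * conf ds'}) z =>
      (c z.1).1 && (if z.2 is Some x then reach (c z.1).2 x else true)
  end.

Lemma pos_nonnil ds (x : pos ds) : ds != [::].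
Proof. by case: ds x => [[]|]. Qed.

Lemma parent_some D ds (z : pos (D :: ds)) j o : parent z = Some (j, o) ->
  exists2 x, z = (j, Some x) & parent x = o.
Proof. by case: z => [j' [x|]] //= [-> <-]; exists x. Qed.

Lemma parent_none D ds (z : pos (D :: ds)) : parent z = None ->
  exists j, z = (j, None).
Proof. by case: z => [j [x|]] //= _; exists j. Qed.

Definition reacho ds (c : conf ds) (o : option (pos ds)) : bool :=
  if o is Some z then reach c z else true.

Lemma reachE ds (c : conf ds) z : reach c z = getc c z && reacho c (parent z).
Proof.
elim: ds c z => [|D ds IH] //= c [i [x|]] /=; last by rewrite andbT.
by rewrite IH; case: (parent x) => [y|] /=; rewrite andbCA ?andbT.
Qed.

Lemma conn_leaf ds (c : conf ds) :
  conn c = (ds == [::]) || [exists z, leafp z && reach c z].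
Proof.
elim: ds c => [|D ds IH] c //=; apply/existsP/existsP => -[].
  move=> i /andP[ci]; rewrite IH => /orP[/eqP e|/existsP[x /andP[lx rx]]].
    by exists (i, None); rewrite /= ci e eqxx.
  by exists (i, Some x); rewrite /= lx ci.
move=> [i [x|]] /= /andP[lx /andP[ci rx]]; exists i; rewrite ci IH.
  by apply/orP; right; apply/existsP; exists x; rewrite lx.
by rewrite lx.
Qed.

Lemma nleafE D ds (c : conf (D :: ds)) : nleaf c = #|[set z | leafp z && reach c z]|.
Proof.
elim: ds D c => [|D' ds IH] D c.
  have -> : [set z | leafp z && reach c z] = [set (i, None) | i in [set i : 'I_D | (c i).1]].
    apply/setP => -[i [[]|]]; rewrite !inE /= andbT.
    by apply/idP/imsetP => [ci|[j]]; [exists i; rewrite ?inE|rewrite inE => cj [->]].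
  rewrite card_imset; last by move=> i j [].
  rewrite -sum1dep_card big_mkcond /=; apply: eq_bigr => i _.
  by rewrite muln1; case: (c i).1.
have -> : #|[set z | leafp z && reach c z]| =
   (\sum_(i < D) #|[set z : pos (D :: D' :: ds) | (leafp z && reach c z) && (z.1 == i)]|)%N.
  rewrite -sum1dep_card (partition_big (fun z : pos (D :: D' :: ds) => z.1) xpredT) //=.
  by apply: eq_bigr => i _; rewrite -sum1dep_card.
apply: eq_bigr => i _; case ci: (c i).1; last first.
  apply/esym/eqP; rewrite mul0n cards_eq0 -subset0; apply/subsetP => -[j o]; rewrite !inE.
  by case/andP=> + /eqP e; rewrite /= in e *; rewrite e ci /= andbF.
rewrite mul1n; have := IH D' (c i).2; rewrite /= => ->.
rewrite -(card_imset _ (f := fun x : pos (D' :: ds) => (i, Some x) : pos (D :: D' :: ds))).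
  apply: eq_card => -[j o]; rewrite !inE.
  apply/imsetP/idP => [[x]|].
    by rewrite inE => lr [-> ->]; rewrite /= eqxx ci andbT.
  case/andP => + /eqP e; rewrite /= in e *; rewrite e ci /=.
  case: o => [x|] //= /andP[lx rx]; exists x => //; by rewrite inE; apply/andP.
by move=> x y [].
Qed.

End TreePos.

Section Embed.
Variables (V : finType) (S : Type) (nxt : S -> nat -> S) (vx : S -> V).

(** Positions are placed by a walker with state [st]: a word growing by one letter for the abstract
    tree, a dart moving to a child for a graph. One analysis of cut-edges thus serves both. *)
Fixpoint vtx (ds : seq nat) (st : S) : pos ds -> V :=
  match ds with
  | [::] => fun z => match z with end
  | D :: ds' => fun z =>
      if z.2 is Some x then vtx (nxt st z.1) x else vx (nxt st z.1)
  end.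

Definition vo ds st (o : option (pos ds)) : V := if o is Some z then vtx st z else vx st.

Definition edge ds st (z : pos ds) : {set V} := [set vtx st z; vo st (parent z)].

Lemma vo_sub D ds st (i : 'I_D) (o : option (pos ds)) :
  vo (nxt st i) o = vtx st ((i, o) : pos (D :: ds)).
Proof. by case: o. Qed.

(* The two separating sets: the open subtree below [z], and, when the parent of
   [z] is joined to neither the root nor a leaf, its own component. *)
Lemma noncut_connect ds st u (c : conf ds) z (r : rel V) :
  symmetric r ->
  injective (@vo ds st) ->
  (forall z', ~~ leafp z' -> forall b, r (vtx st z') b ->
     (b = vo st (parent z') /\ getc c z') \/
     exists z'', [/\ parent z'' = Some z', b = vtx st z'' & getc c z'']) ->
  (~~ u -> exists O : V -> Prop, [/\ forall z' : pos ds, ~ O (vtx st z'),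
     forall a b, O a -> r a b -> O b \/ b = vx st &
     forall b, r (vx st) b ->
       O b \/ exists z'' : pos ds, [/\ parent z'' = None, b = vtx st z'' & getc c z'']]) ->
  getc c z = false -> connect r (vtx st z) (vo st (parent z)) -> noncut u c z.
Proof.
move=> sr; elim: ds st u c z => [|D ds IH] st u c [] // i oz inj H1 H2 gz cz.
have injP j o j' o' : vtx st ((j, o) : pos (D :: ds)) = vtx st ((j', o') : pos (D :: ds)) -> (j, o) = (j', o').
  by move=> e; have /Some_inj := inj (Some (j, o)) (Some (j', o')) e.
have neqR j o : vtx st ((j, o) : pos (D :: ds)) <> vx st.
  by move=> e; have := inj (Some (j, o)) None e.
have nleafP j o : ~~ conn (c j).2 -> reacho (c j).2 o -> ~~ leafp ((j, o) : pos (D :: ds)).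
  rewrite conn_leaf negb_or => /andP[dsn /existsPn nl]; case: o => [x|] //= rx.
  by have := nl x; rewrite rx andbT.
have below j o b : ~~ conn (c j).2 -> reacho (c j).2 o -> r (vtx st ((j, o) : pos (D :: ds))) b ->
    (exists2 o', reacho (c j).2 o' & b = vtx st ((j, o') : pos (D :: ds))) \/
    (b = vx st /\ (c j).1).
  move=> nc ro /(H1 _ (nleafP _ _ nc ro)) [[-> g]|[z'' [/parent_some[x' -> ex] -> g]]].
    case: o ro g => [x|] /= ro g; last by right.
    left; exists (parent x) => //; first by move: ro; rewrite reachE => /andP[].
  
  by left; exists (Some x') => //=; rewrite reachE ex ro andbT.
set u' := u || [exists j, [&& j != i, (c j).1 & conn (c j).2]].
(* If [u'] fails, the outside set, the root and the open parts below its other children form a set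
   that can be left only through edge [i]. It is the outside set for the subtree at [i]. *)
have upper : ~~ u' -> exists O : V -> Prop, [/\ forall o, ~ O (vtx st ((i, o) : pos (D :: ds))), O (vx st) &
    forall a b, O a -> r a b -> O b \/ b = vtx st ((i, None) : pos (D :: ds)) /\ (c i).1].
  rewrite negb_or => /andP[/H2 [O [O1 O2 O3]] /existsPn co].
  exists (fun a => [\/ O a, a = vx st | exists j o, [/\ j != i, (c j).1, reacho (c j).2 o & a = vtx st ((j, o) : pos (D :: ds))]]).
  split.
  - move=> o [/O1//|/neqR//|[j [o' [ji _ _ /injP [e _]]]]]; by rewrite e eqxx in ji.
  - by constructor 2.
  - move=> a b [Oa|->|[j [o [ji cj ro ->]]]] rab.
    + by case: (O2 _ _ Oa rab) => ?; left; [constructor 1|constructor 2].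
    + case: (O3 _ rab) => [Ob|[z'' [/parent_none[j ->] -> cj]]]; first by left; constructor 1.
      case: (eqVneq j i) => [ji|ji]; first by right; rewrite -ji.
      by left; constructor 3; exists j, None.
    + have nc : ~~ conn (c j).2 by have := co j; rewrite ji cj.
      case: (below _ _ _ nc ro rab) => [[o' ro' ->]|[-> _]]; left; last by constructor 2.
      by constructor 3; exists j, o'.
have cs := sym_connect_sym sr.
case: oz gz cz => [x|] gz cz /=; rewrite -/u'; last first.
  apply/andP; split; apply/negPn/negP.
  - move/upper=> [O [O1 O2 O3]]; rewrite /= in gz.
    apply: (O1 None).
    apply: (connect_invariant (r := r) (S := O) (x := vx st)) => //; last by rewrite cs.
    by move=> a b Oa rab; case: (O3 _ _ Oa rab) => // -[_]; rewrite gz.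
  - move=> nc; pose Q b := exists2 o, reacho (c i).2 o & b = vtx st ((i, o) : pos (D :: ds)).
    have [o _ e] : Q (vx st); last exact: neqR (esym e).
    apply: (connect_invariant (r := r) (S := Q)) cz; last by exists None.
    move=> a b [o ro ->] rab; case: (below _ _ _ nc ro rab) => // -[_].
    by rewrite /= in gz; rewrite gz.
apply: (IH (nxt st i)) => //.
- by move=> o o'; rewrite !vo_sub => /injP [].
- move=> x' nl b rb; case: (H1 (i, Some x') nl b rb) => [[-> g]|[z'' [/parent_some[x'' -> ex] -> g]]].
    by left; split=> //; rewrite /= vo_sub.
  by right; exists x''; split.
- have nl : ~~ leafp ((i, None) : pos (D :: ds)) by exact: pos_nonnil x.
  have root b : r (vx (nxt st i)) b -> (b = vx st /\ (c i).1) \/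
      exists z'' : pos ds, [/\ parent z'' = None, b = vtx (nxt st i) z'' & getc (c i).2 z''].
    move=> rb; case: (H1 (i, None) nl b rb) => [[-> g]|[z'' [/parent_some[x'' -> ex] -> g]]]; first by left.
    by right; exists x''.
  case ci: (c i).1 => /=; last first.
    move=> _; exists (fun=> False); split=> [x' []|a b []|b /root [[_]|]].
    - by rewrite ci.
    - by right.
  move/upper=> [O [O1 O2 O3]]; exists O; split.
  + by move=> x'; exact: (O1 (Some x')).
  + by move=> a b Oa rab; case: (O3 _ _ Oa rab) => [|[]]; [left|right].
  + by move=> b /root [[-> _]|]; [left|right].
Qed.

Lemma reach_connect ds st (c : conf ds) (r : rel V) z :
  (forall z', getc c z' -> connect r (vtx st z') (vo st (parent z'))) ->
  reach c z -> connect r (vtx st z) (vx st).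
Proof.
elim: ds st c z => [|D ds IH] st c [] // i [x|] H /= /andP[ci rx]; last exact: (H (i, None)).
apply: connect_trans (H (i, None) ci); rewrite /=; apply: IH rx => x' gx'.
exact: (H (i, Some x') gx').
Qed.

Lemma conn_connect ds st (c : conf ds) (r : rel V) y :
  (forall z', getc c z' -> connect r (vtx st z') (vo st (parent z'))) ->
  (forall z' : pos ds, leafp z' -> connect r (vtx st z') y) ->
  connect_sym r -> (ds == [::] -> connect r (vx st) y) ->
  conn c -> connect r (vx st) y.
Proof.
move=> H L cs H0; rewrite conn_leaf => /orP[/H0//|/existsP[z /andP[lz rz]]].
by apply: connect_trans (L _ lz); rewrite cs; apply: reach_connect rz.
Qed.

(** The vertex [y] plays the wired one: both ends of [z] are led to it along paths avoiding [z]. *)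
Lemma connect_noncut ds st (u : bool) (c : conf ds) z (r : rel V) y :
  connect_sym r ->
  (forall z', getc c z' -> z' != z -> connect r (vtx st z') (vo st (parent z'))) ->
  (forall z' : pos ds, leafp z' -> connect r (vtx st z') y) ->
  (u -> connect r (vx st) y) ->
  noncut u c z -> connect r (vtx st z) (vo st (parent z)).
Proof.
move=> cs; elim: ds st u c z => [|D ds IH] st u c [] // i oz H L U nc.
have sub j : forall (ok : forall o, (j, Some o) != (i, oz)), conn (c j).2 ->
    connect r (vtx st ((j, None) : pos (D :: ds))) y.
  move=> ok; apply: conn_connect => //.
  - by move=> x g; exact: (H (j, Some x) g (ok x)).
  - by move=> x lx; exact: (L (j, Some x)).
  - by move=> e; apply: (L (j, None)).
have up : u || [exists j, [&& j != i, (c j).1 & conn (c j).2]] -> connect r (vx st) y.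
  case/orP=> [/U//|/existsP[j /and3P[ji cj nj]]].
  have ne o : (j, o) != (i, oz) by rewrite xpair_eqE negb_and ji.
  apply: connect_trans (sub j _ nj); last by move=> o; exact: ne.
  by rewrite cs; exact: (H (j, None) cj (ne _)).
case: oz H nc sub {IH} (IH (nxt st i)) => [x|] H /= nc sub IH.
  apply: IH nc => //.
  - move=> x' g ne; apply: (H (i, Some x') g).
    by apply: contra ne => /eqP [->].
  - by move=> x' lx; exact: (L (i, Some x')).
  - case/andP=> ci /up; apply: connect_trans; apply: (H (i, None) ci).
    by apply/eqP => -[].
case/andP: nc => /up ru nc; apply: (@connect_trans _ _ y); last by rewrite cs.
by apply: sub => // o; apply/eqP => -[].
Qed.

End Embed.

Section Proportional.
Variables (R : realType) (p q : R).
Hypotheses (hq : 1 <= q) (hp : 0 < p < 1).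

(* A weight on configurations is determined, up to a constant, by the ratios
   across single-edge flips. *)
Lemma wtw_unique ds u (F : conf ds -> R) :
  (forall c z, F (setc c z true) * ((1 - p) * (if noncut u c z then 1 else q)) =
               F (setc c z false) * p) ->
  forall c c', F c * wtw p q u c' = F c' * wtw p q u c.
Proof.
move=> ratio.
have p0 : 0 < p by case/andP: hp.
have p1 : 0 < 1 - p by case/andP: hp; rewrite subr_gt0.
have W0 (c : conf ds) : wtw p q u c != 0 by rewrite lt0r_neq0 // wtw_gt0.
have flip c z : F (setc c z true) * wtw p q u (setc c z false) =
                F (setc c z false) * wtw p q u (setc c z true).
  have := ratio c z; have := wtw_ratio p q u c z; set a := _ * (if _ then _ else _).
  have a0 : a != 0.
    by rewrite lt0r_neq0 // mulr_gt0 //; case: ifP => // _; exact: lt_le_trans hq.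
  move=> e1 e2; apply: (mulIf a0); apply: (mulIf (lt0r_neq0 p0)).
  transitivity (F (setc c z true) * a * (wtw p q u (setc c z false) * p)); first by ring.
  by rewrite e2 -e1; ring.
have step c z o : F c * wtw p q u (setc c z o) = F (setc c z o) * wtw p q u c.
  have := flip c z; have ec := setc_getc c z.
  by case: (getc c z) o ec => [] [] /= ->.
have main (l : seq (pos ds)) c c' : (forall z, z \notin l -> getc c z = getc c' z) ->
    F c * wtw p q u c' = F c' * wtw p q u c.
  elim: l c c' => [|z l IH] c c' agree.
    by have -> : c = c' by apply: conf_ext => z; exact: agree.
  have e := IH (setc c z (getc c' z)) c'.
  have {}e : F (setc c z (getc c' z)) * wtw p q u c' = F c' * wtw p q u (setc c z (getc c' z)).
    apply: e => x xl; rewrite getc_setc; case: eqP => [->//|/eqP xz].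
    by apply: agree; rewrite inE negb_or xz.
  have w0 := W0 (setc c z (getc c' z)).
  apply: (mulIf w0).
  by rewrite mulrAC step mulrAC e; ring.
by move=> c c'; apply: (main (enum (pos ds))) => z; rewrite mem_enum.
Qed.

End Proportional.

Section PosWord.

Fixpoint pword (ds : seq nat) : pos ds -> seq nat :=
  match ds with
  | [::] => fun _ => [::]
  | D :: ds' => fun z => (z.1 : nat) :: (if z.2 is Some x then pword x else [::])
  end.

Definition pwordo ds (o : option (pos ds)) := if o is Some z then pword z else [::].

Lemma pword_neq_nil ds (z : pos ds) : pword z != [::].
Proof. by case: ds z => [[]|]. Qed.

Lemma pword_inj ds : injective (@pword ds).
Proof.
elim: ds => [|D ds IH] [] // i [x|] [j [y|]] //= [].
- by move=> /val_inj -> /IH ->.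
- by move=> _ e; have := pword_neq_nil x; rewrite e.
- by move=> _ e; have := pword_neq_nil y; rewrite -e.
- by move=> /val_inj ->.
Qed.

Lemma pword_parent ds (z : pos ds) : exists i, pword z = rcons (pwordo (parent z)) i.
Proof.
elim: ds z => [|D ds IH] [] // i [x|] /=; last by exists i.
have [j ->] := IH x; exists j; by case: (parent x).
Qed.

Lemma leafpE ds (z : pos ds) : leafp z = (size (pword z) == size ds).
Proof.
elim: ds z => [|D ds IH] [] // i [x|] /=; first by rewrite IH.
by rewrite eqSS -size_eq0 eq_sym.
Qed.

Lemma size_pword ds (z : pos ds) : (size (pword z) <= size ds)%N.
Proof. by elim: ds z => [|D ds IH] [] // i [x|] /=; rewrite ltnS ?IH. Qed.

Lemma pword_nseq h d (z : pos (nseq h d)) : all (fun i => (i < d)%N) (pword z).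
Proof. by elim: h z => [|h IH] [] // i [x|] /=; rewrite ltn_ord ?IH. Qed.

Lemma pword_surj h d s : s != [::] -> (size s <= h)%N -> all (fun i => (i < d)%N) s ->
  exists z : pos (nseq h d), pword z = s.
Proof.
elim: h s => [|h IH] [|i s] //= _; rewrite ltnS => sz /andP[id al].
case: s sz al => [|j s] sz al; first by exists (Ordinal id, None).
by have [x ex] := IH (j :: s) isT sz al; exists (Ordinal id, Some x); rewrite /= ex.
Qed.

End PosWord.

Section RootedTree.
Variables (R : realType) (p q : R).
Hypotheses (hq : 1 <= q) (hp : 0 < p < 1).
Variables (d h : nat).

Let H := h.+1.
Let TV := tree_vertex d.+1 H.
Let ds := d.+1 :: nseq h d.

Definition tree_node (s : seq nat) : TV :=
  insubd (tree_root d.+1 H) (insub_bseq H (map inord s : seq 'I_d.+1)).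

Let nd := @vtx _ _ rcons tree_node ds [::].
Let ndo := @vo _ _ rcons tree_node ds [::].
Let ed := @edge _ _ rcons tree_node ds [::].

Lemma vtx_word ds' (st : seq nat) (z : pos ds') :
  vtx rcons tree_node st z = tree_node (st ++ pword z).
Proof.
elim: ds' st z => [|D ds' IH] st [] // i [x|] /=; first by rewrite IH cat_rcons.
by rewrite cats1.
Qed.

Lemma nodeE (o : option (pos ds)) : ndo o = tree_node (pwordo o).
Proof. by case: o => [z|] //; exact: (vtx_word [::] z). Qed.

Lemma pword_lt (z : pos ds) : all (fun i => (i < d.+1)%N) (pword z) &&
  all (fun i => (i < d)%N) (behead (pword z)).
Proof.
case: z => i [x|] /=; rewrite ltn_ord // pword_nseq andbT.
by apply: sub_all (pword_nseq x) => j; exact: ltnW.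
Qed.

Lemma tree_word_node (s : seq nat) : (size s <= H)%N -> all (fun i => (i < d.+1)%N) s ->
  all (fun i => (i < d)%N) (behead s) -> map val (tree_word (tree_node s)) = s.
Proof.
move=> sz al al'; set t : seq 'I_d.+1 := map inord s.
have vb : (insub_bseq H t : seq _) = t.
  by rewrite /insub_bseq /insubd insubT //= size_map.
rewrite /tree_word /tree_node insubdK; last first.
  rewrite unfold_in /= vb /t.
  case: s {sz t vb} al al' => //= i s /andP[_ al] al'; elim: s al al' => //= j s IH /andP[j1 al] /andP[j2 al'].
  by rewrite inordK // j2 IH.
rewrite /= vb -map_comp -[RHS]map_id.
by apply/eq_in_map => i si /=; rewrite inordK //; exact: (allP al).
Qed.

Lemma word_ndo (o : option (pos ds)) : map val (tree_word (ndo o)) = pwordo o.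
Proof.
rewrite nodeE; apply: tree_word_node; case: o => [z|] //=.
- by rewrite (leq_trans (size_pword z)) //= size_nseq.
- by case/andP: (pword_lt z).
- by case/andP: (pword_lt z).
Qed.

Lemma size_ndo (o : option (pos ds)) : size (tree_word (ndo o)) = size (pwordo o).
Proof. by rewrite -word_ndo size_map. Qed.

Lemma ndo_inj : injective ndo.
Proof.
move=> o o' e; have := word_ndo o; rewrite e word_ndo => /esym.
case: o o' {e} => [z|] [z'|] //=.
by move=> e; rewrite (@pword_inj ds z z').
Qed.

Lemma tree_word_inj : injective (@tree_word d.+1 H).
Proof. by move=> x y e; apply/val_inj/val_inj. Qed.

Lemma size_parent (z : pos ds) : size (pword z) = (size (pwordo (parent z))).+1.
Proof. by have [i ->] := pword_parent z; rewrite size_rcons. Qed.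

(** The ends of an edge lie at consecutive depths, so the edge determines its lower end. *)
Lemma ed_inj : injective ed.
Proof.
move=> z z'; rewrite /ed /edge => /eqP; rewrite set2_eqP => /orP[] /andP[/eqP e1 /eqP e2].
  by have /Some_inj := @ndo_inj (Some z) (Some z') e1.
have sN x : size (tree_word (ndo (Some x))) = (size (tree_word (ndo (parent x)))).+1.
  by rewrite !size_ndo -size_parent.
have e1' : ndo (Some z) = ndo (parent z') := e1.
have e2' : ndo (parent z) = ndo (Some z') := e2.
by have := sN z; have := sN z'; rewrite e1' -e2'; lia.
Qed.

Lemma tree_edgesE : tree_edges d.+1 H = [set ed z | z : pos ds].
Proof.
apply/setP => e; apply/imsetP/imsetP => [[[x y]]|[z _ ->]].
  rewrite inE /= => /existsP[a /eqP ea] ->.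
  set s := map val (tree_word y).
  have sn : s != [::] by rewrite /s ea map_rcons; case: map.
  have sz : (size s <= H)%N by rewrite size_map; exact: size_bseq.
  have [z ez] : exists z : pos ds, pword z = s.
    case es: s sn => [//|i s'] _.
    have id : (i < d.+1)%N.
      have : i \in s by rewrite es mem_head.
      by case/mapP => j _ ->; exact: ltn_ord.
    case: (eqVneq s' [::]) => [e0|s'n]; first by exists (Ordinal id, None); rewrite e0.
    have [||x' ex] := @pword_surj h d s' s'n.
    - by move: sz; rewrite es.
    - have -> : s' = map val (behead (tree_word y)) by rewrite -behead_map -/s es.
      by rewrite all_map; exact: (valP y).
    - by exists (Ordinal id, Some x'); rewrite /= ex.
  exists z => //; rewrite /ed /edge finset.setUC.
  have eP : map val (tree_word (vtx rcons tree_node [::] z)) = s.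
    by rewrite -ez; exact: (word_ndo (Some z)).
  have -> : vtx rcons tree_node [::] z = y.
    by apply: tree_word_inj; apply: (inj_map val_inj).
  have [i ei] := pword_parent z.
  suff -> : vo rcons tree_node [::] (parent z) = x by [].
  apply: tree_word_inj; apply: (inj_map val_inj); rewrite word_ndo.
  by move: ei; rewrite ez /s ea map_rcons => /rcons_inj [].
exists (ndo (parent z), ndo (Some z)); last by rewrite /ed /edge finset.setUC.
rewrite inE /=; have [i ei] := pword_parent z; apply/existsP; exists (inord i).
apply/eqP/(inj_map val_inj); rewrite map_rcons; apply: etrans (word_ndo (Some z)) _.
apply: (etrans ei); rewrite word_ndo; congr rcons; rewrite /= inordK //.
by have /andP[/allP al _] := pword_lt z; apply: al; rewrite ei mem_rcons mem_head.
Qed.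

Let w (c : conf ds) : {set {set TV}} := [set ed z | z in [set z | getc c z]].
Let E := tree_edges d.+1 H.
Let B := tree_leaves d.+1 H.

Lemma mem_w c z : (ed z \in w c) = getc c z.
Proof. by rewrite mem_imset ?inE //; exact: ed_inj. Qed.

Lemma wP c e : reflect (exists2 z, e = ed z & getc c z) (e \in w c).
Proof.
by apply: (iffP imsetP) => -[z]; rewrite ?inE; [exists z|exists z; rewrite ?inE].
Qed.

Lemma w_set0 c z : ed z \notin w (setc c z false).
Proof. by rewrite mem_w getc_setc eqxx. Qed.

Lemma w_set1 c z : w (setc c z true) = ed z |: w (setc c z false).
Proof.
apply/setP => e; rewrite in_setU1; apply/wP/orP => [[x ->]|[/eqP->|/wP[x ->]]].
- rewrite getc_setc mem_w getc_setc; case: (eqVneq x z) => [->|xz gx]; first by left.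
  by right.
- by exists z; rewrite ?getc_setc ?eqxx.
- by rewrite getc_setc; case: (eqVneq x z) => // xz gx; exists x; rewrite // getc_setc (negPf xz).
Qed.

Lemma w_inj : injective w.
Proof. by move=> c c' e; apply: conf_ext => z; rewrite -!mem_w e. Qed.

Lemma w_sub c : w c \subset E.
Proof. by rewrite /E tree_edgesE; apply/fintype.subsetP => e /wP[z -> _]; apply: imset_f. Qed.

Lemma leafB (o : option (pos ds)) : (ndo o \in B) = (if o is Some z then leafp z else false).
Proof.
rewrite inE size_ndo; case: o => [z|] //; rewrite leafpE.
by rewrite [size ds]/= size_nseq.
Qed.

Lemma connect_wiredE c z (r := wired_adj B (w (setc c z false))) :
  connect r (ndo (Some z)) (ndo (parent z)) = noncut false c z.
Proof.
have sr : symmetric r by exact: wired_adj_sym.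
apply/idP/idP => [cz|nc].
  rewrite -(noncut_setc _ _ _ false).
  apply: (noncut_connect (st := [::]) sr ndo_inj) cz; last by rewrite getc_setc eqxx.
  - move=> z' nl b; rewrite /r /wired_adj /= => /orP[/wP[x]|/andP[h1 _]]; last first.
      have h2 : ndo (Some z') \in B := h1.
      by rewrite leafB (negPf nl) in h2.
    move/eqP; rewrite /ed /edge set2_eqP => /orP[] /andP[/eqP e1 /eqP e2] gx.
      have e3 := @ndo_inj (Some z') (Some x) e1; case: e3 => ezx; subst x.
      by left.
    have e3 := @ndo_inj (Some z') (parent x) e1.
    by right; exists x.
  - move=> _; exists (fun=> False); split=> [x []|a b []|b].
    rewrite /r /wired_adj /= => /orP[/wP[x]|/andP[h1 _]]; last first.
      have h2 : ndo None \in B := h1.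
      by rewrite leafB in h2.
    move/eqP; rewrite /ed /edge set2_eqP => /orP[] /andP[/eqP e1 /eqP e2] gx.
      by have := @ndo_inj None (Some x) e1.
    have e3 := @ndo_inj None (parent x) e1.
    by right; exists x.
have edge_r z' : getc c z' -> z' != z -> connect r (ndo (Some z')) (ndo (parent z')).
  move=> g zz; apply: connect1; rewrite /r /wired_adj /=; apply/orP; left.
  by apply/wP; exists z' => //; rewrite getc_setc (negPf zz).
have [z0 lz0|nol] := pickP (fun z : pos ds => leafp z).
  apply: (connect_noncut (y := ndo (Some z0)) (st := [::]) _ edge_r) nc => //.
  - exact: sym_connect_sym.
  - move=> z' lz'; apply: connect1; rewrite /r /wired_adj /=; apply/orP; right.
    have h1 : ndo (Some z') \in B by rewrite leafB.
    have h2 : ndo (Some z0) \in B by rewrite leafB.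
    by rewrite [X in X && _]h1 h2.
(* There is no leaf when [d] is 0 and [h] positive; any vertex can then stand for the wired one. *)
apply: (connect_noncut (y := ndo None) (st := [::]) _ edge_r) nc => //.
- exact: sym_connect_sym.
- by move=> z'; rewrite nol.
Qed.

(** With [wtw_unique] this makes the wired random-cluster weight proportional to [wtw false]; a
    global component count is thus replaced by the connection of two endpoints. *)
Lemma rc_ratio c z (F := fun c => rc_weight p q E B (w c)) :
  F (setc c z true) * ((1 - p) * (if noncut false c z then 1 else q)) =
  F (setc c z false) * p.
Proof.
have cE : (#|w (setc c z true)| <= #|E|)%N by rewrite subset_leq_card ?w_sub.
have e1 : #|w (setc c z true)| = #|w (setc c z false)|.+1.
  by rewrite w_set1 cardsU1 w_set0.
have e2 : w (setc c z false) = w (setc c z true) :\ ed z.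
  rewrite w_set1 setU1K //; exact: w_set0.
have e3 := ncomp_wired_add B (w (setc c z true)) (ndo (Some z)) (ndo (parent z)).
have ez : [set ndo (Some z); ndo (parent z)] = ed z by [].
rewrite ez -e2 connect_wiredE in e3.
have e4 : ed z |: w (setc c z true) = w (setc c z true).
  by rewrite w_set1 setUA setUid.
rewrite e4 in e3; rewrite /F /rc_weight e3 e1.
have -> : (#|E| - #|w (setc c z false)|)%N = (#|E| - #|w (setc c z false)|.+1).+1 by rewrite -e1; lia.
have alg (a b n : nat) (nc : bool) :
    p ^+ a.+1 * (1 - p) ^+ b * q ^+ n * ((1 - p) * (if nc then 1 else q)) =
    p ^+ a * (1 - p) ^+ b.+1 * q ^+ (n + ~~ nc) * p.
  by rewrite !exprS; case: nc; rewrite /= ?addn0 ?addn1 ?exprS; ring.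
exact: alg.
Qed.

Lemma root_to_leavesE c : root_to_leaves (w c) = conn c.
Proof.
rewrite conn_leaf /root_to_leaves (_ : (ds == [::]) = false) // orFb; apply/existsP/existsP => [[x /andP[xB cx]]|[z /andP[lz rz]]].
  have : exists2 o, reacho c o & x = ndo o.
    apply: (connect_invariant (S := fun a => exists2 o, reacho c o & a = ndo o)) cx.
      move=> a b [o ro ->]; rewrite /adj /= => /wP[z].
      move/eqP; rewrite /ed /edge set2_eqP => /orP[] /andP[/eqP e1 /eqP ->] gz.
        have e3 := @ndo_inj o (Some z) e1; subst o; exists (parent z) => //.
        have rz : reach c z := ro.
        by move: rz; rewrite reachE => /andP[].
      have e3 := @ndo_inj o (parent z) e1; exists (Some z) => //; rewrite /reacho.
      by rewrite reachE gz -e3.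
    exists None => //; apply: tree_word_inj; apply: (inj_map val_inj).
    by rewrite word_ndo.
  case=> o ro ex; move: xB; rewrite ex leafB; case: o ro {ex} => // z rz lz.
  by exists z; rewrite lz.
exists (ndo (Some z)); rewrite leafB lz /=.
have -> : tree_root d.+1 H = ndo None.
  by apply: tree_word_inj; apply: (inj_map val_inj); rewrite word_ndo.
rewrite (sym_connect_sym (adj_sym _)); apply: (reach_connect (st := [::])) rz => z' gz'.
by apply: connect1; rewrite /adj /=; apply/wP; exists z'.
Qed.

Lemma root_leaf_probE : root_leaf_prob q d.+1 p H = wired_conn_prob q d p d.+1 h.
Proof.
pose F c := rc_weight p q E B (w c).
have FE := wtw_unique hq hp (F := F) (u := false) rc_ratio.
pose c0 : conf ds := mkc xpredT; pose K := F c0 / wtw p q false c0.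
have W0 : 0 < wtw p q false c0 by exact: wtw_gt0.
have {}FE c : F c = K * wtw p q false c.
  by rewrite /K mulrAC -(FE c c0) mulfK ?lt0r_neq0.
have K0 : K != 0.
  have p1 : 0 < 1 - p by case/andP: hp; rewrite subr_gt0.
  have p0 : 0 < p by case/andP: hp.
  rewrite lt0r_neq0 // divr_gt0 // /F /rc_weight !mulr_gt0 ?exprn_gt0 //.
  exact: lt_le_trans hq.
pose w' (S : {set {set TV}}) : conf ds := mkc (fun z => ed z \in S).
have wK c : w' (w c) = c by apply: w_inj; congr w; apply: conf_ext => z; rewrite getc_mkc mem_w.
have w'K (S : {set {set TV}}) : S \subset E -> w (w' S) = S.
  move=> SE; apply/setP => e; apply/wP/idP => [[z ->]|eS]; first by rewrite getc_mkc.
  have := fintype.subsetP SE e eS; rewrite /E tree_edgesE => /imsetP[z _ ez].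
  by exists z; rewrite // getc_mkc -ez.
have sumE (A : pred {set {set TV}}) :
    \sum_(S in powerset E | A S) rc_weight p q E B S = K * \sum_(c | A (w c)) wtw p q false c.
  rewrite mulr_sumr (reindex_onto w w'); last first.
    by move=> S /andP[]; rewrite powersetE => /w'K.
  by apply: eq_big => c; rewrite ?powersetE ?w_sub ?wK ?eqxx ?andbT // => _; rewrite -FE.
rewrite /root_leaf_prob /rc_prob sumE.
have -> : \sum_(S in powerset E) rc_weight p q E B S =
    \sum_(S in powerset E | xpredT S) rc_weight p q E B S by apply: eq_bigl => S; rewrite andbT.
rewrite sumE -mulf_div divff // mul1r /wired_conn_prob.
rewrite (eq_bigl (fun c => conn c)); last by move=> c; exact: root_to_leavesE.
congr (_ / _).
  rewrite /tot /tot0 -sumrB big_mkcond; apply: eq_bigr => c _; rewrite /wtw.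
  by case: (conn c) => /=; ring.
by rewrite -tot_unwired; apply: eq_bigr => c _.
Qed.

End RootedTree.

(** * Tree regions in a regular graph *)

Section EdgeInj.
Variables (V : finType) (S : Type) (nxt : S -> nat -> S) (vx : S -> V).

Lemma edge_inj ds st : injective (@vo _ _ nxt vx ds st) -> injective (@edge _ _ nxt vx ds st).
Proof.
move=> inj z z'; rewrite /edge => /eqP; rewrite set2_eqP => /orP[] /andP[/eqP e1 /eqP e2].
  by have /Some_inj := inj (Some z) (Some z') e1.
have e1' := inj (Some z) (parent z') e1; have e2' := inj (parent z) (Some z') e2.
have [i ei] := pword_parent z; have [j ej] := pword_parent z'.
have := congr1 size ei; have := congr1 size ej.
by rewrite e2' -e1' /= !size_rcons; lia.
Qed.

End EdgeInj.

Section RegularGraph.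
Variables (V : finType) (d : nat) (G : {set {set V}}).
Hypothesis regG : regular d.+1 G.

Definition Nb (w : V) : {set V} := [set y | [set w; y] \in G].

Lemma G_card2 e : e \in G -> #|e| = 2%N.
Proof. by case/andP: regG => /forallP h _ eG; have := h e; rewrite eG /= => /eqP. Qed.

Lemma Nb_sym a b : (a \in Nb b) = (b \in Nb a).
Proof. by rewrite !inE finset.setUC. Qed.

Lemma Nb_irr a : a \notin Nb a.
Proof. by rewrite inE setUid; apply/negP => /G_card2; rewrite cards1. Qed.

Lemma G_edgeP e : e \in G -> exists a b, [/\ e = [set a; b], a != b & b \in Nb a].
Proof.
move=> eG; have /eqP/cards2P[a [b [ab ee]]] := G_card2 eG.
by exists a, b; split=> //; rewrite inE -ee.
Qed.

Lemma G_edge_at e a : e \in G -> a \in e -> exists2 b, e = [set a; b] & b \in Nb a.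
Proof.
move=> eG; have [x [y [-> xy yx]]] := G_edgeP eG.
rewrite !inE => /orP[]/eqP ->; first by exists y.
by exists x; [rewrite finset.setUC|rewrite Nb_sym].
Qed.

Lemma card_Nb w : #|Nb w| = d.+1.
Proof.
case/andP: regG => _ /forallP/(_ w)/eqP <-; rewrite /degree.
have inj : {in Nb w &, injective (fun y => [set w; y])}.
  move=> y y' yN _ /eqP; rewrite set2_eqP eqxx /= => /orP[/eqP//|/andP[/eqP e1 /eqP e2]].
  by rewrite e2 e1.
rewrite -(card_in_imset inj); apply: eq_card => e; rewrite inE.
apply/imsetP/andP => [[y yN ->]|[eG we]].
  by move: yN; rewrite !inE eqxx.
by have [b -> bN] := G_edge_at eG we; exists b.
Qed.

(* A dart [(x, w)] points at the vertex [w], whose children are its neighbours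
   other than [x]. *)
Definition ch (st : V * V) (i : nat) : V * V :=
  (st.2, nth st.2 (enum (Nb st.2 :\ st.1)) i).

Definition dart (st : V * V) := st.1 \in Nb st.2.

Lemma size_ch st : dart st -> size (enum (Nb st.2 :\ st.1)) = d.
Proof.
rewrite /dart => dst; rewrite -cardE; have := cardsD1 st.1 (Nb st.2).
by rewrite dst card_Nb => -[].
Qed.

Lemma ch_Nb st i : dart st -> (i < d)%N -> (ch st i).2 \in Nb st.2 /\ (ch st i).2 != st.1.
Proof.
move=> dst id; have : (ch st i).2 \in enum (Nb st.2 :\ st.1) by rewrite mem_nth ?size_ch.
by rewrite mem_enum !inE => /andP[].
Qed.

Lemma ch_dart st i : dart st -> (i < d)%N -> dart (ch st i).
Proof. by move=> dst id; rewrite /dart /= Nb_sym; case: (ch_Nb dst id). Qed.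

Lemma ch_inj st i j : dart st -> (i < d)%N -> (j < d)%N -> (ch st i).2 = (ch st j).2 -> i = j.
Proof.
by move=> dst id jd /eqP; rewrite nth_uniq ?size_ch ?enum_uniq // => /eqP.
Qed.

Lemma ch_surj st b : dart st -> b \in Nb st.2 -> b != st.1 ->
  exists2 i, (i < d)%N & b = (ch st i).2.
Proof.
move=> dst bN bx; have bE : b \in enum (Nb st.2 :\ st.1) by rewrite mem_enum in_setD1 bx.
exists (index b (enum (Nb st.2 :\ st.1))); first by rewrite -(size_ch dst) index_mem.
by rewrite /ch /= nth_index.
Qed.

Notation rvtx := (vtx ch (fun st : V * V => st.2)).
Notation rvo := (vo ch (fun st : V * V => st.2)).
Notation redge := (edge ch (fun st : V * V => st.2)).

Lemma redge_G h st (z : pos (nseq h d)) : dart st -> redge st z \in G.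
Proof.
elim: h st z => [|h IH] st [] // i [x|] dst; rewrite /edge.
  have := IH (ch st i) x (ch_dart dst (ltn_ord i)); rewrite /edge.
  by rewrite (vo_sub ch (fun st : V * V => st.2) st).
rewrite /= finset.setUC; have [] := ch_Nb dst (ltn_ord i); by rewrite inE.
Qed.

Lemma root_children h st b : dart st -> (0 < h)%N -> b \in Nb st.2 -> b != st.1 ->
  exists z : pos (nseq h d), parent z = None /\ b = rvtx st z.
Proof.
case: h => // h dst _ bN bx; have [i id ->] := ch_surj dst bN bx.
by exists (Ordinal id, None).
Qed.

Lemma node_children h st (z : pos (nseq h d)) b : dart st -> ~~ leafp z -> b \in Nb (rvtx st z) ->
  b = rvo st (parent z) \/ exists z', parent z' = Some z /\ b = rvtx st z'.
Proof.
elim: h st z => [|h IH] st [] // i [x|] dst nl bN.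
  case: (IH (ch st i) x (ch_dart dst (ltn_ord i)) nl bN) => [->|[z' [pz ->]]].
    by left; rewrite (vo_sub ch (fun st : V * V => st.2) st).
  by right; exists (i, Some z'); split=> //=; rewrite pz.
case: (eqVneq b st.2) => [->|bs]; first by left.
right; have h0 : (0 < h)%N by case: (h) nl.
have [z' [pz ->]] := root_children (ch_dart dst (ltn_ord i)) h0 bN bs.
by exists (i, Some z'); rewrite /= pz.
Qed.

Section Domination.
Variables (R : realType) (p q : R) (h : nat) (st : V * V).
Hypothesis dst : dart st.
Notation ds := (nseq h d).
Hypothesis inj : injective (@vo _ _ ch (fun st : V * V => st.2) ds st).

Definition region_of (st' : V * V) (e : {set V}) : option (pos ds) := [pick z | redge st' z == e].

Lemma region_edge z : region_of st (redge st z) = Some z.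
Proof.
rewrite /region_of; case: pickP => [z' /eqP/(edge_inj inj) -> //|/(_ z)].
by rewrite eqxx.
Qed.

Lemma region_some e z : region_of st e = Some z -> e = redge st z.
Proof. by rewrite /region_of; case: pickP => // z' /eqP <- [->]. Qed.

Lemma fk_upd_sub (X : {set {set V}}) x : X \subset G -> x.1 \in G -> fk_upd X x \subset G.
Proof.
move=> XG xG; rewrite /fk_upd; case: ifP => _; first by rewrite subUset sub1set xG.
exact: subset_trans (subsetDl _ _) XG.
Qed.

(** A [None] update opens an edge only if a path avoiding it joins its ends. In an embedded tree
    this path has to leave the copy, through a leaf on the lower side and through a leaf or the root
    on the upper one; these being wired, the region chain opens the edge too. *)
Lemma dominate o (X : {set {set V}}) (c : conf ds) :
  all (fun e => e \in G) [seq x.1 | x <- o] -> X \subset G ->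
  (forall z, redge st z \in X -> getc c z) ->
  forall z, redge st z \in foldl (@fk_upd V) X o -> getc (foldl (updm (region_of st)) c o) z.
Proof.
elim: o X c => [|[e u] o IH] X c //= /andP[eG oG] XG dom.
apply: IH => //; first exact: fk_upd_sub.
move=> z; rewrite /updm /=; case re: (region_of st e) => [z0|]; last first.
  have ne : redge st z != e by apply/eqP => ez; rewrite -ez region_edge in re.
  rewrite /fk_upd /=; case: ifP => _; rewrite !inE (negPf ne) ?andbT //=; exact: dom.
have ez0 := region_some re; rewrite /updc getc_setc.
case: (eqVneq z z0) => [->|zz0]; last first.
  have ne : redge st z != e by rewrite ez0; apply: contra zz0 => /eqP/(edge_inj inj)/eqP.
  rewrite /fk_upd /=; case: ifP => _; rewrite !inE (negPf ne) ?andbT //=; exact: dom.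
rewrite -ez0 /fk_upd /=; case: u => [o'|]; first by case: o' => //; rewrite !inE eqxx.
case: (boolP (cut_edge X e)) => /= [_|]; first by rewrite !inE eqxx.
rewrite ez0 cut_edgeE negbK => cz _.
rewrite -(noncut_setc _ _ _ false).
apply: (noncut_connect _ inj) cz.
- exact: adj_sym.
- move=> z' nl b; rewrite /adj /= !inE => /andP[ne zX].
  have bN : b \in Nb (rvtx st z') by rewrite inE; exact: (fintype.subsetP XG).
  case: (node_children dst nl bN) => [eb|[z'' [pz eb]]].
    left; split=> //; rewrite getc_setc; rewrite eb in ne zX.
    case: eqP => [ezz|_]; first by rewrite ezz eqxx in ne.
    exact: dom.
  right; exists z''; split=> //; rewrite getc_setc.
  have ee : [set rvtx st z'; b] = redge st z'' by rewrite /edge pz eb finset.setUC.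
  rewrite ee in ne zX.
  case: eqP => [ezz|_]; first by rewrite ezz eqxx in ne.
  exact: dom.
- by [].
- by rewrite getc_setc eqxx.
Qed.

End Domination.

End RegularGraph.

(** * Spanning trees, excess edges and fresh regions *)

Section Walk.
Variable V : finType.
Implicit Types (v : V) (s : seq V).

Fixpoint trav v s : {set {set V}} :=
  if s is a :: s' then [set v; a] |: trav a s' else set0.

Definition visited v s : {set V} := [set x in v :: s].

(** The round trip from [a] to [b] and back is inserted at a visit to [a]. A tree grown in this way
    is traced by a walk of twice as many steps as it has edges. *)
Lemma walk_detour v s a b : a \in v :: s -> exists s', [/\ size s' = (size s).+2,
  visited v s' = b |: visited v s & trav v s' = [set a; b] |: trav v s].
Proof.
elim: s v => [|c s IH] v.
  rewrite inE => /eqP ->; exists [:: b; v]; split=> //.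
    by apply/setP => x; rewrite !inE; case: (x == v) (x == b) => [] [].
  by rewrite /= (finset.setUC [set b]) setUA setUid.
rewrite inE; case: eqP => [-> _|_ /IH [s' [sz vis tr]]].
  exists [:: b, v, c & s]; split=> //.
    by apply/setP => x; rewrite !inE; case: (x == v) (x == b) => [] [].
  by rewrite /= (finset.setUC [set b]) setUA setUid.
exists (c :: s'); split; first by rewrite /= sz.
  apply/setP => x; have := congr1 (fun A : {set V} => x \in A) vis; rewrite !inE => ->.
  by case: (x == v) (x == b) => [] [].
by rewrite /= tr setUCA.
Qed.

End Walk.

Section Growth.
Variables (V : finType) (d : nat) (G : {set {set V}}).
Hypothesis regG : regular d.+1 G.
Notation Nb := (Nb G).
Notation ch := (ch G).
Notation rvtx := (vtx ch (fun st : V * V => st.2)).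
Notation rvo := (vo ch (fun st : V * V => st.2)).
Implicit Types (U Ep : {set V}) (T : {set {set V}}).

Definition inner U : {set {set V}} := [set e in G | e \subset U].

(* A walk from [v] through all the edges of the tree [T] is recorded so that the
   trees can be counted by walks. *)
Definition tree_on v U T : Prop :=
  [/\ exists s, [/\ visited v s = U, trav v s = T & size s = (#|T|).*2],
      T \subset inner U & (#|T|).+1 = #|U|].

Lemma tree_on_grow v U T a b : tree_on v U T -> a \in U -> b \in Nb a -> b \notin U ->
  tree_on v (b |: U) ([set a; b] |: T).
Proof.
move=> [[s [vis tr sz]] TU cT] aU ba bU.
have eT : [set a; b] \notin T.
  apply: contra bU => /(fintype.subsetP TU); rewrite inE => /andP[_].
  by rewrite subUset !sub1set => /andP[].
split; last by rewrite !cardsU1 eT bU !add1n -cT.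
  have [|s' [sz' vis' tr']] := @walk_detour V v s a b.
    by move: aU; rewrite -vis inE.
  exists s'; rewrite vis' tr' vis tr; split=> //.
  by rewrite sz' sz cardsU1 eT add1n doubleS.
apply/fintype.subsetP => e; rewrite !inE => /orP[/eqP->|/(fintype.subsetP TU)].
  rewrite subUset !sub1set !inE aU eqxx orbT !andbT.
  by move: ba; rewrite inE.
by rewrite inE => /andP[-> eU]; apply: subset_trans eU (subsetUr _ _).
Qed.

Fixpoint ballv (ds : seq nat) (st : V * V) : {set V} :=
  if ds is D :: ds' then \bigcup_(i < D) ((ch st i).2 |: ballv ds' (ch st i)) else set0.

Fixpoint innerv (ds : seq nat) (st : V * V) : {set V} :=
  if ds is D :: ds' then st.2 |: \bigcup_(i < D) innerv ds' (ch st i) else set0.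

Lemma ballvP ds st b : reflect (exists z : pos ds, b = rvtx st z) (b \in ballv ds st).
Proof.
elim: ds st b => [|D ds IH] st b /=; first by rewrite inE; constructor; case=> -[].
apply: (iffP bigcupP) => [[i _]|[[i [x|]] ->]].
- rewrite in_setU1 => /orP[/eqP->|/IH [z ->]]; first by exists (i, None).
  by exists (i, Some z).
- exists i => //; rewrite in_setU1; apply/orP; right; apply/IH; by exists x.
- by exists i => //; rewrite in_setU1 eqxx.
Qed.

Lemma innervP ds st b : reflect (b = st.2 /\ ds != [::] \/ exists2 z : pos ds, ~~ leafp z & b = rvtx st z)
  (b \in innerv ds st).
Proof.
elim: ds st b => [|D ds IH] st b /=.
  by rewrite inE; constructor; case=> [[_]|[[]]].
rewrite in_setU1; apply: (iffP orP) => [[/eqP->|/bigcupP[i _ /IH]]|[[-> _]|[[i [x|]] /= nl ->]]].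
- by left.
- case=> [[-> dn]|[z nl ->]]; right; first by exists (i, None).
  by exists (i, Some z).
- by left.
- by right; apply/bigcupP; exists i => //; apply/IH; right; exists x.
- by right; apply/bigcupP; exists i => //; apply/IH; left.
Qed.

Lemma card_ballv ds st : (#|ballv ds st| <= #|pos ds|)%N.
Proof.
apply: leq_trans (_ : #|[set rvtx st z | z : pos ds]| <= _)%N; last exact: leq_imset_card.
by apply: subset_leq_card; apply/fintype.subsetP => b /ballvP[z ->]; apply: imset_f.
Qed.

Section BallInd.
Variables (Q : {set V} -> Prop) (I : {set V}).
Hypothesis Qstep : forall U a b, Q U -> a \in U -> a \in I -> b \in Nb a -> b \notin U -> Q (b |: U).

Let Qstep' U a b : Q U -> a \in U -> a \in I -> b \in Nb a -> Q (b |: U).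
Proof.
move=> QU aU aI ba; case: (boolP (b \in U)) => [bU|]; last exact: Qstep ba.
by rewrite (setUidPr _) ?sub1set.
Qed.

Lemma star_ind U a (l : seq V) : a \in I -> {subset l <= Nb a} -> a \in U -> Q U ->
  Q ([set x in l] :|: U).
Proof.
move=> aI; elim: l => [|b l IH] lN aU QU.
  by rewrite (_ : [set x in [::]] = set0) ?set0U //; apply/setP => x; rewrite !inE.
have := IH (fun x xl => lN x (mem_behead (s := b :: l) xl)) aU QU.
have -> : [set x in b :: l] :|: U = b |: ([set x in l] :|: U).
  by apply/setP => x; rewrite !inE orbA.
by move=> Q'; apply: (Qstep' (a := a)) => //; [rewrite inE aU orbT|apply: lN; exact: mem_head].
Qed.

(** A ball is built one vertex at a time, each next to a vertex of [I] already present; the tree and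
    the excess are both followed along this construction. *)
Lemma ball_ind h U st : dart G st -> innerv (nseq h d) st \subset I -> st.2 \in U -> Q U ->
  Q (U :|: ballv (nseq h d) st).
Proof.
elim: h U st => [|h IH] U st dst sI wU QU /=; first by rewrite setU0.
have : forall i, (ch st (i : 'I_d)).2 \in Nb st.2 by move=> i; case: (ch_Nb regG dst (ltn_ord i)).
move: (index_enum _) => l yN; elim: l U wU QU => [|i l IHl] U wU QU.
  by rewrite big_nil setU0.
have wI : st.2 \in I by apply: (fintype.subsetP sI); rewrite /= in_setU1 eqxx.
rewrite big_cons setUA; apply: IHl; first by rewrite inE wU.
rewrite setUCA setUA; rewrite -setUA.
rewrite (_ : (ch st i).2 |: (U :|: _) = ((ch st i).2 |: U) :|: ballv (nseq h d) (ch st i)); last first.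
  by rewrite setUA.
apply: (IH _ _ (ch_dart regG dst (ltn_ord i))).
- apply: subset_trans sI => /=; apply: subset_trans (subsetUr _ _).
  exact: (bigcup_sup i).
- exact: setU11.
- exact: (Qstep' (a := st.2)).
Qed.

End BallInd.

(** New vertices hang from inner vertices of the region only, so those outside [Ep] keep at most one
    tree edge. No new tree edge has both ends in [U], so excess edges remain excess edges. *)
Lemma tree_on_extend v U T Ep h st : dart G st -> tree_on v U T -> st.2 \in U ->
  innerv (nseq h d) st \subset Ep ->
  (forall x, x \in U -> x \notin Ep -> forall e e', e \in T -> e' \in T -> x \in e -> x \in e' -> e = e') ->
  let U' := U :|: ballv (nseq h d) st in
  exists T', [/\ tree_on v U' T', T \subset T',
    forall e, e \in T' -> e \subset U -> e \in T &
    forall x, x \in U' -> x \notin Ep -> forall e e', e \in T' -> e' \in T' -> x \in e -> x \in e' -> e = e'].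
Proof.
move=> dst tT wU sI deg1 U'.
pose Q (W : {set V}) := U \subset W /\ exists T', [/\ tree_on v W T', T \subset T',
    forall e, e \in T' -> e \subset U -> e \in T &
    forall x, x \in W -> x \notin Ep -> forall e e', e \in T' -> e' \in T' -> x \in e -> x \in e' -> e = e'].
suff: Q U' by case.
apply: (ball_ind (I := Ep)) => //; last by split=> //; exists T.
move=> W a b [UW [T' [tW TT' new d1]]] aW aE ba bW; split; first exact: subset_trans UW (subsetUr _ _).
have eT : forall e, e \in T' -> b \notin e.
  move=> e eT'; case: tW => _ /fintype.subsetP/(_ e eT'); rewrite inE => /andP[_ eW] _.
  by apply: contra bW; exact: (fintype.subsetP eW).
exists ([set a; b] |: T'); split.
- exact: tree_on_grow.
- exact: subset_trans TT' (subsetUr _ _).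
- move=> e; rewrite in_setU1 => /orP[/eqP->|/new//].
  by rewrite subUset !sub1set => /andP[_ bU]; case/negP: bW; exact: (fintype.subsetP UW).
- move=> x; rewrite in_setU1 => /orP[/eqP->|xW] xE e e'.
    rewrite !in_setU1 => /orP[/eqP->|/eT h1] /orP[/eqP->|/eT h2] // h3 h4.
    + by rewrite h4 in h2.
    + by rewrite h3 in h1.
    + by rewrite h3 in h1.
  have xa : x \notin [set a; b].
    rewrite !inE negb_or; apply/andP; split; apply/eqP => ex; first by rewrite ex aE in xE.
    by rewrite ex (negPf bW) in xW.
  rewrite !in_setU1 => /orP[/eqP->|eT1]; first by rewrite (negPf xa).
  by move=> /orP[/eqP->|eT2]; [rewrite (negPf xa)|exact: (d1 x)].
Qed.

Lemma inner_add U b : b \notin U -> #|inner (b |: U)| = (#|inner U| + #|Nb b :&: U|)%N.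
Proof.
move=> bU; have inj : {in Nb b :&: U &, injective (fun y => [set b; y])}.
  move=> y y'; rewrite !inE => /andP[_ yU] _ /eqP; rewrite set2_eqP eqxx /= => /orP[/eqP//|/andP[_ /eqP e2]].
  by rewrite e2 (negPf bU) in yU.
rewrite -(card_in_imset inj).
have -> : inner (b |: U) = inner U :|: [set [set b; y] | y in Nb b :&: U].
  apply/setP => e; apply/idP/setUP.
    rewrite inE => /andP[eG eU]; case: (boolP (b \in e)) => be; last first.
      left; rewrite inE eG; apply/fintype.subsetP => x xe.
      move: (fintype.subsetP eU x xe); rewrite in_setU1 => /orP[/eqP ex|//].
      by rewrite -ex xe in be.
    have [y ey yN] := G_edge_at regG eG be.
    right; apply/imsetP; exists y => //; rewrite in_setI yN /=.
    have : y \in b |: U by apply: (fintype.subsetP eU); rewrite ey !inE eqxx orbT.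
    rewrite in_setU1 => /orP[/eqP eyb|//].
    by have := Nb_irr regG b; rewrite -{1}eyb yN.
  case=> [|/imsetP[y]].
    by rewrite !inE => /andP[-> eU]; apply: subset_trans eU (subsetUr _ _).
  rewrite !inE => /andP[yN yU] ->; rewrite yN subUset !sub1set !inE eqxx yU orbT //.
rewrite cardsU (_ : inner U :&: _ = set0) ?cards0 ?subn0 //.
apply/setP => e; rewrite !inE; apply/negP => /andP[/andP[_ eU] /imsetP[y _ ee]].
by case/negP: bU; apply: (fintype.subsetP eU); rewrite ee !inE eqxx.
Qed.

(* The number of inner edges minus the number of vertices does not decrease. *)
Definition exc_le U U' := (U \subset U') && (#|inner U| + #|U'| <= #|inner U'| + #|U|)%N.

Lemma exc_le_refl U : exc_le U U. Proof. by rewrite /exc_le subxx leqnn. Qed.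

Lemma exc_le_trans : transitive exc_le.
Proof.
move=> U' U U'' /andP[s1 l1] /andP[s2 l2]; rewrite /exc_le (subset_trans s1 s2) /=.
by move: l1 l2; move: #|inner U| #|inner U'| #|inner U''| #|U| #|U'| #|U''| => *; lia.
Qed.

Lemma exc_le_add U a b : a \in U -> b \in Nb a -> b \notin U -> exc_le U (b |: U).
Proof.
move=> aU ba bU; rewrite /exc_le subsetUr /= inner_add // cardsU1 bU.
have : (0 < #|Nb b :&: U|)%N by apply/card_gt0P; exists a; rewrite in_setI -Nb_sym ba.
by move: #|inner U| #|U| #|Nb b :&: U| => *; lia.
Qed.

Lemma exc_le_ball h U st : dart G st -> st.2 \in U -> exc_le U (U :|: ballv (nseq h d) st).
Proof.
move=> dst wU; apply: (ball_ind (Q := fun W => exc_le U W) (I := [set: V])) => //.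
- by move=> W a b UW aW _ ba bW; apply: exc_le_trans UW _; exact: (exc_le_add aW ba bW).
- exact: exc_le_refl.
Qed.

Lemma exc_le_children h U st (l : seq 'I_d) : dart G st -> st.2 \in U ->
  exc_le U (U :|: \bigcup_(i <- l) ((ch st i).2 |: ballv (nseq h d) (ch st i))).
Proof.
move=> dst; elim: l U => [|i l IH] U wU; first by rewrite big_nil setU0 exc_le_refl.
rewrite big_cons setUA; apply: exc_le_trans (IH _ _); last by rewrite inE wU.
rewrite setUA (setUC U).
have [yN _] := ch_Nb regG dst (ltn_ord i).
apply: (exc_le_trans (y := (ch st i).2 |: U)).
  case: (boolP ((ch st i).2 \in U)) => yU; last exact: (exc_le_add wU yN yU).
  by rewrite (setUidPr _) ?sub1set // exc_le_refl.
by apply: exc_le_ball; [exact: (ch_dart regG dst (ltn_ord i))|rewrite setU11].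
Qed.

(** A second neighbour of [b] in [U] would raise the excess, which cannot come down again by
    [U']. *)
Lemma exc_le_nbr U U' a b : a \in U -> b \in Nb a -> b \notin U -> exc_le (b |: U) U' ->
  (#|inner U'| + #|U| <= #|inner U| + #|U'|)%N -> forall x, x \in Nb b -> x \in U -> x = a.
Proof.
move=> aU ba bU /andP[_ l1] l2 x xb xU.
move: l1; rewrite inner_add // cardsU1 bU => l1.
have : (#|Nb b :&: U| <= 1)%N.
  by move: l1 l2; move: #|inner U| #|inner U'| #|U| #|U'| #|Nb b :&: U| => *; lia.
move/card_le1P/(_ a) => h.
have aN : a \in Nb b :&: U by rewrite in_setI -Nb_sym ba.
have := h aN x; rewrite !inE; move: xb; rewrite inE => ->; rewrite xU /=.
by move/esym/eqP.
Qed.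

(** The excess is monotone along the construction, so no increase overall means none at any step:
    every vertex arrives with a single neighbour already present, and the ball is a tree off [U]. *)
Lemma fresh_region h U st : dart G st -> st.2 \in U ->
  (forall b, b \in Nb st.2 -> b \in U -> b = st.1) ->
  (#|inner (U :|: ballv (nseq h d) st)| + #|U| <=
   #|inner U| + #|U :|: ballv (nseq h d) st|)%N ->
  [/\ forall z : pos (nseq h d), rvtx st z \notin U,
      injective (@vtx _ _ ch (fun st : V * V => st.2) (nseq h d) st) &
      forall (z : pos (nseq h d)) a, a \in Nb (rvtx st z) -> a \in U -> a = st.2].
Proof.
elim: h U st => [|h IH] U st dst wU un exc.
  by split=> [[]|[]|[]].
set w := st.2 in wU un *; pose y (i : 'I_d) := (ch st i).2.
pose B (i : 'I_d) := y i |: ballv (nseq h d) (ch st i).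
pose P := pos (nseq h.+1 d).
have yN i : y i \in Nb w /\ y i != st.1 := ch_Nb regG dst (ltn_ord i).
have yU i : y i \notin U.
  by apply/negP => yiU; have [yi /eqP] := yN i; apply; exact: un.
have yinj i j : y i = y j -> i = j.
  by move=> e; apply/val_inj/(ch_inj regG dst (ltn_ord i) (ltn_ord j) e).
(* Branches are added one by one. Of the vertices added so far, only children already treated may be
   adjacent to [w], so the next child is still new. *)
have main (l : seq 'I_d) U' : uniq l -> U \subset U' ->
    (forall b, b \in U' -> b \notin U -> w \in Nb b -> exists2 j, j \notin l & b = y j) ->
    (#|inner (U' :|: \bigcup_(i <- l) B i)| + #|U'| <= #|inner U'| + #|U' :|: \bigcup_(i <- l) B i|)%N ->
    [/\ forall i o, i \in l -> rvtx st ((i, o) : P) \notin U',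
       forall i j o o', i \in l -> j \in l -> rvtx st ((i, o) : P) = rvtx st ((j, o') : P) ->
          (i, o) = (j, o') &
       forall i o a, i \in l -> a \in Nb (rvtx st ((i, o) : P)) -> a \in U -> a = w].
  elim: l U' => [|i l IHl] U' /=; first by [].
  case/andP=> il ul UU' inv; rewrite big_cons setUA; set Uf := _ :|: \bigcup_(_ <- l) _ => exc'.
  have wU' : w \in U' by exact: (fintype.subsetP UU').
  have yU' : y i \notin U'.
    apply/negP => yiU'; have wNb : w \in Nb (y i) by rewrite Nb_sym; case: (yN i).
    have [j] := inv _ yiU' (yU i) wNb.
    by rewrite inE negb_or => /andP[ji _] /yinj e; rewrite e eqxx in ji.
  have eB : U' :|: B i = (y i |: U') :|: ballv (nseq h d) (ch st i).
    by rewrite /B setUA (setUC U').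
  have di : dart G (ch st i) := ch_dart regG dst (ltn_ord i).
  have s1 : exc_le U' (y i |: U') by apply: (exc_le_add wU') yU'; case: (yN i).
  have s2 : exc_le (y i |: U') (U' :|: B i).
    by rewrite eB; apply: exc_le_ball => //; rewrite setU11.
  have s3 : exc_le (U' :|: B i) Uf.
    by apply: exc_le_children; rewrite // in_setU wU'.
  have nb1 : forall x, x \in Nb (y i) -> x \in U' -> x = w.
    by apply: (exc_le_nbr wU' _ yU' (exc_le_trans s2 s3) exc'); case: (yN i).
  have [||g1 g2 g3] := IH (y i |: U') (ch st i) di (setU11 _ _).
  - move=> b bN; rewrite in_setU1 => /orP[/eqP e|bU']; last exact: nb1.
    by rewrite e in bN; rewrite (negPf (Nb_irr regG _)) in bN.
  - rewrite -eB; move: s1 s2 s3 exc' => /andP[_ +] /andP[_ +] /andP[_ +].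
    move: #|inner U'| #|U'| #|inner (y i |: U')| #|y i |: U'| #|inner (U' :|: B i)|
      #|U' :|: B i| #|inner Uf| #|Uf| => *; lia.
  have g1' (x : pos (nseq h d)) : rvtx (ch st i) x \notin U' /\ rvtx (ch st i) x != y i.
    by have := g1 x; rewrite in_setU1 negb_or => /andP[].
  have headU (o : option (pos (nseq h d))) : rvtx st ((i, o) : P) \notin U' by case: o => [x|] /=; [case: (g1' x)|exact: yU'].
  have headB (o : option (pos (nseq h d))) : rvtx st ((i, o) : P) \in B i.
    rewrite /B in_setU1; case: o => [x|] /=; last by rewrite eqxx.
    by apply/orP; right; apply/ballvP; exists x.
  have [|||k1 k2 k3] := IHl (U' :|: B i) ul.
  - by apply: subset_trans UU' (subsetUl _ _).
  - move=> b; rewrite in_setU => /orP[bU'|].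
      move=> bU wb; have [j] := inv b bU' bU wb.
      by rewrite inE negb_or => /andP[_ jl] ->; exists j.
    rewrite in_setU1 => /orP[/eqP-> _ _|/ballvP[x ->] _ wx]; first by exists i.
    have e := g3 x w wx; rewrite in_setU1 wU' orbT in e.
    by have := yU i; rewrite /y -(e isT) wU.
  - move: s1 s2 exc' => /andP[_ +] /andP[_ +].
    rewrite -/Uf; move: #|inner U'| #|U'| #|inner (y i |: U')| #|y i |: U'| #|inner (U' :|: B i)|
      #|U' :|: B i| #|inner Uf| #|Uf| => *; lia.
  have sep j (o o' : option (pos (nseq h d))) : j \in l -> rvtx st ((i, o) : P) <> rvtx st ((j, o') : P).
    move=> jl e; have := k1 j o' jl; rewrite -e in_setU negb_or => /andP[_].
    by rewrite headB.
  have headI (o o' : option (pos (nseq h d))) : rvtx st ((i, o) : P) = rvtx st ((i, o') : P) -> o = o'.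
    case: o o' => [x|] [x'|] //=; first by move/g2 ->.
    - by move=> e; case: (g1' x) => _ /eqP; rewrite e.
    - by move=> e; case: (g1' x') => _ /eqP; rewrite -e.
  split.
  - move=> j o; rewrite inE => /orP[/eqP->|jl]; first exact: headU.
    by have := k1 j o jl; rewrite in_setU negb_or => /andP[].
  - move=> j j' o o'; rewrite !inE => /orP[/eqP->|jl] /orP[/eqP->|jl'] e.
    + by rewrite (headI _ _ e).
    + by case: (sep _ _ _ jl' e).
    + by case: (sep _ _ _ jl (esym e)).
    + exact: k2.
  - move=> j o a; rewrite inE => /orP[/eqP->|jl]; last exact: k3.
    case: o => [x|] /= aN aU; last by apply: nb1 => //; exact: (fintype.subsetP UU').
    have e := g3 x a aN; rewrite in_setU1 (fintype.subsetP UU' _ aU) orbT in e.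
    by have := yU i; rewrite /y -(e isT) aU.
have [||||m1 m2 m3] := main (index_enum _) U.
- exact: index_enum_uniq.
- by [].
- by move=> b -> .
- exact: exc.
split=> [[i o]|[i o] [j o'] e|[i o] a].
- by apply: m1; rewrite mem_index_enum.
- by apply: m2; rewrite ?mem_index_enum.
- by apply: m3; rewrite mem_index_enum.
Qed.

End Growth.

(** * Exploration of an open cluster *)

Section OpenCluster.
Variable V : finType.
Implicit Types (Z : {set {set V}}) (x a b : V).

Lemma open_cluster_refl Z x : x \in open_cluster Z x.
Proof. by rewrite inE connect0. Qed.

Lemma open_cluster_step Z x a b : a \in open_cluster Z x -> [set a; b] \in Z -> b \in open_cluster Z x.
Proof. by rewrite !inE => xa ab; apply: connect_trans xa _; exact: connect1. Qed.

Lemma open_cluster_min Z x (S : {set V}) :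
  (forall a b, a \in S -> [set a; b] \in Z -> b \in S) -> x \in S -> open_cluster Z x \subset S.
Proof.
move=> cl xS; apply/fintype.subsetP => b; rewrite inE.
exact: (connect_invariant (S := fun a => a \in S) cl).
Qed.

Lemma open_cluster_sym Z a b : (a \in open_cluster Z b) = (b \in open_cluster Z a).
Proof. by rewrite !inE (sym_connect_sym (adj_sym Z)). Qed.

Lemma open_cluster_trans Z a b c :
  b \in open_cluster Z a -> c \in open_cluster Z b -> c \in open_cluster Z a.
Proof. by rewrite !inE; exact: connect_trans. Qed.

Lemma open_cluster_mono Z Z' x : Z \subset Z' -> open_cluster Z x \subset open_cluster Z' x.
Proof.
move=> ZZ; apply: open_cluster_min (open_cluster_refl _ _) => a b aS ab.
by apply: open_cluster_step aS _; exact: (fintype.subsetP ZZ).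
Qed.

Lemma card_bigcup_le (I T : finType) (P : pred I) (F : I -> {set T}) :
  (#|\bigcup_(i | P i) F i| <= \sum_(i | P i) #|F i|)%N.
Proof.
elim/big_rec2: _ => [|i n A _ le]; first by rewrite cards0.
by rewrite (leq_trans (leq_card_setU _ _)) // leq_add2l.
Qed.

End OpenCluster.

Lemma reach_full ds (z : pos ds) : reach (mkc xpredT) z.
Proof. by elim: ds z => [|D ds IH] [] // i [x|] /=; rewrite ffunE //= IH. Qed.

Lemma parent_nonleaf ds (z z' : pos ds) : parent z = Some z' -> ~~ leafp z'.
Proof.
elim: ds z z' => [|D ds IH] [] // i [x|] z' //= [<-] /=.
by case ex: (parent x) => [y|]; [exact: IH ex|exact: pos_nonnil x].
Qed.

Section Exploration.
Variables (V : finType) (d h : nat) (G : {set {set V}}) (v : V).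
Hypothesis regG : regular d.+1 G.
Notation Nb := (Nb G).
Notation ch := (ch G).
Notation ds := (nseq h.+1 d).
Notation rvtx := (@vtx _ _ ch (fun st : V * V => st.2) ds).
Notation rvo := (@vo _ _ ch (fun st : V * V => st.2) ds).
Notation redge := (@edge _ _ ch (fun st : V * V => st.2) ds).
Notation ballv := (ballv G).
Notation innerv := (innerv G).
Implicit Types (U Ep : {set V}) (T Z : {set {set V}}) (st : V * V).

Definition region_size : nat := #|pos ds|.+1.

Definition explored Ep : {set {set V}} := [set e in G | [exists a in Ep, a \in e]].

(* [U] is the set of discovered vertices, [Ep] that of the vertices all of whose
   edges have been revealed, [T] a tree spanning [U], and [Z] the upper bound
   obtained so far on the open edges among the revealed ones. *)
Record explore_inv U Ep T Z : Prop := ExploreInv {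
  inv_root : v \in Ep;
  inv_sub : Ep \subset U;
  inv_nb : forall a, a \in Ep -> Nb a \subset U;
  inv_tree : tree_on G v U T;
  inv_deg : forall x, x \in U -> x \notin Ep -> forall e e', e \in T -> e' \in T -> x \in e -> x \in e' -> e = e';
  inv_open : Z \subset explored Ep;
  inv_comp : forall z, z \notin open_cluster Z v -> (#|open_cluster Z z| <= region_size)%N }.

Definition excess U T := inner G U :\: T.

(* Strictly increases at each exploration step whose region is not a fresh
   tree, and is at most three times the number of excess edges. *)
Definition badness U Ep T : nat := (#|excess U T| + #|Ep :&: cover (excess U T)|)%N.

Lemma exploredP Ep e : reflect (exists2 a, a \in Ep & exists2 b, b \in Nb a & e = [set a; b]) (e \in explored Ep).
Proof.
rewrite inE; apply: (iffP andP) => [[eG /existsP[a /andP[aE ae]]]|[a aE [b bN ->]]].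
  by have [b eb bN] := G_edge_at regG eG ae; exists a => //; exists b.
split; first by move: bN; rewrite inE.
by apply/existsP; exists a; rewrite aE !inE eqxx.
Qed.

Lemma inv_open_in U Ep T Z e : explore_inv U Ep T Z -> e \in Z -> e \subset U.
Proof.
move=> I eZ; have /exploredP[a aE [b bN ->]] := fintype.subsetP (inv_open I) e eZ.
rewrite subUset !sub1set (fintype.subsetP (inv_sub I)) //=.
exact: (fintype.subsetP (inv_nb I aE)).
Qed.

Lemma inv_end U Ep T Z a b : explore_inv U Ep T Z -> [set a; b] \in Z -> a \in U /\ b \in U.
Proof. by move=> I /(inv_open_in I); rewrite subUset !sub1set => /andP[]. Qed.

Lemma cluster_in U Ep T Z x : explore_inv U Ep T Z -> x \in U -> open_cluster Z x \subset U.
Proof. by move=> I; apply: open_cluster_min => a b _ /(inv_end I) []. Qed.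

Lemma inv_rootU U Ep T Z : explore_inv U Ep T Z -> v \in U.
Proof. by move=> I; apply: (fintype.subsetP (inv_sub I)); exact: inv_root I. Qed.

Lemma frontier_dart U Ep T Z w : explore_inv U Ep T Z -> w \in open_cluster Z v -> w \notin Ep ->
  exists2 x, x \in Ep & dart G (x, w).
Proof.
move=> I; rewrite inE => /connectP[s ps ew] wE.
case/lastP: s ps ew => [_ ew|s y].
  by rewrite /= in ew; rewrite ew (inv_root I) in wE.
rewrite rcons_path last_rcons => /andP[_ +] ew; rewrite -{y}ew /adj /= => eZ.
have /exploredP[a aE [b bN e]] := fintype.subsetP (inv_open I) _ eZ.
move/eqP: e; rewrite set2_eqP => /orP[]/andP[/eqP e1 /eqP e2]; last by rewrite e2 aE in wE.
by exists (last v s); rewrite /dart /= ?e1 // Nb_sym e2.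
Qed.

Section Step.
Variables (U Ep : {set V}) (T Z : {set {set V}}) (x w : V).
Hypothesis I : explore_inv U Ep T Z.
Hypothesis wD : w \in open_cluster Z v.
Hypothesis wE : w \notin Ep.
Hypothesis xE : x \in Ep.
Hypothesis dst : dart G (x, w).
Let st := (x, w).
Let U' := U :|: ballv ds st.
Let Ep' := Ep :|: innerv ds st.

Let wU : w \in U.
Proof. by apply: (fintype.subsetP (cluster_in I (inv_rootU I))). Qed.

Let xU : x \in U. Proof. exact: (fintype.subsetP (inv_sub I)). Qed.

Lemma vo_parent_innerv (z : pos ds) : rvo st (parent z) \in innerv ds st.
Proof.
apply/innervP; case ez: (parent z) => [z'|]; last by left.
by right; exists z' => //; exact: parent_nonleaf ez.
Qed.

Lemma vo_U' (o : option (pos ds)) : rvo st o \in U'.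
Proof.
rewrite in_setU; case: o => [z|]; last by rewrite /= wU.
by apply/orP; right; apply/ballvP; exists z.
Qed.

Lemma innerv_nbr a b : a \in innerv ds st -> b \in Nb a -> (a = w /\ b = x) \/
  exists2 z, [set a; b] = redge st z & b \in U'.
Proof.
case/innervP => [[-> _] bN|[z nl ->] bN].
  case: (eqVneq b x) => [->|bx]; first by left.
  right; have [z [pz ->]] := root_children regG dst (ltn0Sn h) bN bx.
  by exists z; [rewrite /edge pz finset.setUC|exact: (vo_U' (Some z))].
right; case: (node_children regG dst nl bN) => [->|[z' [pz ->]]].
  by exists z => //; exact: vo_U'.
by exists z'; [rewrite /edge pz finset.setUC|exact: (vo_U' (Some z'))].
Qed.

Lemma newly_explored e : e \in explored Ep' -> e \notin explored Ep -> exists z, e = redge st z.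
Proof.
case/exploredP=> a; rewrite in_setU => /orP[aE|ai] [b bN ->] ne.
  by case/exploredP: ne; exists a => //; exists b.
case: (innerv_nbr ai bN) => [[ea eb]|[z -> _]]; last by exists z.
case/exploredP: ne; exists x => //; exists w; first by rewrite Nb_sym.
by rewrite ea eb finset.setUC.
Qed.

Lemma redge_explored z : redge st z \in explored Ep'.
Proof.
rewrite inE redge_G //=; apply/existsP; exists (rvo st (parent z)).
by rewrite in_setU vo_parent_innerv orbT /edge !inE eqxx orbT.
Qed.

Lemma inv_step T' Z' : tree_on G v U' T' ->
  (forall y, y \in U' -> y \notin Ep' -> forall e e', e \in T' -> e' \in T' -> y \in e -> y \in e' -> e = e') ->
  (forall e, e \in Z' -> e \in Z \/ exists z, e = redge st z) ->
  (forall z, z \notin open_cluster Z' v -> (#|open_cluster Z' z| <= region_size)%N) ->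
  explore_inv U' Ep' T' Z'.
Proof.
move=> tT d1 ZZ comp; split=> //.
- by rewrite in_setU (inv_root I).
- apply/fintype.subsetP => a; rewrite in_setU => /orP[aE|/innervP[[-> _]|[z _ ->]]].
  + by rewrite in_setU (fintype.subsetP (inv_sub I)).
  + by rewrite in_setU wU.
  + exact: (vo_U' (Some z)).
- move=> a; rewrite in_setU => /orP[aE|ai].
    exact: subset_trans (inv_nb I aE) (subsetUl _ _).
  apply/fintype.subsetP => b bN; case: (innerv_nbr ai bN) => [[_ ->]|[z _ //]].
  by rewrite in_setU xU.
- apply/fintype.subsetP => e /ZZ[eZ|[z ->]]; last exact: redge_explored.
  have /exploredP[a aE [b bN ->]] := fintype.subsetP (inv_open I) _ eZ.
  by apply/exploredP; exists a; [rewrite in_setU aE|exists b].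
Qed.

(** On a region that is not a fresh tree the domination fails, so all its edges are declared
    open. *)
Definition open_bad := Z :|: [set redge st z | z : pos ds].

Lemma open_badP e : e \in open_bad -> e \in Z \/ exists z, e = redge st z.
Proof. by rewrite in_setU => /orP[|/imsetP[z _ ->]]; [left|right; exists z]. Qed.

Let D := open_cluster Z v.

Lemma cluster_bad o : rvo st o \in open_cluster open_bad v.
Proof.
have wD' : w \in open_cluster open_bad v.
  exact: (fintype.subsetP (open_cluster_mono v (subsetUl _ _))).
case: o => [z|] //; apply: open_cluster_trans wD' _.
rewrite open_cluster_sym inE; apply: reach_connect (reach_full z) => z' _.
by apply: connect1; rewrite /adj /= in_setU; apply/orP; right; apply/imsetP; exists z'.
Qed.

(** The cluster absorbs at most one component per position of the region, each bounded through
    [inv_comp]. *)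
Lemma inv_bad T' : tree_on G v U' T' ->
  (forall y, y \in U' -> y \notin Ep' -> forall e e', e \in T' -> e' \in T' -> y \in e -> y \in e' -> e = e') ->
  explore_inv U' Ep' T' open_bad /\
  (#|open_cluster open_bad v :\: Ep'| <= #|D :\: Ep| + region_size * region_size)%N.
Proof.
move=> tT d1; set D' := open_cluster open_bad v.
have DD' : D \subset D' by exact: open_cluster_mono (subsetUl _ _).
split.
  apply: inv_step => // [e /open_badP//|z zD'].
  have zD : z \notin D by apply: contra zD'; exact: (fintype.subsetP DD').
  apply: leq_trans (inv_comp I zD); apply: subset_leq_card.
  have sub : open_cluster open_bad z \subset open_cluster Z z :|: D'.
    apply: open_cluster_min; last by rewrite in_setU open_cluster_refl.
    move=> a b /setUP[aZ|aD] ab; rewrite in_setU; last first.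
      by apply/orP; right; exact: open_cluster_step ab.
    case: (open_badP ab) => [abZ|[y ey]]; first by rewrite (open_cluster_step aZ abZ).
    have : b \in redge st y by rewrite -ey !inE eqxx orbT.
    by move/set2P=> []->; apply/orP; right; [exact: (cluster_bad (Some y))|exact: cluster_bad].
  apply/fintype.subsetP => b bz; have := fintype.subsetP sub b bz.
  rewrite in_setU => /orP[//|bD]; case/negP: zD'.
  by apply: open_cluster_trans bD _; rewrite open_cluster_sym.
pose C := \bigcup_(z : pos ds | rvtx st z \notin D) open_cluster Z (rvtx st z).
have sub : D' \subset D :|: C.
  apply: open_cluster_min; last by rewrite in_setU open_cluster_refl.
  have voS o : rvo st o \in D :|: C.
    rewrite in_setU; case: o => [z|] /=; last by rewrite wD.
    case: (boolP (rvtx st z \in D)) => //= zD; apply/bigcupP; exists z => //.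
    exact: open_cluster_refl.
  move=> a b aS ab.
  case: (open_badP ab) => [abZ|[y ey]]; last first.
    have : b \in redge st y by rewrite -ey !inE eqxx orbT.
    by move/set2P=> []->; [exact: (voS (Some y))|exact: voS].
  rewrite in_setU; case/setUP: aS => [aD|/bigcupP[z zD az]].
    by rewrite (open_cluster_step aD abZ).
  by apply/orP; right; apply/bigcupP; exists z => //; exact: open_cluster_step abZ.
apply: (@leq_trans #|(D :\: Ep) :|: C|)%N.
  apply: subset_leq_card; apply/fintype.subsetP => b; rewrite in_setD => /andP[bE bD].
  have {}bE : b \notin Ep by apply: contra bE => bE; rewrite in_setU bE.
  by have := fintype.subsetP sub b bD; rewrite !in_setU in_setD bE.
apply: leq_trans (leq_card_setU _ _) _; rewrite leq_add2l.
apply: leq_trans (card_bigcup_le _ _) _.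
apply: (@leq_trans (\sum_(z : pos ds | rvtx st z \notin D) region_size))%N.
  by apply: leq_sum => z zD; exact: (inv_comp I zD).
rewrite sum_nat_const leq_mul2r; apply/orP; right.
by apply: leq_trans (max_card _) _; rewrite /region_size.
Qed.

Section Good.
Hypothesis fresh : forall z : pos ds, rvtx st z \notin U.
Hypothesis inj : injective (rvtx st).

Lemma vo_inj : injective (rvo st).
Proof.
move=> [z|] [z'|] // e; first by rewrite (inj (e : rvtx st z = rvtx st z')).
- by have := fresh z; rewrite (e : rvtx st z = w) wU.
- by have := fresh z'; rewrite -(e : w = rvtx st z') wU.
Qed.

Definition open_good (y : conf ds) := Z :|: [set redge st z | z in [set z | getc y z]].

Lemma open_goodP y e : e \in open_good y -> e \in Z \/ exists2 z, e = redge st z & getc y z.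
Proof. by rewrite in_setU => /orP[|/imsetP[z]]; [left|rewrite inE => gz ->; right; exists z]. Qed.

(** The frontier loses [w] and gains at most the leaves that [y] joins to it, since fresh vertices
    lie on no edge of [Z]. Components of the new region that miss the cluster stay inside the
    region, whence [inv_comp]. *)
Lemma inv_good T' y : tree_on G v U' T' ->
  (forall y, y \in U' -> y \notin Ep' -> forall e e', e \in T' -> e' \in T' -> y \in e -> y \in e' -> e = e') ->
  explore_inv U' Ep' T' (open_good y) /\
  (#|open_cluster (open_good y) v :\: Ep'|.+1 <= #|D :\: Ep| + nleaf y)%N.
Proof.
move=> tT d1; set Z' := open_good y; set D' := open_cluster Z' v.
have DU : D \subset U := cluster_in I (inv_rootU I).
have DD' : D \subset D' by exact: open_cluster_mono (subsetUl _ _).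
have vnU z a : a \in U -> a <> rvtx st z by move=> aU e; have := fresh z; rewrite -e aU.
have edge_cases a b : [set a; b] \in Z' -> [set a; b] \in Z \/
    exists2 z, getc y z & (a = rvtx st z /\ b = rvo st (parent z)) \/ (a = rvo st (parent z) /\ b = rvtx st z).
  case/open_goodP => [|[z /eqP]]; first by left.
  rewrite /edge set2_eqP => /orP[]/andP[/eqP e1 /eqP e2] gz; right; exists z => //; by [left|right].
split.
  apply: inv_step => // [e /open_goodP[|[z -> _]]|z zD']; [by left|by right; exists z|].
  have zD : z \notin D by apply: contra zD'; exact: (fintype.subsetP DD').
  have disj b : b \in open_cluster Z' z -> b \notin D'.
    move=> bz; apply: contra zD' => bD; apply: open_cluster_trans bD _.
    by rewrite open_cluster_sym.
  have wD' : w \in D' by exact: (fintype.subsetP DD').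
  case: (boolP (z \in U)) => zU.
    apply: leq_trans (inv_comp I zD); apply: subset_leq_card.
    have sub : open_cluster Z' z \subset open_cluster Z z :|: D'.
      apply: open_cluster_min; last by rewrite in_setU open_cluster_refl.
      move=> a b /setUP[aZ|aD] ab; rewrite in_setU; last first.
        by apply/orP; right; exact: open_cluster_step ab.
      have aU : a \in U by exact: (fintype.subsetP (cluster_in I zU)).
      case: (edge_cases _ _ ab) => [abZ|[z' _ [[e1 _]|[e1 _]]]].
      - by rewrite (open_cluster_step aZ abZ).
      - by case: (vnU z' a aU).
      - apply/orP; right; apply: open_cluster_step ab.
        by rewrite e1; rewrite e1 in aU; case: (parent z') aU => //= z''; rewrite (negPf (fresh z'')).
    apply/fintype.subsetP => b bz; have := fintype.subsetP sub b bz.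
    by rewrite in_setU (negPf (disj _ bz)) orbF.
  have sub : open_cluster Z' z \subset (z |: ballv ds st) :|: D'.
    apply: open_cluster_min; last by rewrite in_setU in_setU1 eqxx.
    move=> a b /setUP[aS|aD] ab; last first.
      by rewrite in_setU; apply/orP; right; exact: open_cluster_step ab.
    have aU : a \notin U.
      by move: aS; rewrite in_setU1 => /orP[/eqP->//|/ballvP[z' ->]].
    case: (edge_cases _ _ ab) => [/(inv_end I)[aU' _]|[z' _ [[_ ->]|[_ ->]]]].
    - by rewrite aU' in aU.
    - apply/setUP; case: (parent z') => [z''|]; last by right.
      by left; apply/setU1P; right; apply/ballvP; exists z''.
    - by apply/setUP; left; apply/setU1P; right; apply/ballvP; exists z'.
  apply: (@leq_trans #|z |: ballv ds st|)%N.
    apply: subset_leq_card; apply/fintype.subsetP => b bz; have := fintype.subsetP sub b bz.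
    by rewrite in_setU (negPf (disj _ bz)) orbF.
  rewrite cardsU1 /region_size; apply: leq_trans (_ : 1 + #|ballv ds st| <= _)%N; first by rewrite leq_add2r leq_b1.
  by rewrite add1n ltnS card_ballv.
pose C := [set rvtx st z | z in [set z | leafp z && reach y z]].
have sub : D' \subset D :|: [set rvtx st z | z in [set z | reach y z]].
  apply: open_cluster_min; last by rewrite in_setU open_cluster_refl.
  have voS o : reacho y o -> rvo st o \in D :|: [set rvtx st z | z in [set z | reach y z]].
    rewrite in_setU; case: o => [z|] rz; last by rewrite /= wD.
    by apply/orP; right; apply/imsetP; exists z; rewrite ?inE.
  have voR o : rvo st o \in D :|: [set rvtx st z | z in [set z | reach y z]] -> reacho y o.
    case: o => [z|] //; rewrite in_setU => /orP[zD|/imsetP[z' +]].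
      by case: (vnU z _ (fintype.subsetP DU _ zD)).
    by rewrite inE => rz /inj ->.
  move=> a b aS ab; case: (edge_cases _ _ ab) => [abZ|[z' gz [[ea ->]|[ea ->]]]].
  - have [aU _] := inv_end I abZ.
    move: aS; rewrite in_setU => /orP[aD|/imsetP[z _ ez]]; last by case: (vnU z a aU).
    by rewrite in_setU (open_cluster_step aD abZ).
  - rewrite ea in aS; have aR : reach y z' := voR (Some z') aS.
    by apply: voS; move: aR; rewrite reachE => /andP[].
  - apply: (voS (Some z')); rewrite /reacho reachE gz /=; apply: voR; by rewrite -ea.
have wDE : w \in D :\: Ep by rewrite in_setD wE.
rewrite (cardsD1 w (D :\: Ep)) wDE add1n addSn ltnS.
rewrite (nleafE (ds := nseq h d)).
apply: (@leq_trans #|((D :\: Ep) :\ w) :|: C|)%N.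
  apply: subset_leq_card; apply/fintype.subsetP => b; rewrite in_setD => /andP[bE' bD].
  have bE : b \notin Ep by apply: contra bE' => bE; rewrite in_setU bE.
  have bi : b \notin innerv ds st by apply: contra bE' => bi; rewrite in_setU bi orbT.
  have := fintype.subsetP sub b bD; rewrite !in_setU => /orP[bD0|/imsetP[z]].
    rewrite in_setD1 in_setD bE bD0 andbT andbT; apply/orP; left; apply/eqP => ebw.
    by case/innervP: bi; left; rewrite ebw.
  rewrite inE => rz ez; apply/orP; right; apply/imsetP; exists z => //; rewrite inE rz andbT.
  by apply: contraT => nl; case/innervP: bi; right; exists z.
apply: leq_trans (leq_card_setU _ _) _; rewrite leq_add2l.
exact: leq_imset_card.
Qed.

End Good.

End Step.

End Exploration.

Section FoldFilter.
Variables (R : realType) (p q : R) (ds : seq nat) (X : eqType).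

Lemma foldl_updm_filter (m : X -> option (pos ds)) (a : pred X) c o :
  (forall e, m e != None -> a e) ->
  foldl (updm m) c o = foldl (updm m) c [seq x <- o | a x.1].
Proof.
move=> ma; elim: o c => [|[e u] o IH] c //=.
case ae: (a e) => /=; first exact: IH.
rewrite IH; congr foldl; rewrite /updm /=; case me: (m e) => [z|] //.
by have := ma e; rewrite me ae => /(_ isT).
Qed.

End FoldFilter.

Lemma add_double_le e c i J : (e <= J)%N -> (c <= e.*2)%N -> (i <= c)%N -> (e + i <= 3 * J)%N.
Proof. lia. Qed.

Lemma leq_sub_lt a b c : (a < b)%N -> (b <= c)%N -> ((c - b).+1 <= c - a)%N.
Proof. lia. Qed.

Section ExplorationBound.
Variables (R : realType) (p q : R).
Hypotheses (hq : 1 <= q) (hp : 0 < p < 1).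
Variables (V : finType) (d h : nat) (G : {set {set V}}) (v : V).
Hypothesis regG : regular d.+1 G.
Notation Nb := (Nb G).
Notation ds := (nseq h.+1 d).
Notation ch := (ch G).
Notation rvtx := (@vtx _ _ ch (fun st : V * V => st.2) ds).
Notation rvo := (@vo _ _ ch (fun st : V * V => st.2) ds).
Notation redge := (@edge _ _ ch (fun st : V * V => st.2) ds).
Notation K0 := (region_size d h).
Implicit Types (U Ep : {set V}) (T Z : {set {set V}}) (st : V * V).
Implicit Types (L : seq ((V * V) * conf ds)).

Let X o := foldl (@fk_upd V) G o.
(* The region chain starts from the all-open configuration, as the dynamics. *)
Let Y st o : conf ds := foldl (updm (region_of d G h.+1 st)) (mkc xpredT) o.

Variable s : seq {set V}.
Hypothesis sG : all (fun e => e \in G) s.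
Variable lam : conf ds -> R.
Hypothesis lam_ge0 : forall y, 0 <= lam y.
Hypothesis hit_lam : forall st, dart G st -> injective (rvo st) -> forall y,
  hit p q (region_of d G h.+1 st) s (mkc xpredT) y <= lam y.

Definition matches L o := all (fun c => Y c.1 o == c.2) L.

Fixpoint disjoint_regions L : Prop :=
  if L is c :: L' then (forall c', c' \in L' -> forall z z', redge c.1 z <> redge c'.1 z') /\
     disjoint_regions L' else True.

Definition region_ok U st :=
  [/\ dart G st, injective (rvo st) & forall z, redge st z \subset U].

(** Regions without common edges read disjoint update variables, so [Eu_indep] splits off one factor
    at a time. *)
Lemma match_prob U L : (forall c, c \in L -> region_ok U c.1) -> disjoint_regions L ->
  Eu p q s (fun o => (matches L o)%:R) <= \prod_(c <- L) lam c.2.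
Proof.
elim: L => [|c L IH] ok /=; first by rewrite big_nil Eu_cst.
case=> disj dL; rewrite big_cons.
have [dc ic _] := ok c (mem_head _ _).
pose a e := region_of d G h.+1 c.1 e != None.
have -> : Eu p q s (fun o => ((Y c.1 o == c.2) && matches L o)%:R) =
    Eu p q s (fun o => (Y c.1 o == c.2)%:R * (matches L o)%:R).
  by apply: eq_Eu => // o _; rewrite -mulnb natrM.
rewrite (Eu_indep hq hp s (a := a)) //.
- apply: ler_pM; [exact: Eu_ge0|exact: Eu_ge0|exact: hit_lam|].
  by apply: IH => // c' cL; apply: ok; rewrite inE cL orbT.
- by move=> o; rewrite /Y (foldl_updm_filter (a := a)).
- move=> o; congr (_%:R); apply: congr1; apply: eq_in_all => c' cL.
  rewrite /Y (foldl_updm_filter (a := predC a)) // => e.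
  case re: (region_of d G h.+1 c'.1 e) => [z'|] // _; apply/negP => ae.
  move: ae; rewrite /a; case re': (region_of d G h.+1 c.1 e) => [z|] // _.
  by apply: (disj c' cL z z'); rewrite -(region_some re) -(region_some re').
Qed.

Variables (theta rho : R) (J N k Kb : nat).
Hypothesis theta1 : 1 <= theta.
Hypothesis rho01 : 0 < rho <= 1.
Hypothesis branch : \sum_y lam y * theta ^+ nleaf y <= rho * theta.
Hypothesis bad_cost : theta ^+ (K0 * K0) <= rho * theta ^+ Kb.
Hypothesis sparse : forall w, (size w <= N.*2)%N -> trav v w \subset G ->
  (#|inner G (visited v w) :\: trav v w| <= J)%N.
Hypothesis Nk : (N < k)%N.

Definition large_cluster L Z Ep o :=
  [&& matches L o, X o :&: explored G Ep \subset Z & (k <= #|open_cluster (X o) v|)%N].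

Lemma X_sub o : [seq x.1 | x <- o] = s -> X o \subset G.
Proof.
move=> eo; have : all (fun e => e \in G) [seq x.1 | x <- o] by rewrite eo.
suff main (W : {set {set V}}) : W \subset G -> all (fun e => e \in G) [seq x.1 | x <- o] ->
    foldl (@fk_upd V) W o \subset G by exact: main.
elim: o W {eo} => [|x o IH] W WG //= /andP[xG oG].
by apply: IH => //; exact: fk_upd_sub.
Qed.

Lemma card_cover_excess U T : (#|cover (excess G U T)| <= (#|excess G U T|).*2)%N.
Proof.
rewrite /cover; apply: leq_trans (card_bigcup_le _ _) _.
apply: (@leq_trans (\sum_(e in excess G U T) 2)); last by rewrite sum_nat_const muln2.
apply: leq_sum => e; rewrite !inE => /andP[_ /andP[eG _]].
by rewrite (G_card2 regG eG).
Qed.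

Lemma badness_le U Ep T : tree_on G v U T -> (#|U| <= N)%N -> (badness G U Ep T <= 3 * J)%N.
Proof.
move=> [[w [vis tr sz]] TU cT] UN.
have exJ : (#|excess G U T| <= J)%N.
  rewrite /excess -vis -tr; apply: sparse; last first.
    by rewrite tr; apply: subset_trans TU _; apply/fintype.subsetP => e; rewrite inE => /andP[].
  by rewrite sz leq_double; apply: leq_trans UN; rewrite -cT.
rewrite /badness; have cov := card_cover_excess U T.
have sub : (#|Ep :&: cover (excess G U T)| <= #|cover (excess G U T)|)%N by rewrite subset_leq_card ?subsetIr.
exact: add_double_le exJ cov sub.
Qed.

(* Induction on the number [m] of regions still to be revealed: a fresh region
   costs the factor [rho] by [branch], and another one at most
   [theta ^+ (K0 * K0)], which the drop of [Kb * (3 * J - badness)] pays for. *)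
Lemma exploration_bound m U Ep T Z L :
  explore_inv d h G v U Ep T Z ->
  (forall c, c \in L -> region_ok U c.1) -> disjoint_regions L ->
  (#|U| + m * K0 <= N)%N ->
  Eu p q s (fun o => (large_cluster L Z Ep o)%:R) <=
  (\prod_(c <- L) lam c.2) * theta ^+ #|open_cluster Z v :\: Ep| * rho ^+ m *
    theta ^+ (Kb * (3 * J - badness G U Ep T)).
Proof.
have /andP[r0 r1] := rho01.
have t0 : 0 < theta := lt_le_trans ltr01 theta1.
have alg1 (a b c e f g : R) : b * a * (c * f) * e * g = a * c * e * g * (b * f) by ring.
have alg2 (a c e g y z : R) : a * c * e * g * (y * z) = a * (z * c) * (y * e) * g by ring.
have alg3 (y z e g : R) : y * z * (e * g) = y * e * (z * g) by ring.
have PL0 L' : 0 <= \prod_(c <- L') lam c.2.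
  elim: L' => [|c L' IH']; first by rewrite big_nil ler01.
  by rewrite big_cons mulr_ge0.
elim: m U Ep T Z L => [|m IH] U Ep T Z L I Lok Ld UN.
  apply: le_trans (_ : Eu p q s (fun o => (matches L o)%:R) <= _).
    apply: Eu_le => // o _; rewrite ler_nat /large_cluster.
    by case: (matches L o) => //=; exact: leq_b1.
  apply: le_trans (match_prob Lok Ld) _; rewrite expr0 mulr1 -mulrA.
  by rewrite ler_peMr // -exprD exprn_ege1.
(* If the cluster is entirely revealed, it lies in [U], which has at most [N < k] vertices, so the
   event is empty. *)
case: (boolP (open_cluster Z v \subset Ep)) => [DE|/subsetPn[w wD wE]].
  apply: le_trans (_ : 0 <= _); last by rewrite !mulr_ge0 // exprn_ge0 // ltW.
  rewrite -(Eu_cst p q s 0); apply: Eu_le => // o eo.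
  rewrite lern0 eqb0; apply/negP => /and3P[_ XZ]; rewrite leqNgt => /negP; apply.
  apply: leq_ltn_trans Nk; apply: leq_trans (leq_trans (leq_addr _ _) UN).
  apply: subset_leq_card; apply: subset_trans (cluster_in regG I (inv_rootU I)).
  apply: open_cluster_min; last exact: open_cluster_refl.
  move=> a b aD ab; apply: (open_cluster_step aD); apply: (fintype.subsetP XZ).
  rewrite in_setI ab; apply/(exploredP regG); exists a; first exact: (fintype.subsetP DE _ aD).
  by exists b => //; rewrite inE; exact: (fintype.subsetP (X_sub eo) _ ab).
have [x xE dst] := frontier_dart regG I wD wE.
pose st := (x, w); pose U' := U :|: ballv G ds st; pose Ep' := Ep :|: innerv G ds st.
have wU : w \in U by apply: (fintype.subsetP (cluster_in regG I (inv_rootU I))).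
have xU : x \in U by exact: (fintype.subsetP (inv_sub I)).
have [T' [tT' TT' newT deg']] : exists T', [/\ tree_on G v U' T', T \subset T',
    forall e, e \in T' -> e \subset U -> e \in T &
    forall x, x \in U' -> x \notin Ep' -> forall e e', e \in T' -> e' \in T' -> x \in e -> x \in e' -> e = e'].
  apply: (tree_on_extend regG dst (inv_tree I)) => //; first exact: subsetUr.
  by move=> y yU yE; apply: (inv_deg I) => //; apply: contra yE => yE; rewrite in_setU yE.
have cU' : (#|U'| + m * K0 <= N)%N.
  apply: leq_trans UN; rewrite mulSn addnA leq_add2r.
  apply: leq_trans (leq_card_setU _ _) _; rewrite leq_add2l /region_size.
  by apply: leq_trans (card_ballv G ds st) _.
have UU' : U \subset U' by exact: subsetUl.
have exx : excess G U T \subset excess G U' T'.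
  apply/fintype.subsetP => e; rewrite /excess /inner !inE => /andP[eT /andP[eG eU]].
  rewrite eG (subset_trans eU UU') !andbT; apply: contra eT => eT'; exact: newT.
have cc : cover (excess G U T) \subset cover (excess G U' T').
  apply/fintype.subsetP => y /bigcupP[e ee ye]; apply/bigcupP; exists e => //.
  exact: (fintype.subsetP exx).
have wi : w \in innerv G ds st by apply/innervP; left.
have bmono : (badness G U Ep T <= badness G U' Ep' T')%N.
  by rewrite /badness leq_add ?subset_leq_card ?setISS // subsetUl.
have b'J : (badness G U' Ep' T' <= 3 * J)%N.
  by apply: badness_le => //; apply: leq_trans cU'; exact: leq_addr.
have Lok' c : c \in L -> region_ok U' c.1.
  by move=> /Lok [h1 h2 h3]; split=> // z; apply: subset_trans (h3 z) UU'.
have rm m' : 0 <= rho ^+ m' by rewrite exprn_ge0 // ltW.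
have tm m' : 0 <= theta ^+ m' by rewrite exprn_ge0 // ltW.
(* With [w] on no excess edge, all its edges into [U] are tree edges, hence only the one to [x];
   with no new excess edge, [fresh_region] applies. *)
case: (boolP ((#|excess G U' T'| == #|excess G U T|) && (w \notin cover (excess G U T)))) => [/andP[/eqP exE wc]|bad].
  have un b : b \in Nb w -> b \in U -> b = x.
    move=> bN bU.
    have inT y : y \in Nb w -> y \in U -> [set w; y] \in T.
      move=> yN yU; apply: contraT => nT; case/negP: wc; apply/bigcupP; exists [set w; y].
        rewrite /excess /inner !inE nT /= subUset !sub1set wU yU.
        by move: yN; rewrite inE => ->.
      by rewrite !inE eqxx.
    have e : [set w; b] = [set w; x].
      by apply: (inv_deg I wU wE (inT b bN bU) (inT x dst xU)); rewrite !inE eqxx.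
    move/eqP: e; rewrite set2_eqP eqxx /= => /orP[/eqP//|/andP[/eqP -> /eqP ->]] //.
  have cI W TW : tree_on G v W TW -> #|inner G W| = (#|excess G W TW| + #|TW|)%N.
    move=> [_ TWi _]; rewrite /excess -(cardsID TW) addnC; congr (_ + _)%N.
    by apply: eq_card => e; rewrite in_setI andbC; case: (boolP (e \in TW)) => // /(fintype.subsetP TWi) ->.
  have exc : (#|inner G U'| + #|U| <= #|inner G U| + #|U'|)%N.
    rewrite (cI _ _ tT') (cI _ _ (inv_tree I)) exE; case: tT' => _ _ <-; case: (inv_tree I) => _ _ <-.
    by rewrite !addnS ltnS -!addnA leq_add2l addnC.
  have [fresh inj _] := fresh_region regG dst wU un exc.
  have vi := vo_inj regG I wD fresh inj.
  have fr z : ~~ (redge st z \subset U).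
    by rewrite /edge subUset sub1set (negPf (fresh z)).
  (* The event is split by the final state [y] of the new region chain, which by [dominate] contains
     the open edges of the region. *)
  have step : Eu p q s (fun o => (large_cluster L Z Ep o)%:R) <=
      \sum_y Eu p q s (fun o => (large_cluster ((st, y) :: L) (open_good G Z x w y) Ep' o)%:R).
    rewrite -Eu_sum; apply: Eu_le => // o eo.
    rewrite (bigD1 (Y st o)) //= -[leLHS]addr0; apply: lerD; last exact: sumr_ge0.
    rewrite ler_nat; case: (boolP (large_cluster L Z Ep o)) => // /and3P[mL XZ kC].
    rewrite lt0b /large_cluster kC andbT.
    have -> : matches ((st, Y st o) :: L) o by rewrite /matches /= eqxx; exact: mL.
    rewrite andTb.
    apply/fintype.subsetP => e; rewrite in_setI => /andP[eX eE'].
    case: (boolP (e \in explored G Ep)) => eE.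
      by rewrite in_setU (fintype.subsetP XZ) // in_setI eX.
    have [z ez] := newly_explored regG I wD xE dst eE' eE.
    rewrite in_setU; apply/orP; right; apply/imsetP; exists z => //; rewrite inE.
    apply: (dominate regG dst vi (X := G)) => //.
    - by rewrite eo.
    - by move=> z' _; rewrite getc_mkc.
    - by rewrite -ez.
  apply: le_trans step _.
  have bound y : Eu p q s (fun o => (large_cluster ((st, y) :: L) (open_good G Z x w y) Ep' o)%:R) <=
     (\prod_(c <- L) lam c.2) * theta ^+ (#|open_cluster Z v :\: Ep|).-1 * rho ^+ m *
      theta ^+ (Kb * (3 * J - badness G U Ep T)) * (lam y * theta ^+ nleaf y).
    have [I' cD] := inv_good regG I wD wE xE dst fresh inj y tT' deg'.
    apply: le_trans (IH U' Ep' T' (open_good G Z x w y) ((st, y) :: L) I' _ _ cU') _.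
    - move=> c; rewrite inE => /orP[/eqP-> /=|/Lok'//]; split=> // z.
      by rewrite /edge subUset !sub1set; apply/andP; split; [exact: (vo_U' regG x I wD (Some z))|exact: (vo_U' regG x I wD)].
    - split=> // c' cL z z' e; have [_ _ /(_ z')] := Lok c' cL.
      by rewrite -e /= (negPf (fr z)).
    rewrite big_cons /=.
    have pos0 : (0 < #|open_cluster Z v :\: Ep|)%N.
      by apply/card_gt0P; exists w; rewrite in_setD wE.
    apply: (@le_trans _ _ (lam y * \prod_(c <- L) lam c.2 * theta ^+ ((#|open_cluster Z v :\: Ep|).-1 + nleaf y) * rho ^+ m *
        theta ^+ (Kb * (3 * J - badness G U Ep T)))); last by rewrite exprD alg1.
    apply: ler_pM; rewrite ?mulr_ge0 //.
      apply: ler_wpM2r => //; apply: ler_wpM2l; first by rewrite mulr_ge0.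
      apply: ler_weXn2l => //; rewrite -ltnS; apply: leq_trans cD _.
      by rewrite -addSn prednK.
    by apply: ler_weXn2l => //; rewrite leq_mul2l leq_sub2l ?orbT.
  apply: le_trans (ler_sum _ (fun y _ => bound y)) _; rewrite -mulr_sumr.
  have pos0 : (0 < #|open_cluster Z v :\: Ep|)%N.
    by apply/card_gt0P; exists w; rewrite in_setD wE.
  rewrite -{2}(prednK pos0) (exprS theta) (exprS rho).
  apply: (@le_trans _ _ ((\prod_(c <- L) lam c.2) * theta ^+ (#|open_cluster Z v :\: Ep|).-1 * rho ^+ m *
      theta ^+ (Kb * (3 * J - badness G U Ep T)) * (rho * theta))).
    by apply: ler_wpM2l => //; rewrite !mulr_ge0.
  by rewrite alg2.
have [I' cD] := inv_bad regG I wD xE dst tT' deg'.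
have step : Eu p q s (fun o => (large_cluster L Z Ep o)%:R) <=
    Eu p q s (fun o => (large_cluster L (open_bad d h G Z x w) Ep' o)%:R).
  apply: Eu_le => // o eo; rewrite ler_nat.
  case: (boolP (large_cluster L Z Ep o)) => // /and3P[mL XZ kC].
  rewrite lt0b /large_cluster mL kC andbT /=.
  apply/fintype.subsetP => e; rewrite in_setI => /andP[eX eE'].
  case: (boolP (e \in explored G Ep)) => eE.
    by rewrite in_setU (fintype.subsetP XZ) // in_setI eX.
  have [z ez] := newly_explored regG I wD xE dst eE' eE.
  by rewrite in_setU; apply/orP; right; apply/imsetP; exists z.
apply: le_trans step _; apply: le_trans (IH U' Ep' T' _ L I' Lok' Ld cU') _.
(* Either an excess edge has appeared, or [w], revealed just now, lies on an old one. *)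
have blt : (badness G U Ep T < badness G U' Ep' T')%N.
  have wE' : w \in Ep' by rewrite in_setU wi orbT.
  rewrite negb_and negbK in bad; case/orP: bad => [ne|wc].
    have lt : (#|excess G U T| < #|excess G U' T'|)%N.
      by rewrite ltn_neqAle eq_sym ne subset_leq_card.
    rewrite /badness -addSn leq_add // subset_leq_card // setISS //; exact: subsetUl.
  have lt : (#|Ep :&: cover (excess G U T)| < #|Ep' :&: cover (excess G U' T')|)%N.
    apply: proper_card; apply/properP; split; first by rewrite setISS // subsetUl.
    exists w; first by rewrite in_setI wE' (fintype.subsetP cc).
    by rewrite in_setI (negPf wE).
  by rewrite /badness -addnS leq_add // subset_leq_card.
rewrite -!mulrA ler_wpM2l //.
apply: (@le_trans _ _ (theta ^+ (#|open_cluster Z v :\: Ep| + K0 * K0) * (rho ^+ m *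
    theta ^+ (Kb * (3 * J - badness G U' Ep' T'))))).
  by apply: ler_wpM2r; [rewrite mulr_ge0|exact: ler_weXn2l].
rewrite exprD -mulrA ler_wpM2l //.
apply: (@le_trans _ _ (rho * theta ^+ Kb * (rho ^+ m * theta ^+ (Kb * (3 * J - badness G U' Ep' T'))))).
  by apply: ler_wpM2r; [rewrite mulr_ge0|].
have -> : rho * theta ^+ Kb * (rho ^+ m * theta ^+ (Kb * (3 * J - badness G U' Ep' T'))) =
   rho ^+ m.+1 * theta ^+ (Kb * (3 * J - badness G U' Ep' T').+1).
  by rewrite mulnS exprD exprS; exact: alg3.
apply: ler_wpM2l => //; apply: ler_weXn2l => //; rewrite leq_mul2l; apply/orP; right.
exact: leq_sub_lt.
Qed.

End ExplorationBound.

(** * Local sparsity of random regular graphs *)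

Lemma card_dep_pair (I J : finType) (P : I -> J -> bool) :
  #|[set t : I * J | P t.1 t.2]| = (\sum_i #|[set j | P i j]|)%N.
Proof.
rewrite -sum1dep_card -(pair_big_dep xpredT P (fun _ _ => 1%N)) /=.
by apply: eq_bigr => i _; rewrite sum1dep_card.
Qed.

Lemma switch_count (T : eqType) (a b x y u : T) m :
  a != b -> x != a -> x != b -> y != a -> y != b -> x != y ->
  (((u == a) || (u == x)) + (((u == b) || (u == y)) + m) =
   ((u == a) || (u == b)) + (((u == x) || (u == y)) + m))%N.
Proof.
move=> ab xa xb ya yb xy.
case: (eqVneq u a) => [->|_].
  by rewrite (eq_sym a y) (eq_sym a x) (negPf ya) (negPf xa) (negPf ab).
case: (eqVneq u b) => [->|_].
  by rewrite (eq_sym b y) (eq_sym b x) (negPf yb) (negPf xb) /= addnCA.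
by case: (eqVneq u x) => [->|_] /=; rewrite ?(negPf xy).
Qed.

Lemma switch_size_bound s D Q n k : (n <= k + (2 * s + 4 * D + 2 * Q))%N ->
  (2 * (2 * s + 4 * D + 2 * Q) <= n)%N -> (n <= 2 * k)%N.
Proof. lia. Qed.

Lemma switch_size_sum s D : (2 * D + (2 * D + (D * D + (D * D + 2 * s))) <= 2 * s + 4 * D + 2 * (D * D))%N.
Proof. lia. Qed.

Lemma leq_cancel_square x y n D : (0 < D)%N -> (x * (n * D) <= 2 * (D * D) * y)%N ->
  (x * n <= 2 * D * y)%N.
Proof.
move=> D0 h; rewrite -(leq_pmul2r D0) -mulnA; apply: leq_trans h _.
by rewrite -!mulnA (mulnC y).
Qed.

Section Switching.
Variables (V : finType) (d : nat).
Notation Delta := d.+1.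
Implicit Types (E S : {set {set V}}) (a b x y : V).

Definition darts E : {set V * V} := [set t | t.2 \in Nb E t.1].

Lemma card_darts_from E (A : {set V}) : regular Delta E ->
  #|[set t in darts E | t.1 \in A]| = (#|A| * Delta)%N.
Proof.
move=> rE; have -> : [set t in darts E | t.1 \in A] =
    [set t : V * V | (t.1 \in A) && (t.2 \in Nb E t.1)].
  by apply/setP => t; rewrite !inE andbC.
rewrite (card_dep_pair (fun x y => (x \in A) && (y \in Nb E x))).
rewrite -sum_nat_const [RHS]big_mkcond; apply: eq_bigr => x _.
case: (x \in A) => /=; last by apply/eqP; rewrite cards_eq0; apply/eqP/setP => y; rewrite !inE.
by rewrite -(card_Nb rE x); apply: eq_card => y; rewrite inE.
Qed.

Lemma card_darts_to E (A : {set V}) : regular Delta E ->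
  #|[set t in darts E | t.2 \in A]| = (#|A| * Delta)%N.
Proof.
move=> rE; rewrite -(card_darts_from A rE).
have sK : involutive (fun t : V * V => (t.2, t.1)) by case.
rewrite -(card_imset [set t in darts E | t.1 \in A] (inv_inj sK)).
apply: eq_card => -[x y]; rewrite !inE /=; apply/andP/imsetP => [[xy yA]|[[x' y']]].
  by exists (y, x); rewrite // !inE /= finset.setUC xy.
by rewrite !inE /= => /andP[xy xA] [-> ->]; rewrite finset.setUC xy.
Qed.

Lemma card_darts E : regular Delta E -> #|darts E| = (#|V| * Delta)%N.
Proof.
move=> rE; rewrite -cardsT -(card_darts_from _ rE).
by apply: eq_card => t; rewrite !inE andbT.
Qed.

Lemma card_darts_on E S : regular Delta E ->
  (#|[set t in darts E | [set t.1; t.2] \in S]| <= 2 * #|S|)%N.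
Proof.
move=> rE; pose f (t : V * V) := ([set t.1; t.2], t.1).
have inj : {in [set t in darts E | [set t.1; t.2] \in S] &, injective f}.
  move=> [x y] [x' y'] _ _ [/eqP e ex]; rewrite -ex in e *.
  by move: e; rewrite set2_eqP eqxx /= => /orP[/eqP->//|/andP[/eqP-> /eqP->]].
rewrite -(card_in_imset inj).
apply: (@leq_trans #|[set t : {set V} * V | (t.1 \in S :&: E) && (t.2 \in t.1)]|).
  apply: subset_leq_card; apply/fintype.subsetP => _ /imsetP[[x y] + ->].
  by rewrite !inE /= => /andP[-> ->]; rewrite eqxx.
rewrite (card_dep_pair (fun (e : {set V}) x => (e \in S :&: E) && (x \in e))).
apply: (@leq_trans (\sum_(e in S) 2)); last by rewrite sum_nat_const mulnC.
rewrite [leqRHS]big_mkcond; apply: leq_sum => e _; rewrite inE.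
case: (boolP (e \in S)) => //= eS; last by rewrite leqn0 cards_eq0; apply/eqP/setP => y; rewrite !inE.
case: (boolP (e \in E)) => //= eE; last by rewrite (_ : [set _ | _] = set0) ?cards0 //; apply/setP => y; rewrite !inE.
by rewrite (_ : [set j | j \in e] = e) ?(G_card2 rE eE) //; apply/setP => y; rewrite inE.
Qed.

Lemma degreeE E u : degree E u = (\sum_(e in E) (u \in e))%N.
Proof.
rewrite /degree -sum1_card big_mkcond [RHS]big_mkcond; apply: eq_bigr => e _.
by rewrite inE; case: (e \in E).
Qed.

Section Pair.
Variables a b : V.
Hypothesis ab : a != b.
Notation e0 := [set a; b].

Definition switchable E S : {set V * V} :=
  [set t in darts E | [&& t.1 \notin e0, t.2 \notin e0, t.1 \notin Nb E a, t.2 \notin Nb E b &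
    [set t.1; t.2] \notin S]].

(* Replaces the edges ab and xy by ax and by; a dart (x, y) can be recovered
   from the image, among at most Delta^2 candidates. *)
Definition switch E (t : V * V) : {set {set V}} :=
  [set a; t.1] |: ([set b; t.2] |: (E :\ e0 :\ [set t.1; t.2])).

Lemma card_switchable E S : regular Delta E ->
  (#|V| * Delta <= #|switchable E S| + (2 * #|S| + 4 * Delta + 2 * Delta ^ 2))%N.
Proof.
move=> rE; rewrite -(card_darts rE).
pose B1 := [set t in darts E | t.1 \in e0]; pose B2 := [set t in darts E | t.2 \in e0].
pose B3 := [set t in darts E | t.1 \in Nb E a]; pose B4 := [set t in darts E | t.2 \in Nb E b].
pose B5 := [set t in darts E | [set t.1; t.2] \in S].
have sub : darts E \subset switchable E S :|: (B1 :|: (B2 :|: (B3 :|: (B4 :|: B5)))).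
  apply/fintype.subsetP => t tE.
  have mB (P : pred (V * V)) : (t \in [set t in darts E | P t]) = P t by rewrite inE tE.
  rewrite !in_setU !mB.
  by case: (t.1 \in e0) (t.2 \in e0) (t.1 \in Nb E a) (t.2 \in Nb E b) ([set t.1; t.2] \in S) => [] [] [] [] [].
apply: leq_trans (subset_leq_card sub) _.
have c2 : #|e0| = 2%N by rewrite cards2 ab.
have h1 : #|B1| = (2 * Delta)%N by rewrite card_darts_from // c2.
have h2 : #|B2| = (2 * Delta)%N by rewrite card_darts_to // c2.
have h3 : #|B3| = (Delta * Delta)%N by rewrite card_darts_from // (card_Nb rE).
have h4 : #|B4| = (Delta * Delta)%N by rewrite card_darts_to // (card_Nb rE).
have h5 := card_darts_on S rE.
apply: leq_trans (leq_card_setU _ _) _; rewrite leq_add2l.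
apply: leq_trans (leq_card_setU _ _) _; rewrite h1.
apply: leq_trans (leq_add (leqnn _) (leq_trans (leq_card_setU _ _) (leq_add (leqnn _) (leq_trans (leq_card_setU _ _)
  (leq_add (leqnn _) (leq_card_setU _ _)))))) _.
rewrite h2 h3 h4; apply: leq_trans (leq_add (leqnn _) (leq_add (leqnn _) (leq_add (leqnn _) (leq_add (leqnn _) h5)))) _.
rewrite -mulnn; exact: switch_size_sum.
Qed.

Lemma switch_regular E S t : regular Delta E -> e0 \in E -> t \in switchable E S ->
  [/\ regular Delta (switch E t), t.1 \in Nb (switch E t) a, t.2 \in Nb (switch E t) b &
   E = e0 |: ([set t.1; t.2] |: (switch E t :\ [set a; t.1] :\ [set b; t.2]))].
Proof.
case: t => x y rE eE; rewrite !inE /= => /and5P[xy]; rewrite !negb_or => /andP[xa xb] /andP[ya yb] nax.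
case/andP=> nby nS.
have xny : x != y by apply: contraTneq xy => ->; have := Nb_irr rE y; rewrite inE.
pose F := E :\ e0 :\ [set x; y].
have n1 : [set x; y] \notin F by rewrite !inE eqxx.
have n2 : e0 \notin [set x; y] |: F.
  by rewrite !inE eqxx /= andbF orbF set2_eqP (eq_sym a x) (negPf xa) (eq_sym a y) (negPf ya).
have EE : E = e0 |: ([set x; y] |: F).
  apply/setP => e; rewrite !inE; case: (eqVneq e e0) => [->//|_] /=.
  by case: (eqVneq e [set x; y]) => [->|].
have n3 : [set b; y] \notin F by rewrite !inE (negPf nby) !andbF.
have n4 : [set a; x] \notin [set b; y] |: F.
  rewrite !inE (negPf nax) !andbF orbF set2_eqP (negPf ab) /=.
  by rewrite (eq_sym a y) (negPf ya).
have degE u : degree (switch E (x, y)) u = degree E u.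
  rewrite [in RHS]EE !degreeE /switch /= -/F !big_setU1 //= !inE.
  exact: switch_count.
split.
- apply/andP; split; last by apply/forallP => u; rewrite degE; case/andP: rE => _ /forallP.
  apply/forallP => e; apply/implyP; rewrite /switch /= !in_setU1 => /orP[/eqP->|/orP[/eqP->|]].
  + by rewrite cards2 (eq_sym a) xa.
  + by rewrite cards2 (eq_sym b) yb.
  + by rewrite !inE => /andP[_ /andP[_ eE']]; rewrite (G_card2 rE eE').
- by rewrite eqxx.
- by rewrite eqxx orbT.
- rewrite {1}EE /switch /= -/F; congr (_ |: (_ |: _)).
  apply/setP => e; rewrite !inE.
  case: (eqVneq e [set b; y]) => [->|_] /=; first by rewrite (negPf nby) !andbF.
  by case: (eqVneq e [set a; x]) => [->|_] //=; rewrite (negPf nax) !andbF.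
Qed.

Definition reg_above S : {set {set {set V}}} := [set E | regular Delta E & S \subset E].

(** Double counting of pairs of a graph containing [ab] and a switchable dart. At least half of the
    darts are switchable; the switching, with the dart kept, is injective, and in the image the dart
    runs from a neighbour of [a] to one of [b]. *)
Lemma switching_pair S : e0 \notin S ->
  (2 * (2 * #|S| + 4 * Delta + 2 * Delta ^ 2) <= #|V| * Delta)%N ->
  (#|reg_above (e0 |: S)| * (#|V| * Delta) <= 2 * Delta ^ 2 * #|reg_above S|)%N.
Proof.
move=> eS big.
pose A := [set t : {set {set V}} * (V * V) | (t.1 \in reg_above (e0 |: S)) && (t.2 \in switchable t.1 S)].
pose B := [set t : {set {set V}} * (V * V) | (t.1 \in reg_above S) && (t.2 \in finset.setX (Nb t.1 a) (Nb t.1 b))].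
pose f (t : {set {set V}} * (V * V)) := (switch t.1 t.2, t.2).
have AP E t : (E, t) \in A -> [/\ regular Delta E, e0 \in E, S \subset E & t \in switchable E S].
  rewrite inE /= => /andP[]; rewrite inE => /andP[rE]; rewrite subUset sub1set => /andP[eE SE] tE.
  by split.
have injf : {in A &, injective f}.
  move=> [E t] [E' t'] /AP[rE eE _ tE] /AP[rE' eE' _ tE'] [es et]; rewrite -et in es tE' *.
  congr (_, _); have [_ _ _ ->] := switch_regular rE eE tE.
  by have [_ _ _ ->] := switch_regular rE' eE' tE'; rewrite es.
have AB : f @: A \subset B.
  apply/fintype.subsetP => _ /imsetP[[E t] tA ->]; have [rE eE SE tE] := AP _ _ tA.
  have [rS xN yN EE] := switch_regular rE eE tE.
  have tX : t \in finset.setX (Nb (switch E t) a) (Nb (switch E t) b).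
    by move: xN yN; case: (t) => x y /= xN yN; rewrite in_setX xN yN.
  rewrite inE /= tX andbT inE rS /=.
  apply/fintype.subsetP => e eSS; rewrite /switch !inE.
  have -> : e != e0 by apply: contraTneq eSS => ->.
  have -> : e != [set t.1; t.2].
    by apply: contraTneq eSS => ->; move: tE; rewrite inE => /andP[_ /and5P[]].
  by rewrite (fintype.subsetP SE _ eSS) !orbT.
have cA : (#|reg_above (e0 |: S)| * (#|V| * Delta) <= 2 * #|A|)%N.
  rewrite (card_dep_pair (fun E t => (E \in reg_above (e0 |: S)) && (t \in switchable E S))).
  rewrite -sum_nat_const big_distrr [leqLHS]big_mkcond /=; apply: leq_sum => E _.
  case: (boolP (E \in _)) => //; rewrite inE => /andP[rE _] /=.
  rewrite (_ : [set j | j \in switchable E S] = switchable E S); last by apply/setP => t; rewrite inE.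
  exact: switch_size_bound (card_switchable S rE) big.
have cB : #|B| = (Delta ^ 2 * #|reg_above S|)%N.
  rewrite (card_dep_pair (fun E t => (E \in reg_above S) && (t \in finset.setX (Nb E a) (Nb E b)))).
  rewrite mulnC -sum_nat_const [RHS]big_mkcond; apply: eq_bigr => E _.
  case: (boolP (E \in reg_above S)) => [|_] /=; last by apply/eqP; rewrite cards_eq0; apply/eqP/setP => t; rewrite !inE.
  rewrite inE => /andP[rE _]; rewrite (_ : [set j | j \in _] = finset.setX (Nb E a) (Nb E b)); last by apply/setP => t; rewrite inE.
  by rewrite cardsX !(card_Nb rE) mulnn.
apply: leq_trans cA _; rewrite -mulnA -cB leq_mul2l /=.
by rewrite -(card_in_imset injf) subset_leq_card.
Qed.

End Pair.

Lemma switching S e : e \notin S ->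
  (2 * (2 * #|S| + 4 * Delta + 2 * Delta ^ 2) <= #|V| * Delta)%N ->
  (#|reg_above (e |: S)| * #|V| <= 2 * Delta * #|reg_above S|)%N.
Proof.
move=> eS big; case: (boolP (#|e| == 2)%N) => [/cards2P[a [b [ab ee]]]|ne].
  rewrite ee in eS *; have := switching_pair ab eS big.
  by rewrite -mulnn; exact: leq_cancel_square.
rewrite (_ : reg_above _ = set0) ?cards0 //; apply/setP => E; rewrite !inE.
apply/negP => /andP[rE]; rewrite subUset sub1set => /andP[eE _].
by rewrite (G_card2 rE eE) in ne.
Qed.

Lemma switching_set S (B : {set {set V}}) : [disjoint B & S] ->
  (2 * (2 * (#|S| + #|B|) + 4 * Delta + 2 * Delta ^ 2) <= #|V| * Delta)%N ->
  (#|reg_above (B :|: S)| * #|V| ^ #|B| <= (2 * Delta) ^ #|B| * #|reg_above S|)%N.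
Proof.
move: {2}#|B| (erefl #|B|) => m; elim: m B => [|m IH] B cB dis big.
  by move/eqP: (cB); rewrite cards_eq0 => /eqP ->; rewrite set0U cards0 !expn0 muln1 mul1n.
have [e eB] : exists e, e \in B by apply/card_gt0P; rewrite cB.
have cB' : #|B :\ e| = m by have := cardsD1 e B; rewrite eB cB add1n => -[].
have dis' : [disjoint B :\ e & S] by apply: disjointWl dis; exact: subsetDl.
have eS : e \notin S by move: dis; rewrite disjoint_subset => /fintype.subsetP/(_ e eB); rewrite inE.
have := IH (B :\ e) cB' dis'; rewrite cB' cB => /(_ _) IH'.
have {}IH' : (#|reg_above (B :\ e :|: S)| * #|V| ^ m <= (2 * Delta) ^ m * #|reg_above S|)%N.
  by apply: IH'; apply: leq_trans big; rewrite cB !leq_mul2l /= !leq_add2r !leq_mul2l /= leq_add2l.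
have nBS : e \notin B :\ e :|: S by rewrite in_setU in_setD1 eqxx.
have := switching nBS; have -> : e |: (B :\ e :|: S) = B :|: S by rewrite setUA setD1K.
have cu : (#|B :\ e :|: S| <= #|S| + m)%N by rewrite addnC -cB' leq_card_setU.
move=> /(_ _) sw; have {}sw : (#|reg_above (B :|: S)| * #|V| <= 2 * Delta * #|reg_above (B :\ e :|: S)|)%N.
  by apply: sw; apply: leq_trans big; rewrite cB !leq_mul2l /= !leq_add2r !leq_mul2l /= (leq_trans cu) // leq_add2l.
rewrite !expnS mulnA; apply: leq_trans (leq_mul sw (leqnn _)) _.
move: IH'; move: (_ ^ m)%N (_ ^ m)%N => u w IH'.
by rewrite -[leqLHS]mulnA -[leqRHS]mulnA leq_mul2l IH' orbT.
Qed.

End Switching.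

Lemma bin_le_exp m k : ('C(m, k) <= m ^ k)%N.
Proof.
apply: leq_trans (leq_pmulr _ (fact_gt0 k)) _; rewrite bin_ffact ffact_prod.
apply: (@leq_trans (\prod_(i < k) m)%N); last by rewrite prod_nat_const card_ord.
by apply: leq_prod => i _; exact: leq_subr.
Qed.

(** * Union bound over walks *)

Section WalkUnion.
Variables (V : finType) (d : nat).
Notation Delta := d.+1.
Implicit Types (E S : {set {set V}}) (v : V).

Lemma card_walks l v E : regular Delta E ->
  (#|[set w : l.-tuple V | trav v w \subset E]| <= Delta ^ l)%N.
Proof.
move=> rE; elim: l v => [|l IH] v.
  by apply: leq_trans (max_card _) _; rewrite card_tuple.
pose f (w : l.+1.-tuple V) := (thead w, [tuple of behead w] : l.-tuple V).
have injf : injective f.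
  by move=> w w' [e1 e2]; apply: val_inj; rewrite (tuple_eta w) (tuple_eta w') /= e1 e2.
rewrite -(card_imset _ injf).
apply: (@leq_trans #|[set t : V * l.-tuple V | (t.1 \in Nb E v) && (trav t.1 t.2 \subset E)]|).
  apply: subset_leq_card; apply/fintype.subsetP => _ /imsetP[w + ->].
  rewrite !inE {1}(tuple_eta w) /= subUset sub1set => /andP[-> h]; exact: h.
rewrite (card_dep_pair (fun x (w : l.-tuple V) => (x \in Nb E v) && (trav x w \subset E))).
rewrite expnS -[X in (X * _)%N](card_Nb rE v) -sum_nat_const [leqRHS]big_mkcond; apply: leq_sum => x _.
case: (x \in Nb E v).
  by apply: leq_trans (IH x); apply: subset_leq_card; apply/fintype.subsetP => w; rewrite !inE.
by rewrite leqn0 cards_eq0; apply/eqP/setP => w; rewrite !inE.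
Qed.

Lemma card_trav v (w : seq V) : (#|trav v w| <= size w)%N.
Proof.
elim: w v => [|a w IH] v /=; first by rewrite cards0.
apply: leq_trans (leq_card_setU _ _) _; rewrite cards1 add1n ltnS; exact: IH.
Qed.

Definition vpairs (U : {set V}) : {set {set V}} := [set [set x; y] | x in U, y in U].

Lemma card_vpairs U : (#|vpairs U| <= #|U| ^ 2)%N.
Proof.
rewrite /vpairs curry_imset2X -mulnn -cardsX; exact: leq_imset_card.
Qed.

Lemma card_visited v (w : seq V) : (#|visited v w| <= (size w).+1)%N.
Proof. by rewrite /visited cardsE; apply: leq_trans (card_size _) _. Qed.

Definition dense_near v L J E : bool :=
  [exists l : 'I_L.+1, [exists w : l.-tuple V,
     (trav v w \subset E) && (J < #|inner E (visited v w) :\: trav v w|)%N]].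

(** For each walk and each set [B] of [J.+1] further pairs among its vertices, [switching_set]
    compares the graphs containing both with those containing the walk alone, so only [B] is charged
    powers of 1/n. *)
Lemma card_dense_near v L J :
  (2 * (2 * (L + J.+1) + 4 * Delta + 2 * Delta ^ 2) <= #|V| * Delta)%N ->
  (#|[set E | regular Delta E & dense_near v L J E]| * #|V| ^ J.+1 <=
   L.+1 * ((L.+1 ^ 2) ^ J.+1 * ((2 * Delta) ^ J.+1 * (Delta ^ L * #|[set E : {set {set V}} | regular Delta E]|))))%N.
Proof.
move=> big.
pose draws l (w : l.-tuple V) := [set B : {set {set V}} | B \subset vpairs (visited v w) & #|B| == J.+1].
pose A l (w : l.-tuple V) (B : {set {set V}}) := if [disjoint B & trav v w] then reg_above d (B :|: trav v w) else set0.
have sub : [set E | regular Delta E & dense_near v L J E] \subset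
    \bigcup_(l : 'I_L.+1) \bigcup_(w : l.-tuple V) \bigcup_(B in draws l w) A l w B.
  apply/fintype.subsetP => E; rewrite inE => /andP[rE /existsP[l /existsP[w /andP[tE lt]]]].
  apply/bigcupP; exists l => //; apply/bigcupP; exists w => //.
  have [B BS cB] : exists2 B : {set {set V}}, B \subset inner E (visited v w) :\: trav v w & #|B| = J.+1.
    have [B [uB cB BS]] := card_geqP lt; exists [set x in B].
      by apply/fintype.subsetP => e; rewrite inE; exact: BS.
    by rewrite cardsE (card_uniqP uB).
  have BE e : e \in B -> [/\ e \in E, e \subset visited v w & e \notin trav v w].
    by move=> /(fintype.subsetP BS); rewrite !inE => /andP[-> /andP[-> ->]].
  apply/bigcupP; exists B.
    rewrite inE cB eqxx andbT; apply/fintype.subsetP => e /BE[eE eU _].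
    have [x [y [ee _ _]]] := G_edgeP rE eE.
    by move: eU; rewrite ee subUset !sub1set => /andP[xU yU]; apply/imset2P; exists x y.
  rewrite /A (_ : [disjoint B & trav v w]); last first.
    by rewrite disjoint_subset; apply/fintype.subsetP => e /BE[_ _]; rewrite inE.
  rewrite inE rE subUset tE andbT; by apply/fintype.subsetP => e /BE[].
apply: leq_trans (leq_mul (subset_leq_card sub) (leqnn _)) _.
apply: leq_trans (leq_mul (card_bigcup_le _ _) (leqnn _)) _.
rewrite big_distrl; set M := (_ ^ J.+1 * _)%N.
apply: (@leq_trans (\sum_(l < L.+1) M)%N); last by rewrite sum_nat_const card_ord.
rewrite {}/M; apply: leq_sum => l _.
have lL : (l <= L)%N by rewrite -ltnS.
apply: leq_trans (leq_mul (card_bigcup_le _ _) (leqnn _)) _.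
rewrite big_distrl.
apply: (@leq_trans (\sum_(w : l.-tuple V) (L.+1 ^ 2) ^ J.+1 * ((2 * Delta) ^ J.+1 * #|reg_above d (trav v w)|))%N).
  apply: leq_sum => w _.
  apply: leq_trans (leq_mul (card_bigcup_le _ _) (leqnn _)) _.
  rewrite big_distrl.
  have tl : (#|trav v w| <= L)%N by apply: leq_trans (card_trav _ _) _; rewrite size_tuple.
  apply: (@leq_trans (\sum_(B in draws l w) (2 * Delta) ^ J.+1 * #|reg_above d (trav v w)|)%N).
    apply: leq_sum => B; rewrite inE => /andP[_ /eqP cB]; rewrite /A.
    case: ifP => [dis|_]; last by rewrite cards0.
    have := switching_set dis; rewrite cB; apply; apply: leq_trans big.
    by rewrite !leq_mul2l /= !leq_add2r !leq_mul2l /= leq_add2r.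
  rewrite sum_nat_const leq_mul2r; apply/orP; right.
  rewrite cards_draws; apply: leq_trans (bin_le_exp _ _) _; rewrite leq_exp2r //.
  apply: leq_trans (card_vpairs _) _; rewrite leq_exp2r //.
  by apply: leq_trans (card_visited _ _) _; rewrite size_tuple ltnS.
rewrite -big_distrr /= leq_mul2l; apply/orP; right.
rewrite -big_distrr /= leq_mul2l; apply/orP; right.
(* Exchanging the sums leaves the number of walks inside each graph, which does not grow with
   [#|V|]. *)
have -> : (\sum_(w : l.-tuple V) #|reg_above d (trav v w)| =
    \sum_(E in [set E : {set {set V}} | regular Delta E]) #|[set w : l.-tuple V | trav v w \subset E]|)%N.
  transitivity (\sum_(w : l.-tuple V) \sum_(E | regular Delta E) (trav v w \subset E : nat))%N.
    apply: eq_bigr => w _; rewrite -sum1_card.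
    rewrite (eq_bigl (fun E => regular Delta E && (trav v w \subset E))); last by move=> E; rewrite inE.
    by rewrite big_mkcondr; apply: eq_bigr => E _; case: (_ \subset _).
  rewrite exchange_big; apply: eq_big => [E|E _]; first by rewrite inE.
  by rewrite -sum1dep_card [RHS]big_mkcond; apply: eq_bigr => w _; case: (_ \subset _).
rewrite mulnC -sum_nat_const; apply: leq_sum => E; rewrite inE => rE.
by apply: leq_trans (card_walks l v rE) _; apply: leq_pexp2l.
Qed.

End WalkUnion.

(** * Existence of regular graphs *)

Section Circulant.
Variables (n : nat) (D : {set 'I_n.+1}).
Hypothesis D0 : 0 \notin D.
Hypothesis DN : forall x, x \in D -> - x \in D.

Definition circulant : {set {set 'I_n.+1}} := [set [set i; i + x] | i in setT, x in D].

Lemma circulant_regular : regular #|D| circulant.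
Proof.
have ne (i x : 'I_n.+1) : x \in D -> i != i + x.
  by move=> xD; apply: contraNneq D0 => /(congr1 (fun y => y - i)); rewrite subrr addrAC subrr add0r => ->.
apply/andP; split.
  apply/forallP => e; apply/implyP => /imset2P[i x _ xD ->].
  by rewrite cards2 ne.
apply/forallP => v; rewrite /degree; apply/eqP.
have inj : {in D &, injective (fun x => [set v; v + x])}.
  move=> x y xD yD /eqP; rewrite set2_eqP eqxx /= => /orP[/eqP/addrI//|/andP[/eqP e _]].
  by have := ne v y yD; rewrite -e eqxx.
rewrite -(card_in_imset inj); apply: eq_card => e; rewrite inE.
apply/andP/imsetP => [[/imset2P[i x _ xD ->]]|[x xD ->]].
  rewrite !inE => /orP[/eqP->|/eqP->]; first by exists x.
  by exists (- x); rewrite ?DN // addrK finset.setUC.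
by rewrite !inE eqxx; split=> //; apply/imset2P; exists v x.
Qed.

End Circulant.

(** Keeps the denominator of [rrg_prob] from being 0. The steps of the circulant graph are 1, ..., k
    and their opposites, together with n/2 when [Delta] is odd, n being even in that case. *)
Lemma regular_exists n Delta : (Delta < n)%N -> ~~ odd (Delta * n) ->
  exists E : {set {set 'I_n}}, regular Delta E.
Proof.
case: n => // n Dn ev.
pose k := Delta./2.
have kE : Delta = (odd Delta + k.*2)%N by rewrite odd_double_half.
have valN (x : 'I_n.+1) : x != 0 -> val (- x) = (n.+1 - x)%N.
  move=> x0; rewrite /= modn_small // ltn_subrL lt0n /=; apply/andP; split=> //.
have kn : (k.*2 < n.+1)%N by rewrite (leq_ltn_trans _ Dn) // [leqRHS]kE leq_addl.
have kn' : (k <= n)%N by rewrite -ltnS (leq_ltn_trans _ kn) // -addnn leq_addr.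
pose f (i : 'I_k) : 'I_n.+1 := inord i.+1.
have fE i : val (f i) = i.+1 by rewrite /= inordK // ltnS (leq_trans _ kn').
have f0 i : f i != 0 by rewrite -val_eqE fE.
pose low : {set 'I_n.+1} := [set f i | i : 'I_k].
pose high : {set 'I_n.+1} := [set - f i | i : 'I_k].
pose mid : {set 'I_n.+1} := if odd Delta then [set inord n.+1./2] else finset.set0.
have finj : injective f by move=> i j /(congr1 val); rewrite !fE => -[/val_inj].
have oddn : odd Delta -> n.+1 = (n.+1./2).*2.
  by move=> oD; move: ev; rewrite oddM oD /= => /negPf on; rewrite -{1}(odd_double_half n.+1) /= on.
have midP x : x \in mid -> odd Delta /\ (val x).*2 = n.+1.
  rewrite /mid; case: ifP => oD; rewrite inE // => /eqP ->; split=> //.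
  by rewrite /= inordK -?oddn // [ltnRHS](oddn oD) -addnn; have := oddn oD; lia.
have lowP x : x \in low -> x != 0 /\ (val x <= k)%N.
  by case/imsetP=> i _ ->; rewrite f0 fE.
have highP x : x \in high -> x != 0 /\ (n.+1 - k <= val x)%N.
  case/imsetP=> i _ ->; rewrite oppr_eq0 f0 valN // fE; split=> //.
  by rewrite leq_sub2l.
have clow : #|low| = k by rewrite card_imset // card_ord.
have chigh : #|high| = k.
  by rewrite card_imset ?card_ord // => i j /oppr_inj/finj.
have cmid : #|mid| = odd Delta by rewrite /mid; case: (odd Delta); rewrite ?cards1 ?cards0.
have dlh : low :&: high = finset.set0.
  apply/setP => x; rewrite !inE; apply/negP => /andP[/lowP[_ h1] /highP[_ h2]].
  by move: h1 h2 kn; move: (val x) => y; lia.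
have dm : (low :|: high) :&: mid = finset.set0.
  apply/setP => x; rewrite [in LHS]inE in_set0; apply/negP => /andP[xlh /midP[oD ex]].
  have Dk : (k.*2.+1 < n.+1)%N by move: Dn; rewrite kE oD.
  case/setUP: xlh => [/lowP[_ h1]|/highP[_ h2]]; first by move: h1 ex Dk; move: (val x) => y; lia.
  by move: h2 ex Dk kn'; move: (val x) => y; lia.
pose D := low :|: high :|: mid.
have cD : #|D| = Delta.
  rewrite /D cardsU dm cards0 subn0 cardsU dlh cards0 subn0 clow chigh cmid addnn addnC.
  by rewrite [RHS]kE.
rewrite -cD; exists (circulant D); apply: circulant_regular.
  apply/negP => /setUP[/setUP[/lowP[]|/highP[]]|/midP[_]]; rewrite ?eqxx //.
move=> x /setUP[/setUP[|]|].
- by case/imsetP=> i _ ->; apply/setUP; left; apply/setUP; right; apply: imset_f.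
- by case/imsetP=> i _ ->; rewrite opprK; apply/setUP; left; apply/setUP; left; apply: imset_f.
- move=> xm; have [oD ex] := midP x xm.
  have x0 : x != 0 by apply/eqP => e; rewrite e in ex.
  suff -> : - x = x by apply/setUP; right.
  by apply: val_inj; rewrite valN //; move: ex => /=; lia.
Qed.

(** * The bound for a fixed graph *)

Section Blocks.
Variable X : eqType.

Fixpoint blocks (b l : nat) (s : seq X) : seq (seq X) :=
  if b is b'.+1 then take l s :: blocks b' l (drop l s) else [::].

Lemma blocks_cat b l s : exists s', s = flatten (blocks b l s) ++ s'.
Proof.
elim: b s => [|b IH] s; first by exists s.
have [s' e] := IH (drop l s); exists s'.
by rewrite /= -catA -e cat_take_drop.
Qed.

Lemma size_blocks b l s : size (blocks b l s) = b.
Proof. by elim: b s => [|b IH] s //=; rewrite IH. Qed.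

End Blocks.

Section Coverage.
Variables (R : realType) (V : finType) (E : {set {set V}}).
Hypothesis E0 : (0 < #|E|)%N.
Notation N := (#|E|%:R : R).

Let N0 : N != 0. Proof. by rewrite pnatr_eq0 -lt0n. Qed.

Lemma Av_take l T (g : seq {set V} -> R) : Av E (l + T) (fun s => g (take l s)) = Av E l g.
Proof.
elim: l g => [|l IH] g; first by rewrite add0n -[RHS](Av_cst T (g [::]) E0); congr Av; apply/funext => s; rewrite take0.
by rewrite addSn /=; apply: eq_bigr => e _; congr (_ * _); rewrite -IH.
Qed.

Lemma Av_drop l T (g : seq {set V} -> R) : Av E (l + T) (fun s => g (drop l s)) = Av E T g.
Proof.
elim: l => [|l IH]; first by rewrite add0n; congr Av; apply/funext => s; rewrite drop0.
rewrite addSn /=; under eq_bigr => e _ do rewrite IH.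
rewrite sumr_const -mulrnAl -[_ *+ _]mulr_natr mulVf ?mul1r //.
Qed.

Lemma Av_miss l e : e \in E -> Av E l (fun s => (e \notin s)%:R) = (1 - N^-1) ^+ l.
Proof.
move=> eE; elim: l => [|l IH] //=; rewrite exprS -IH.
rewrite (bigD1 e) //= (_ : Av E l _ = 0); last first.
  by rewrite -(Av_cst l (0 : R) E0); congr Av; apply/funext => s; rewrite mem_head.
rewrite mulr0 add0r (eq_bigr (fun=> N^-1 * Av E l (fun s => (e \notin s)%:R))); last first.
  move=> e' /andP[_ ne]; congr (_ * Av E l _); apply/funext => s.
  by rewrite inE negb_or eq_sym ne.
rewrite sumr_const -[_ *+ _]mulr_natr mulrAC; congr (_ * _).
have -> : #|[pred i in E | i != e]| = #|E|.-1.
  by rewrite (cardsD1 e E) eE /=; apply: eq_card => i; rewrite !inE andbC.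
have -> : #|E|.-1%:R = N - 1 by rewrite -[in RHS](prednK E0) -natr1 addrK.
by rewrite mulrBr mulVf // mulr1.
Qed.

Definition full_block (s : seq {set V}) := [forall e in E, e \in s].

Lemma Av_miss_block l : Av E l (fun s => (~~ full_block s)%:R) <= N * (1 - N^-1) ^+ l.
Proof.
apply: (@le_trans _ _ (Av E l (fun s => \sum_(e : {set V}) (e \in E)%:R * (e \notin s)%:R))).
  apply: Av_le => s _ _; case: (boolP (full_block s)) => [_|/forallPn[e]] /=.
    by apply: sumr_ge0 => e _; rewrite mulr_ge0 // ler0n.
  rewrite negb_imply => /andP[eE es]; rewrite (bigD1 e) //= eE es mulr1 lerDl.
  by apply: sumr_ge0 => e' _; rewrite mulr_ge0 // ler0n.
rewrite Av_sum le_eqVlt; apply/orP; left; apply/eqP.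
rewrite mulr_natl -sumr_const [RHS]big_mkcond; apply: eq_bigr => e _.
by case: (boolP (e \in E)) => eE; rewrite ?mul1r ?mul0r // Av_miss.
Qed.

Lemma Av_miss_blocks b l T : (b * l <= T)%N ->
  Av E T (fun s => (~~ all full_block (blocks b l s))%:R) <= b%:R * (N * (1 - N^-1) ^+ l).
Proof.
elim: b T => [|b IH] T.
  by move=> _; rewrite mul0r -[leRHS](Av_cst T (0 : R) E0); apply: Av_le => s.
rewrite mulSn => bT; have -> : T = (l + (T - l))%N by rewrite subnKC // (leq_trans _ bT) // leq_addr.
have bT' : (b * l <= T - l)%N by rewrite leq_subRL // (leq_trans _ bT) // leq_addr.
apply: (@le_trans _ _ (Av E (l + (T - l)) (fun s => 1 * (~~ full_block (take l s))%:R +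
    (~~ all full_block (blocks b l (drop l s)))%:R))).
  apply: Av_le => s _ _ /=; rewrite mul1r negb_and.
  by case: (full_block _) => /=; case: (all _ _) => /=; rewrite ?addr0 ?add0r ?lerDl.
rewrite Av_lin mul1r -natr1 mulrDl mul1r [leRHS]addrC.
apply: lerD; last by rewrite (Av_drop _ _ (fun s => (~~ all full_block (blocks b l s))%:R)) IH.
by rewrite (Av_take _ _ (fun s => (~~ full_block s)%:R)) Av_miss_block.
Qed.

Lemma miss_le_exp l : (1 - N^-1) ^+ l <= expR (- (l%:R / N)).
Proof.
have -> : - (l%:R / N) = l%:R * (- N^-1) by rewrite mulrN.
rewrite expRM_natl; apply: lerXn2r; rewrite ?nnegrE ?expR_ge0 //.
  by rewrite subr_ge0 invf_le1 ?ltr0n // ler1n.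
by have := @expR_ge1Dx R (- N^-1).
Qed.

End Coverage.

Section FixedGraph.
Variables (R : realType) (p q : R).
Hypotheses (hq : 1 <= q) (hp : 0 < p < 1).
Variables (V : finType) (d h : nat) (G : {set {set V}}) (v : V).
Hypothesis regG : regular d.+1 G.
Notation Nb := (Nb G).
Notation ds := (nseq h.+1 d).
Notation K0 := (region_size d h).

(** The edges at [v] are all declared open: [v] has [d.+1] neighbours, whereas later frontier
    vertices are entered by a dart and have [d] children. *)
Lemma explore_init : exists T,
  explore_inv d h G v (v |: Nb v) [set v] T [set [set v; a] | a in Nb v].
Proof.
pose Q (W : {set V}) := v \in W /\ exists T, tree_on G v W T /\
  forall x, x \in W -> x != v -> forall e e', e \in T -> e' \in T -> x \in e -> x \in e' -> e = e'.
have [_ [T [tT dT]]] : Q (v |: Nb v).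
  have -> : v |: Nb v = [set x in enum (Nb v)] :|: [set v].
    by apply/setP => x; rewrite !inE mem_enum inE orbC.
  apply: (@star_ind V G Q [set v] _ [set v] v (enum (Nb v))); rewrite ?set11 //.
  - move=> W a b [vW [T [tT dT]]] aW; rewrite inE => /eqP -> ba bW.
    split; first by rewrite in_setU1 vW orbT.
    exists ([set v; b] |: T); split; first exact: (tree_on_grow tT vW ba bW).
    have eT e : e \in T -> b \notin e.
      move=> eT; case: tT => _ /fintype.subsetP/(_ e eT); rewrite inE => /andP[_ eW] _.
      by apply: contra bW; exact: (fintype.subsetP eW).
    move=> x; rewrite in_setU1 => /orP[/eqP->|xW] xv e e'.
      rewrite !in_setU1 => /orP[/eqP->|/eT h1] /orP[/eqP->|/eT h2] // h3 h4.
      + by rewrite h4 in h2.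
      + by rewrite h3 in h1.
      + by rewrite h3 in h1.
    have xa : x \notin [set v; b].
      by rewrite !inE negb_or xv; apply: contraNneq bW => <-.
    rewrite !in_setU1 => /orP[/eqP->|eT1]; first by rewrite (negPf xa).
    by move=> /orP[/eqP->|eT2]; [rewrite (negPf xa)|exact: (dT x)].
  - by move=> x; rewrite mem_enum.
  - split; first by rewrite inE.
    exists set0; split; last by move=> x _ _ e e'; rewrite inE.
    split; last by rewrite cards0 cards1.
      exists [::]; rewrite cards0; split=> //.
      by apply/setP => x; rewrite !inE.
    exact: sub0set.
exists T; split=> //.
- by rewrite inE.
- by rewrite sub1set setU11.
- by move=> a; rewrite inE => /eqP ->; exact: subsetUr.
- by move=> x xU; rewrite inE => xv; exact: dT.
- apply/fintype.subsetP => _ /imsetP[a aN ->]; apply/(exploredP regG).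
  by exists v; [rewrite inE|exists a].
- move=> z zD; apply: (@leq_trans #|[set z]|); last by rewrite cards1.
  apply: subset_leq_card; apply: open_cluster_min; last by rewrite inE.
  move=> a b; rewrite inE => /eqP -> /imsetP[y yN /eqP].
  rewrite set2_eqP => /orP[/andP[/eqP e _]|/andP[/eqP e1 /eqP e2]].
    by rewrite e open_cluster_refl in zD.
  case/negP: zD; rewrite e1; apply: open_cluster_step (open_cluster_refl _ _) _.
  by apply: imset_f.
Qed.

Lemma sparse_near L J w : ~~ dense_near v L J G -> (size w <= L)%N -> trav v w \subset G ->
  (#|inner G (visited v w) :\: trav v w| <= J)%N.
Proof.
move=> nd sL tG; rewrite leqNgt; apply: contra nd => lt.
apply/existsP; exists (Ordinal (sL : (size w < L.+1)%N)).
by apply/existsP; exists (in_tuple w); rewrite tG.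
Qed.

Lemma full_block_covers st s : dart G st ->
  injective (@vo _ _ (ch G) (fun st : V * V => st.2) ds st) ->
  full_block G s -> covers (region_of d G h.+1 st) s.
Proof.
move=> dst inj /forallP fb; apply/forallP => z; apply/hasP.
exists (edge (ch G) (fun st : V * V => st.2) st z); last by rewrite region_edge.
by have := fb (edge (ch G) (fun st : V * V => st.2) st z); rewrite redge_G.
Qed.

Variables (lam : conf ds -> R) (theta rho : R) (b l J k m L : nat).
Hypothesis lam_ge0 : forall y, 0 <= lam y.
Hypothesis near_lam : forall (X : eqType) (m : X -> option (pos ds)) ss s c y,
  size ss = b -> all (covers m) ss -> hit p q m (flatten ss ++ s) c y <= lam y.
Hypothesis theta1 : 1 <= theta.
Hypothesis rho01 : 0 < rho <= 1.
Hypothesis branch : \sum_y lam y * theta ^+ nleaf y <= rho * theta.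
Hypothesis rt1 : 1 <= rho * theta.
Hypothesis sparseG : ~~ dense_near v L J G.
Hypothesis mL : ((d.+2 + m * K0).*2 <= L)%N.
Hypothesis mk : (d.+2 + m * K0 < k)%N.

Lemma cluster_bound s : all (fun e => e \in G) s -> all (full_block G) (blocks b l s) ->
  Eu p q s (fun o => (k <= #|open_cluster (foldl (@fk_upd V) G o) v|)%N%:R) <=
  theta ^+ (d.+1 + (K0 * K0).+1 * (3 * J)) * rho ^+ m.
Proof.
move=> sG fb; have [T I] := explore_init.
have [s' es] := blocks_cat b l s.
have hl st : dart G st -> injective (@vo _ _ (ch G) (fun st : V * V => st.2) ds st) ->
    forall y, hit p q (region_of d G h.+1 st) s (mkc xpredT) y <= lam y.
  move=> dst inj y; rewrite es; apply: near_lam; first exact: size_blocks.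
  by apply: sub_all fb => bl; exact: full_block_covers.
(* Since [rho * theta >= 1], one more power of [theta] supplies the factor [rho] that a bad step
   does not earn. *)
have cost : theta ^+ (K0 * K0) <= rho * theta ^+ (K0 * K0).+1.
  by rewrite exprS mulrA ler_peMl // exprn_ge0 // (le_trans ler01).
have cU : #|v |: Nb v| = d.+2.
  by rewrite cardsU1 (card_Nb regG) (Nb_irr regG).
have bound := @exploration_bound R p q hq hp V d h G v regG s sG lam lam_ge0 hl theta rho
  J (d.+2 + m * K0) k (K0 * K0).+1 theta1 rho01 branch cost.
have {}bound := bound (fun w sw => sparse_near sparseG (leq_trans sw mL)) mk m _ _ _ _ [::] I.
have {}bound := bound (fun c (h : c \in [::]) => match notF h with end) Logic.I.
rewrite cU in bound; have {}bound := bound (leqnn _).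
apply: le_trans (le_trans _ bound) _.
  apply: Eu_le => // o _; rewrite ler_nat /large_cluster /matches /=.
  rewrite (_ : _ \subset _) //; apply/fintype.subsetP => e; rewrite in_setI => /andP[_].
  by case/(exploredP regG)=> a; rewrite inE => /eqP -> [c cN ->]; apply: imset_f.
rewrite big_nil mul1r mulrAC -exprD; apply: ler_wpM2r.
  by rewrite exprn_ge0 // ltW; case/andP: rho01.
apply: ler_weXn2l => //; apply: leq_add; last by rewrite leq_mul2l leq_subr orbT.
rewrite -(card_Nb regG v); apply: subset_leq_card; apply/fintype.subsetP => x.
rewrite in_setD inE => /andP[xv xD].
have sub : open_cluster [set [set v; a] | a in Nb v] v \subset v |: Nb v.
  exact: (cluster_in regG I (setU11 _ _)).
by have := fintype.subsetP sub x xD; rewrite in_setU1 (negPf xv).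
Qed.

End FixedGraph.

(** * The constants *)

Section Constants.
Variables (R : realType) (q : R).
Hypothesis hq : 1 <= q.

Lemma slack_cvg0 (p : R) d : 0 < p < 1 -> (0 < d)%N ->
  (root_leaf_prob q d.+1 p h @[h --> \oo] --> (0 : R))%classic ->
  forall eps, 0 < eps -> exists h0, forall h, (h0 <= h)%N -> slack q d p h < eps.
Proof.
move=> hp hd cv eps eps0.
have a0 : 0 < q / phat p q by rewrite divr_gt0 ?phat_gt0 // (lt_le_trans ltr01).
have e0 : 0 < eps / (q / phat p q) by exact: divr_gt0.
have /cvgrPdist_lt/(_ _ e0) [N _ hN] := cv.
exists N => h Nh.
apply: le_lt_trans (slack_le_conn_prob hq hd hp h (ltn0Sn d)) _.
rewrite -root_leaf_probE // mulrC -ltr_pdivlMr //.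
have := hN h.+1 (leqW Nh); rewrite /= sub0r normrN.
exact/le_lt_trans/ler_norm.
Qed.

Lemma phat_lt (p p' : R) : 0 < p < 1 -> 0 < p' < 1 -> p < p' -> phat p q < phat p' q.
Proof.
move=> /andP[p0 p1] /andP[r0 r1] pr; rewrite /phat.
have q0 : 0 < q by exact: lt_le_trans hq.
have D1 : 0 < q * (1 - p) + p by apply: addr_gt0 => //; apply: mulr_gt0 => //; lra.
have D2 : 0 < q * (1 - p') + p' by apply: addr_gt0 => //; apply: mulr_gt0 => //; lra.
rewrite ltr_pdivrMr // mulrAC ltr_pdivlMr //.
have : 0 < q * (p' - p) by apply: mulr_gt0 => //; rewrite subr_gt0.
by nra.
Qed.

Lemma small_meanN (p eps : R) d : 0 < p < 1 -> (0 < d)%N -> p < p_u q d.+1 -> 0 < eps ->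
  exists h, meanN q d p h.+1 < eps.
Proof.
move=> hp hd ppu eps0; have /andP[p0 p1] := hp.
have [r cr pr] : exists2 r, is_critical q d.+1 r & p < r.
  exists (p_u q d.+1) => //; rewrite /p_u; case: xgetP => [r -> //|no].
  by move: ppu; rewrite /p_u; case: xgetP => [r -> /no//|_]; rewrite ltNge ltW.
case: cr => /andP[r0 r1] sub _.
(* The gap between [p] and [(p + r) / 2] makes [d * phat p] strictly less than 1. *)
have hp' : 0 < (p + r) / 2 < 1 by apply/andP; split; lra.
have h1 := slack_cvg0 hp hd (sub _ hp pr).
have h2 := slack_cvg0 hp' hd (sub _ hp' ltac:(lra)).
have lt1 : d%:R * phat p q < 1.
  apply: lt_le_trans (slope_le1 hq hd hp' h2).
  by rewrite ltr_pM2l ?ltr0n // phat_lt // ltr_pdivlMr // mulr_natr mulr2n ltrD2l.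
by have [[|h] // _ ?] := meanN_small hq hd hp h1 lt1 eps0; exists h.
Qed.

Lemma exp1D_le (eta : R) N : 0 <= eta -> 2 * eta * N%:R <= 1 ->
  (1 + eta) ^+ N <= 1 + 2 * eta * N%:R.
Proof.
move=> e0; elim: N => [|N IH]; first by rewrite expr0 mulr0 addr0.
rewrite exprS -[N.+1]addn1 natrD; move: (N%:R : R) (ler0n R N) IH => x x0 IH h.
rewrite !mulrDr mulr1 in h *.
have {}IH : (1 + eta) ^+ N <= 1 + 2 * eta * x by apply: IH; lra.
by move: (_ ^+ N) IH => y IH; nra.
Qed.

Lemma branching_constants (p : R) d : 0 < p < 1 -> (0 < d)%N -> p < p_u q d.+1 ->
  exists h b (lam : conf (nseq h.+1 d) -> R) (theta rho : R),
  [/\ forall y, 0 <= lam y,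
      forall (X : eqType) (m : X -> option (pos (nseq h.+1 d))) ss s c y,
        size ss = b -> all (covers m) ss -> hit p q m (flatten ss ++ s) c y <= lam y,
      1 <= theta /\ 0 < rho < 1,
      \sum_y lam y * theta ^+ nleaf y <= rho * theta & 1 <= rho * theta].
Proof.
move=> hp hd ppu; have [h mh] := small_meanN hp hd ppu (eps := 8^-1) ltac:(by rewrite invr_gt0).
set ds := nseq h.+1 d; pose P := \max_(c : conf ds) nleaf c.
have leP c : (nleaf (c : conf ds) <= P)%N by exact: (leq_bigmax c).
(* Makes [2 * eta * nleaf] at most 1, the range of [exp1D_le]. *)
pose eta : R := (2 * P.+1%:R)^-1.
have e0 : 0 < eta by rewrite invr_gt0 mulr_gt0 // ltr0n.
have eP : 2 * eta * P.+1%:R = 1.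
  by rewrite /eta mulrAC mulfV // mulf_neq0 // pnatr_eq0.
have e1 : eta <= 2^-1.
  rewrite lef_pV2 ?posrE ?mulr_gt0 ?ltr0n //; rewrite ler_peMr // ler1n //.
have [b hb] := near_stationary_ratio hq hp ds (eps := eta / 4) ltac:(by rewrite divr_gt0).
pose Z := tot p q ds.
have w0 (y : conf ds) : 0 <= wt p q y by rewrite ltW ?wt_gt0.
have Z0 : 0 < Z.
  rewrite /Z /tot (bigD1 (mkc (ds:=ds) xpredT)) //; apply: ltr_pwDl; first exact: wt_gt0.
  by apply: sumr_ge0 => y _; exact: w0.
have rt : (1 + eta / 4) ^+ 2 / (1 + eta) * (1 + eta) = (1 + eta / 4) ^+ 2.
  by rewrite divfK //; apply: lt0r_neq0; lra.
(* A mean below 1/8 bounds the stationary moment of [theta ^+ nleaf] by [1 + eta / 4]; the mixing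
   error gives the same factor again, and [(1 + eta / 4) ^+ 2 < 1 + eta]. *)
exists h, b, (fun y => (1 + eta / 4) * (wt p q y / Z)), (1 + eta), ((1 + eta / 4) ^+ 2 / (1 + eta)).
split.
- by move=> y; rewrite mulr_ge0 ?divr_ge0 ?w0 //; [lra|exact: ltW].
- by move=> X m ss s c y s1 s2; exact: hb.
- split; first by lra.
  have e2 : 0 < 1 + eta by lra.
  by rewrite divr_gt0 ?exprn_gt0 ?ltr_pdivrMr //=; nra.
- rewrite rt; under eq_bigr do rewrite -mulrA; rewrite -mulr_sumr expr2.
  apply: ler_wpM2l; first by lra.
  apply: (@le_trans _ _ (\sum_(y : conf ds) (wt p q y + 2 * eta * (wt p q y * (nleaf y)%:R)) / Z)).
    apply: ler_sum => y _; rewrite mulrAC; apply: ler_wpM2r; first by rewrite invr_ge0 ltW.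
    rewrite mulrCA -[X in _ <= X + _]mulr1 -mulrDr; apply: ler_wpM2l => //.
    apply: exp1D_le; first exact: ltW.
    apply: (@le_trans _ _ (2 * eta * P.+1%:R)); last by rewrite eP.
    apply: ler_wpM2l; first by lra.
    by rewrite ler_nat (leq_trans (leP y)).
  rewrite -mulr_suml big_split /= -mulr_sumr mulrDl divff ?lt0r_neq0 //.
  rewrite lerD2l -mulrA.
  have : meanN q d p h.+1 < 8^-1 by [].
  by rewrite /meanN /totN -/ds -/Z; nra.
- by rewrite rt; nra.
Qed.

End Constants.

(** * Probability of a dense neighbourhood at logarithmic scale *)

Section DenseProbability.
Variable R : realType.

Lemma expr_le_expR (x : R) N : 0 <= x -> x ^+ N <= N%:R ^+ N * expR x.
Proof.
case: N => [|N] x0; first by rewrite !expr0 mul1r -expR0 ler_expR.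
have N0 : (0 : R) < N.+1%:R by rewrite ltr0n.
have : (x / N.+1%:R) ^+ N.+1 <= expR (x / N.+1%:R) ^+ N.+1.
  apply: lerXn2r; rewrite ?nnegrE ?expR_ge0 ?divr_ge0 ?ler0n //.
  by apply: le_trans (expR_ge1Dx _); rewrite lerDr.
rewrite -expRM_natl mulrCA divff ?lt0r_neq0 // mulr1 => h.
by rewrite mulrC -ler_pdivrMr ?exprn_gt0 // -expr_div_n.
Qed.

Lemma expR_ln_nat (j n : nat) : (0 < n)%N -> expR (j%:R * ln (n%:R : R)) = n%:R ^+ j.
Proof. by move=> n0; rewrite expRM_natl lnK // posrE ltr0n. Qed.

Lemma ln_le_linear (a a' : R) : 0 <= a -> 0 <= a' ->
  exists N, forall n, (N <= n)%N -> a * ln n%:R + a' <= n%:R.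
Proof.
move=> a0 a'0; pose x : R := 16 * a ^+ 2 + 2 * a' + 1; exists (Num.truncn x).+1 => n Nn.
have xn : x <= n%:R.
  by apply/ltW; apply: lt_le_trans (truncnS_gt x) _; rewrite ler_nat.
have n0 : (0 < n)%N by case: n Nn xn.
have l0 : 0 <= ln (n%:R : R) by rewrite ln_ge0 // ler1n.
have := expr_le_expR 2 l0; rewrite lnK ?posrE ?ltr0n //.
move: (ln _) l0 => y y0; move: (n%:R : R) xn => z; rewrite /x => xz yz.
have a2 : 0 <= a ^+ 2 by exact: sqr_ge0.
have h : (a * y) ^+ 2 <= (z / 2) ^+ 2.
  rewrite exprMn; apply: (@le_trans _ _ (a ^+ 2 * (2 ^+ 2 * z))); first exact: ler_wpM2l.
  by nra.
have {}h : a * y <= z / 2.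
  by rewrite -(@ler_pXn2r _ 2) ?nnegrE ?mulr_ge0 //; lra.
by lra.
Qed.

Lemma div_natr5_ge1 (N n : nat) : (0 < n)%N -> (n <= N)%N -> 1 <= N%:R ^+ 5 / n%:R ^+ 5 :> R.
Proof.
move=> n0 nN; rewrite ler_pdivlMr ?exprn_gt0 ?ltr0n // mul1r.
by apply: lerXn2r; rewrite ?nnegrE ?ler0n // ler_nat.
Qed.

Lemma dense_near_prob d (a a' : R) : 0 <= a -> 0 <= a' ->
  exists J (A : R), 0 <= A /\ forall n (v : 'I_n) L, L%:R <= a * ln n%:R + a' ->
    #|[set E | regular d.+1 E & dense_near v L J E]|%:R / #|[set E : {set {set 'I_n}} | regular d.+1 E]|%:R
      <= A / n%:R ^+ 5.
Proof.
move=> a0 a'0; pose D : R := d.+1%:R.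
have D1 : 1 <= D by rewrite ler1n.
have lD : 0 <= ln D by exact: ln_ge0.
have [j ja] : exists j : nat, a * ln D <= j%:R.
  by exists (Num.truncn (a * ln D)).+1; exact/ltW/truncnS_gt.
(* Of the [J.+1 = j + 6] powers of n gained, [j] pay for the [D ^+ L] walks, one for the powers of
   the logarithmic [L], and five remain. *)
have [J JE] : exists J, J = (j + 5)%N by eexists.
pose cc := (4 * J.+1 + 8 * d.+1 + 4 * d.+1 ^ 2)%N.
have [N hN] := @ln_le_linear (4 * a) (4 * a' + cc%:R) ltac:(by rewrite mulr_ge0) ltac:(by rewrite addr_ge0 ?mulr_ge0 ?ler0n).
have [e eE] : exists e, e = (J.+1 * 2).+1 by eexists.
pose A1 := ((a + a' + 1) ^+ e * (e%:R ^+ e * expR 1)) * (2 * D) ^+ J.+1 * expR (ln D * a').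
exists J, (N%:R ^+ 5 + A1).
have A10 : 0 <= A1.
  have h1 : 0 <= a + a' + 1 by rewrite !addr_ge0.
  have h2 : 0 <= 2 * D by rewrite mulr_ge0 // (le_trans ler01).
  by rewrite /A1 !mulr_ge0 ?exprn_ge0 ?expR_ge0 ?ler0n.
split; first by rewrite addr_ge0 // exprn_ge0 ?ler0n.
move=> n v L hL; have n0 : (0 < n)%N by case: n v {hL} => [[]|].
rewrite mulrDl; have nn0 : (0 : R) < n%:R by rewrite ltr0n.
set X := [set E | _ & _]; set Y := [set E | _].
have XY : #|X|%:R / #|Y|%:R <= 1 :> R.
  have [Y0|Y0] := posnP #|Y|; first by rewrite Y0 invr0 mulr0.
  rewrite ler_pdivrMr ?ltr0n // mul1r ler_nat subset_leq_card //.
  by apply/fintype.subsetP => E; rewrite !inE => /andP[].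
(* For small n the trivial bound 1 is absorbed in the constant by [N ^ 5]. *)
have [nN|Nn] := leqP n N.
  apply: le_trans XY _; apply: le_trans (div_natr5_ge1 n0 nN) _.
  by rewrite lerDl divr_ge0 // exprn_ge0 ?ler0n.
have /card_dense_near : (2 * (2 * (L + J.+1) + 4 * d.+1 + 2 * d.+1 ^ 2) <= #|{: 'I_n}| * d.+1)%N.
  rewrite card_ord; have : (4 * L + cc <= n)%N.
    rewrite -(ler_nat R) natrD natrM; apply: le_trans (hN n (ltnW Nn)).
    by rewrite addrA lerD2r -mulrA -mulrDr ler_wpM2l.
  rewrite /cc; move: (d.+1 ^ 2)%N => s h; apply: (@leq_trans n); first by lia.
  by rewrite leq_pmulr.
move=> /(_ v); rewrite -/X -/Y card_ord => main.
apply: (@le_trans _ _ (A1 / n%:R ^+ 5)); last by rewrite lerDr divr_ge0 // exprn_ge0 ?ler0n.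
have [Y0|Y0] := posnP #|Y|; first by rewrite Y0 invr0 mulr0 divr_ge0 // exprn_ge0 ?ler0n.
rewrite ler_pdivrMr ?ltr0n // mulrAC ler_pdivlMr ?exprn_gt0 //.
rewrite -(ler_pM2r (exprn_gt0 j.+1 nn0)) -mulrA -exprD.
have -> : (5 + j.+1 = J.+1)%N by rewrite JE; lia.
have {}main : #|X|%:R * n%:R ^+ J.+1 <=
    L.+1%:R ^+ e * (2 * D) ^+ J.+1 * D ^+ L * #|Y|%:R :> R.
  move: main; rewrite -(ler_nat R) !natrM !natrX !natrM => main.
  by apply: le_trans main _; rewrite eE (exprS _ (J.+1 * 2)) (mulnC J.+1) exprM !mulrA.
apply: le_trans main _; rewrite [leRHS]mulrAC; apply: ler_wpM2r; first by rewrite ler0n.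
have l0 : 0 <= ln (n%:R : R) by rewrite ln_ge0 // ler1n.
have h1 : L.+1%:R ^+ e <= (a + a' + 1) ^+ e * (e%:R ^+ e * expR 1) * n%:R :> R.
  apply: (@le_trans _ _ (((a + a' + 1) * (1 + ln n%:R)) ^+ e)).
    apply: lerXn2r; rewrite ?nnegrE ?mulr_ge0 ?addr_ge0 //.
    by rewrite -natr1; move: (ln _) l0 hL => y y0 hL; nra.
  rewrite exprMn -!mulrA; apply: ler_wpM2l; first by rewrite exprn_ge0 // !addr_ge0.
  have := @expr_le_expR (1 + ln n%:R) e ltac:(by rewrite addr_ge0).
  by rewrite expRD lnK // posrE.
have h2 : D ^+ L <= expR (ln D * a') * n%:R ^+ j.
  rewrite -[D in D ^+ _]lnK ?posrE; last by exact: lt_le_trans D1.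
  rewrite -expRM_natl -expR_ln_nat // -expRD ler_expR.
  apply: (@le_trans _ _ ((a * ln n%:R + a') * ln D)); first exact: ler_wpM2r.
  by move: (ln n%:R) l0 => y y0; nra.
rewrite /A1; set u := _ * (_ * expR 1) in h1 *; rewrite (exprS _ j).
have -> : u * (2 * D) ^+ J.+1 * expR (ln D * a') * (n%:R * n%:R ^+ j) =
   (u * n%:R) * (2 * D) ^+ J.+1 * (expR (ln D * a') * n%:R ^+ j) by ring.
have D20 : 0 <= (2 * D) ^+ J.+1 by rewrite exprn_ge0 // mulr_ge0 // (le_trans ler01).
apply: ler_pM => //.
- by rewrite mulr_ge0 // exprn_ge0 ?ler0n.
- by rewrite exprn_ge0 // (le_trans ler01).
- exact: ler_wpM2r.
Qed.

End DenseProbability.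

(** * From a fixed graph to the random graph *)

Lemma card_edges_le (V : finType) Delta (G : {set {set V}}) :
  regular Delta G -> (#|G| <= #|V| * Delta)%N.
Proof.
case/andP=> /forallP sG /forallP dG.
have sub : G \subset \bigcup_(v : V) [set e in G | v \in e].
  apply/fintype.subsetP => e eG; have := implyP (sG e) eG => /eqP e2.
  have [v ve] : exists v, v \in e by apply/set0Pn; rewrite -card_gt0 e2.
  by apply/bigcupP; exists v; rewrite ?inE ?eG.
apply: leq_trans (subset_leq_card sub) (leq_trans (card_bigcup_le _ _) _).
rewrite -sum_nat_const; apply: leq_sum => v _.
by rewrite -(eqP (dG v)).
Qed.

Lemma card_edges_gt0 (V : finType) Delta (G : {set {set V}}) (v : V) :
  (0 < Delta)%N -> regular Delta G -> (0 < #|G|)%N.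
Proof.
move=> D0 /andP[_ /forallP/(_ v)/eqP dv]; rewrite -{}dv in D0.
apply: leq_trans D0 (subset_leq_card _).
by apply/fintype.subsetP => e; rewrite inE => /andP[].
Qed.

Section FKTail.
Variables (R : realType) (p q : R).
Hypotheses (hq : 1 <= q) (hp : 0 < p < 1).

Lemma fk_prob_le1 (V : finType) (G w : {set {set V}}) T (A : pred {set {set V}}) :
  (0 < #|G|)%N -> fk_prob p q G w T A <= 1.
Proof.
move=> G0; rewrite fk_prob_Av -[leRHS](Av_cst T 1 G0).
apply: Av_le => s _ _; rewrite -[leRHS](Eu_cst p q s 1).
by apply: Eu_le => // o _; rewrite lern1; case: (A _).
Qed.

(** Edge sequences with a block missing some edge are given up, at the coupon-collector cost; the
    others fall under [cluster_bound]. *)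
Lemma fk_cluster_tail (V : finType) d h (G : {set {set V}}) (v : V)
    (lam : conf (nseq h.+1 d) -> R) (theta rho : R) b l J k m L T :
  regular d.+1 G ->
  (forall y, 0 <= lam y) ->
  (forall (X : eqType) (m : X -> option (pos (nseq h.+1 d))) ss s c y,
    size ss = b -> all (covers m) ss -> hit p q m (flatten ss ++ s) c y <= lam y) ->
  1 <= theta -> 0 < rho <= 1 ->
  \sum_y lam y * theta ^+ nleaf y <= rho * theta -> 1 <= rho * theta ->
  ~~ dense_near v L J G -> ((d.+2 + m * region_size d h).*2 <= L)%N ->
  (d.+2 + m * region_size d h < k)%N -> (b * l <= T)%N ->
  fk_prob p q G G T (fun w => (k <= #|open_cluster w v|)%N) <=
    theta ^+ (d.+1 + (region_size d h * region_size d h).+1 * (3 * J)) * rho ^+ m +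
    b%:R * (#|G|%:R * (1 - #|G|%:R^-1) ^+ l).
Proof.
move=> rG lam0 near th1 rho01 branch rt sp mL mk bT.
have G0 := card_edges_gt0 v (ltn0Sn d) rG.
set M := _ * rho ^+ m; rewrite fk_prob_Av.
apply: (@le_trans _ _ (Av G T (fun s => 1 * (~~ all (full_block G) (blocks b l s))%:R + M))).
  apply: Av_le => s _ sG; rewrite mul1r; case fb : (all _ _) => /=.
    by rewrite add0r; exact: (cluster_bound hq hp rG lam0 near th1 rho01 branch rt sp mL mk sG fb).
  have M0 : 0 <= M.
    case/andP: rho01 => r0 _.
    by rewrite mulr_ge0 // exprn_ge0 // ?(ltW r0) // (le_trans ler01).
  rewrite -[leLHS]addr0; apply: lerD => //; rewrite -[leRHS](Eu_cst p q s 1).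
  by apply: Eu_le => // o _; rewrite lern1 leq_b1.
by rewrite (Av_lin G T 1 _ (fun=> M)) mul1r Av_cst // addrC lerD2l; exact: Av_miss_blocks.
Qed.

End FKTail.

(** The constant 6 makes a given edge missed with probability at most [N ^ -6]; the union over the
    edges costs one power. *)
Lemma miss_bound (R : realType) (N E l : nat) Delta : (0 < N)%N -> (0 < E)%N -> (E <= N * Delta)%N ->
  6 * Delta%:R * N%:R * ln (N%:R : R) <= l%:R ->
  E%:R * expR (- (l%:R / E%:R)) <= Delta%:R / N%:R ^+ 5 :> R.
Proof.
move=> N0 E0 EN hl.
have D0 : (0 < Delta)%N by case: Delta EN {hl} => //; rewrite muln0 leqNgt E0.
have n0 : (0 : R) < N%:R by rewrite ltr0n.
have d0 : (0 : R) < Delta%:R by rewrite ltr0n.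
have h : expR (- (l%:R / E%:R)) <= (N%:R ^+ 6)^-1 :> R.
  rewrite -expR_ln_nat // -expRN ler_expR lerN2 ler_pdivlMr ?ltr0n //.
  apply: le_trans hl; have l0 : 0 <= ln (N%:R : R) by rewrite ln_ge0 // ler1n.
  have : E%:R <= N%:R * Delta%:R :> R by rewrite -natrM ler_nat.
  move/(ler_wpM2l l0); lra.
apply: (@le_trans _ _ ((N * Delta)%:R * (N%:R ^+ 6)^-1)).
  by apply: ler_pM; rewrite ?ler0n ?expR_ge0 ?ler_nat.
rewrite natrM exprS invfM mulrACA divff ?mul1r //; exact: lt0r_neq0.
Qed.

Lemma add_lt_of_le_sub D x k : (x <= k - D.+1)%N -> (D < k)%N -> (D + x < k)%N.
Proof. lia. Qed.

Lemma le_add_of_sub_lt D x k : (k - D.+1 < x)%N -> (D < k)%N -> (k <= D.+1 + x)%N.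
Proof. lia. Qed.

Theorem theorem3p2 (R : realType) (q : R) (Delta : nat) (p : R)
    (hq : 1 <= q) (hDelta : (3 <= Delta)%N) (hp : 0 < p < 1)
    (hpu : p < p_u q Delta) :
  exists2 C : R, 0 < C &
  exists (f g : nat -> R) (A B : R),
    [/\ Omega_id f, Omega_id g &
    forall (n : nat), (Delta < n)%N -> ~~ odd (Delta * n) ->
    forall (v : 'I_n) (k T : nat), (1 <= k)%N ->
      C * n%:R * ln n%:R <= T%:R ->
      1 - expR (- f k) - A / n%:R ^+ 5 <=
        rrg_prob R Delta (fun G : {set {set 'I_n}} =>
          fk_prob p q G G T (fun w => (k <= #|open_cluster w v|)%N)
            <= expR (- g k) + B / n%:R ^+ 5)].
Proof.
case: Delta hDelta hpu => // d d2 hpu; have d0 : (0 < d)%N by lia.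
have [h [b [lam [theta [rho [lam0 near [th1 /andP[r0 r1]] branch rt]]]]]] :=
  branching_constants hq hp d0 hpu.
have [K KE] : exists K, K = region_size d h by eexists.
have K1 : (0 < K)%N by rewrite KE.
have kK : (0 : R) < K%:R by rewrite ltr0n.
pose kap : R := - ln rho.
have kap0 : 0 < kap by rewrite oppr_gt0 ln_lt0 // r0.
have rhoX m : rho ^+ m = expR (- (kap * m%:R)).
  by rewrite -mulNr opprK mulrC expRM_natl lnK // posrE.
(* Chosen for the walk length [L] below, which is twice [d.+2 + M * K] with [M] at most
   [5 * ln n / kap + 1]. *)
pose a : R := 10 * K%:R / kap; pose a' : R := 2 * (d.+2%:R + K%:R).
have a0 : 0 <= a by rewrite divr_ge0 ?mulr_ge0 ?ler0n // ltW.
have a'0 : 0 <= a' by apply: mulr_ge0 => //; apply: addr_ge0; apply: ler0n.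
have [J [A [A0 dense]]] := dense_near_prob d a0 a'0.
have [w wE] : exists w, w = (d.+1 + (K * K).+1 * (3 * J))%N by eexists.
pose A1 := theta ^+ w.
have A1_1 : 1 <= A1 by exact: exprn_ege1.
have A1_0 : 0 < A1 by exact: lt_le_trans A1_1.
have B0 : 0 <= A1 + b%:R * d.+1%:R by rewrite addr_ge0 ?mulr_ge0 ?ler0n // ltW.
(* Absorbs the prefactor [A1], the initial star and the rounding of the number of regions. *)
pose c0 := ln A1 + kap * (1 + d.+3%:R / K%:R).
(* There is room for [b] blocks of length [l]; the last 1 absorbs the rounding of [l], as
   [n * ln n >= 1]. *)
exists ((b%:R + 1) * (6 * d.+1%:R + 1)).
  by rewrite mulr_gt0 // ltr_wpDl ?mulr_ge0 ?ler0n.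
exists (fun k => k%:R), (fun k => kap / K%:R * k%:R - c0), A, (A1 + b%:R * d.+1%:R); split.
- by exists 1 => //; exists 0%N => k _; rewrite mul1r.
- have e0 : 0 < kap / K%:R / 2 by rewrite !divr_gt0.
  exists (kap / K%:R / 2) => //; exists (Num.truncn (c0 / (kap / K%:R / 2))).+1 => k kk.
  have : c0 / (kap / K%:R / 2) <= k%:R.
    by apply/ltW; apply: lt_le_trans (truncnS_gt _) _; rewrite ler_nat.
  rewrite ler_pdivrMr //; move: (kap / K%:R) (k%:R : R) => x y; lra.
move=> n Dn ev v k T k1 CT; have n4 : (4 <= n)%N by exact: leq_trans Dn.
have n0 : (0 < n)%N by exact: leq_trans n4.
have nR : (0 : R) < n%:R by rewrite ltr0n.
have n5 : (0 : R) < n%:R ^+ 5 by exact: exprn_gt0.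
have l0 : 0 <= ln (n%:R : R) by rewrite ln_ge0 // ler1n.
have nln : 1 <= n%:R * ln n%:R :> R.
  have := expR_ge1Dx (- ln (n%:R : R)); rewrite expRN lnK ?posrE // => hh.
  have : (n%:R : R)^-1 * n%:R = 1 by rewrite mulVf // lt0r_neq0.
  have : (4 : R) <= n%:R by rewrite ler_nat.
  by move: (n%:R : R) ((n%:R : R)^-1) (ln (n%:R : R)) hh => z x y; nra.
(* After [M] regions [rho ^+ M] is at most [n ^ -5]; stopping there, only neighbourhoods of
   logarithmic size have to be sparse. *)
pose M := (Num.truncn (5 / kap * ln (n%:R : R))).+1.
have M1 : 5 * ln (n%:R : R) <= kap * M%:R.
  have := ltW (truncnS_gt (5 / kap * ln (n%:R : R))); rewrite -/M.
  by rewrite mulrAC ler_pdivrMr // [kap * _]mulrC.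
have M2 : kap * M%:R <= 5 * ln (n%:R : R) + kap.
  rewrite /M -natr1 mulrDr mulr1 lerD2r mulrC -ler_pdivlMr // mulrAC.
  by rewrite truncn_le !mulr_ge0 // invr_ge0 ltW.
pose L := (d.+2 + M * K).*2.
have LB : L%:R <= a * ln n%:R + a'.
  have : M%:R <= 5 * ln n%:R / kap + 1 by rewrite -(ler_pM2l kap0) mulrDr mulr1 mulrCA divff ?mulr1 // lt0r_neq0.
  rewrite /L /a /a' -mul2n natrM natrD natrM => hM.
  have := ler_wpM2r (ltW kK) hM.
  have -> : 10 * K%:R / kap * ln n%:R = 2 * (5 * ln n%:R / kap * K%:R) by ring.
  by move: (M%:R * _) (_ / kap) => x y; lra.
have few := dense n v L LB.
have [E0 rE0] := regular_exists Dn ev.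
have Y0 : (0 < #|regular_graphs n d.+1|)%N by apply/card_gt0P; exists E0; rewrite inE.
apply: (@le_trans _ _ (1 - A / n%:R ^+ 5)).
  by rewrite lerD2r gerBl expR_ge0.
rewrite /rrg_prob; set good := [set E in _ | _].
set X := [set E | _ & _] in few.
have YX : (#|regular_graphs n d.+1| <= #|good| + #|X|)%N.
  apply: leq_trans (leq_card_setU _ _); apply: subset_leq_card.
  apply/fintype.subsetP => G; rewrite inE => rG.
  rewrite in_setU orbC [G \in X]inE rG /=.
  case: (boolP (dense_near v L J G)) => //= sp; rewrite /good !inE rG /=.
  have G0 := card_edges_gt0 v (ltn0Sn d) rG.
  (* When the star at [v] may already have [k] vertices, [c0] makes the claimed bound at least 1. *)
  have [kd|kd] := leqP k d.+2.
    apply: le_trans (fk_prob_le1 hq hp _ _ _ G0) _.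
    apply: ler_wpDr; first exact: divr_ge0 B0 (ltW n5).
    rewrite -[leLHS]expR0 ler_expR opprB subr_ge0 /c0.
    have lA : 0 <= ln A1 by exact: ln_ge0.
    have : k%:R <= d.+3%:R :> R by rewrite ler_nat ltnW.
    move/(ler_wpM2l (ltW (divr_gt0 kap0 kK))).
    have -> : kap * (1 + d.+3%:R / K%:R) = kap + kap / K%:R * d.+3%:R by ring.
    by move=> h1; apply: le_trans h1 _; rewrite addrA lerDr addr_ge0 // ltW.
  (* As many regions as keep the discovered set below [k] vertices, but at most [M]: [rho ^+ m0]
     decays exponentially in [k], while [rho ^+ M] is the error of order [n ^ -5]. *)
  pose m0 := ((k - d.+3) %/ K)%N; pose m := minn m0 M.
  have mk : (d.+2 + m * K < k)%N.
    have : (m * K <= m0 * K)%N by rewrite leq_mul2r geq_minl orbT.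
    have : (m0 * K <= k - d.+3)%N by exact: leq_trunc_div.
    by move=> h1 h2; exact: add_lt_of_le_sub (leq_trans h2 h1) kd.
  have mL : ((d.+2 + m * K).*2 <= L)%N.
    by rewrite leq_double leq_add2l leq_mul2r geq_minr orbT.
  pose l := (Num.truncn (6 * d.+1%:R * n%:R * ln (n%:R : R))).+1.
  have x0 : 0 <= 6 * d.+1%:R * n%:R * ln (n%:R : R) by rewrite !mulr_ge0 ?ler0n.
  have l1 : 6 * d.+1%:R * n%:R * ln (n%:R : R) <= l%:R by exact/ltW/truncnS_gt.
  have l2 : l%:R <= (6 * d.+1%:R + 1) * (n%:R * ln (n%:R : R)).
    have -> : (6 * d.+1%:R + 1) * (n%:R * ln n%:R) =
      6 * d.+1%:R * n%:R * ln n%:R + n%:R * ln n%:R :> R by ring.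
    rewrite /l -[leLHS]natr1; apply: lerD => //.
    by rewrite truncn_le.
  have bT : (b * l <= T)%N.
    rewrite -(ler_nat R) natrM; apply: le_trans CT.
    rewrite -!mulrA; apply: ler_pM; rewrite ?ler0n // lerDl //.
  rewrite KE in mk mL.
  apply: le_trans (fk_cluster_tail hq hp rG lam0 near th1 _ branch rt sp mL mk bT) _.
    by rewrite r0 ltW.
  rewrite -KE -wE -/A1 mulrDl addrA; apply: lerD; last first.
    rewrite -mulrA; apply: ler_wpM2l; first exact: ler0n.
    apply: le_trans (miss_bound n0 G0 _ l1); last by have := card_edges_le rG; rewrite card_ord.
    by apply: ler_wpM2l; [exact: ler0n|exact: miss_le_exp].
  rewrite /m; case: leqP => _.
    apply: ler_wpDr; first exact: divr_ge0 (ltW A1_0) (ltW n5).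
    rewrite rhoX -[A1 in leLHS]lnK ?posrE // -expRD ler_expR /c0.
    have : (k <= d.+3 + (m0 * K + K))%N.
      have := ltn_ceil (k - d.+3) K1; rewrite -/m0 mulSn.
      by rewrite addnC => h1; exact: (le_add_of_sub_lt h1 kd).
    rewrite -(ler_nat R) !natrD natrM.
    move/(ler_wpM2l (ltW (divr_gt0 kap0 kK))).
    have -> : kap * (1 + d.+3%:R / K%:R) = kap + kap / K%:R * d.+3%:R by ring.
    rewrite !mulrDr mulrCA [_ * K%:R]divfK ?lt0r_neq0 // [m0%:R * _]mulrC.
    move: (kap / _ * _) (kap / _ * _) (kap * _) => x y z; lra.
  apply: ler_wpDl; first exact: expR_ge0.
  apply: ler_wpM2l; first exact: le_trans A1_1.
  by rewrite rhoX -expR_ln_nat // -expRN ler_expR lerN2.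
have YR : (0 : R) < #|regular_graphs n d.+1|%:R by rewrite ltr0n.
rewrite ler_pdivlMr // mulrBl mul1r lerBlDr.
apply: (@le_trans _ _ (#|good|%:R + #|X|%:R)); first by rewrite -natrD ler_nat.
by rewrite lerD2l -ler_pdivrMr.
Qed.
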